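(* Let $\alpha>-1$, let $M>0$ be a constant, and let $f\in\mathcal{C}^2(\mathbb{D})$ be a solution of the Dirichlet problem $T_\alpha(f)=0$ in $\mathbb{D}$, $f=f^*$ on $\partial\mathbb{D}$ (in the distributional sense), with the series expansion $$f(z)=\sum_{k=0}^{\infty}c_kF\left(-\frac{\alpha}{2},k-\frac{\alpha}{2};k+1;|z|^2\right)z^k+\sum_{k=1}^{\infty}c_{-k}F\left(-\frac{\alpha}{2},k-\frac{\alpha}{2};k+1;|z|^2\right)\bar z^{\,k},\quad z\in\mathbb{D},$$ where $\{c_k\}_{k=-\infty}^{\infty}$ is a sequence of complex numbers with $\limsup_{|k|\to\infty}|c_k|^{1/|k|}\le1$, and suppose $\sup_{z\in\mathbb{D}}|f(z)|\le M$. Then, for every $k\in\{1,2,\ldots\}$, $$\left|c_kF\left(-\frac{\alpha}{2},k-\frac{\alpha}{2};k+1;1\right)\right|+\left|c_{-k}F\left(-\frac{\alpha}{2},k-\frac{\alpha}{2};k+1;1\right)\right|\le\frac{4M}{\pi},$$ and $$\left|c_0F\left(-\frac{\alpha}{2},-\frac{\alpha}{2};1;1\right)\right|\le M.$$ In particular, if $\alpha=0$, then the first estimate (for each $k\ge1$) is sharp, and all the extremal functions (those for which equality holds for the given $k$) are $$f_k(z)=\frac{2\varepsilon M}{\pi}\,\mathrm{Im}\left(\log\frac{1+\vartheta z^k}{1-\vartheta z^k}\right),\qquad |\varepsilon|=|\vartheta|=1.$$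
   Context: $\mathbb{D}$ is the open unit disk in $\mathbb{C}$; $\mathcal{C}^2(\mathbb{D})$ is the set of twice continuously differentiable complex-valued functions on $\mathbb{D}$. With $\frac{\partial}{\partial z}=\frac12(\frac{\partial}{\partial x}-i\frac{\partial}{\partial y})$, $\frac{\partial}{\partial\bar z}=\frac12(\frac{\partial}{\partial x}+i\frac{\partial}{\partial y})$ and $\Delta=4\frac{\partial^2}{\partial z\partial\bar z}$, for $\alpha\in\mathbb{R}$ the operator $T_\alpha$ is $$T_{\alpha}=-\frac{\alpha^{2}}{4}(1-|z|^{2})^{-\alpha-1}+\frac{\alpha}{2}(1-|z|^{2})^{-\alpha-1}\left(z\frac{\partial}{\partial z}+\bar z\frac{\partial}{\partial\bar z}\right)+\frac14(1-|z|^2)^{-\alpha}\Delta .$$ The Dirichlet problem means: $T_\alpha(f)=0$ in $\mathbb{D}$, and for a distribution $f^*\in\mathfrak{D}'(\partial\mathbb{D})$ the functions $f_r(e^{i\theta})=f(re^{i\theta})$, $r\in[0,1)$, converge to $f^*$ in $\mathfrak{D}'(\partial\mathbb{D})$ as $r\to1^-$. The hypergeometric function is $F(a,b;c;x)=\sum_{n=0}^\infty\frac{(a)_n(b)_n}{(c)_n}\frac{x^n}{n!}$ for $|x|<1$, with $(a)_0=1$, $(a)_n=a(a+1)\cdots(a+n-1)$, and $F(a,b;c;1)=\lim_{x\to1^-}F(a,b;c;x)$. (For $\alpha=0$ all the hypergeometric factors above are identically $1$. The logarithm is the branch on the right half-plane with $\log 1=0$.) *)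

(* Defs.v *)
From Stdlib Require Export Reals ZArith.
From Coquelicot Require Export Coquelicot.

Open Scope R_scope.

Definition in_disk (z : C) : Prop := Cmod z < 1.

(* [f] is only meaningful on the open disk; its values elsewhere are arbitrary.
   [ex_diff_n g 2 x y]: all partial derivatives of [g] of order at most 2 exist
   and are continuous at (x, y). *)
Definition C2_disk (f : C -> C) : Prop :=
  forall x y : R, in_disk (x, y) ->
    ex_diff_n (fun s t => Re (f (s, t))) 2 x y /\
    ex_diff_n (fun s t => Im (f (s, t))) 2 x y.

Definition d_dx (f : C -> C) (z : C) : C :=
  (Derive (fun s => Re (f (s, Im z))) (Re z),
   Derive (fun s => Im (f (s, Im z))) (Re z)).

Definition d_dy (f : C -> C) (z : C) : C :=
  (Derive (fun t => Re (f (Re z, t))) (Im z),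
   Derive (fun t => Im (f (Re z, t))) (Im z)).

Definition d_dz (f : C -> C) (z : C) : C :=
  (RtoC (1 / 2) * (d_dx f z - Ci * d_dy f z))%C.

Definition d_dzbar (f : C -> C) (z : C) : C :=
  (RtoC (1 / 2) * (d_dx f z + Ci * d_dy f z))%C.

Definition Laplacian (f : C -> C) (z : C) : C :=
  (RtoC 4 * d_dz (d_dzbar f) z)%C.

Definition T_op (alpha : R) (f : C -> C) (z : C) : C :=
  let w := 1 - Cmod z ^ 2 in
  (RtoC (- (alpha ^ 2 / 4) * Rpower w (- alpha - 1)) * f z
   + RtoC (alpha / 2 * Rpower w (- alpha - 1))
     * (z * d_dz f z + Cconj z * d_dzbar f z)
   + RtoC (1 / 4 * Rpower w (- alpha)) * Laplacian f z)%C.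

(* Smooth functions on the unit circle are represented as smooth 2pi-periodic
   functions of the angle. *)
Definition test_function (phi : R -> C) : Prop :=
  (forall (n : nat) (t : R),
     ex_derive_n (fun s => Re (phi s)) n t /\
     ex_derive_n (fun s => Im (phi s)) n t) /\
  (forall t : R, phi (t + 2 * PI) = phi t).

Definition CDerive_n (phi : R -> C) (n : nat) (t : R) : C :=
  (Derive_n (fun s => Re (phi s)) n t, Derive_n (fun s => Im (phi s)) n t).

(* Linear functionals on test functions, continuous for the topology of the
   seminorms phi |-> max_{j <= N} sup_t |phi^(j)(t)|. *)
Definition circle_distribution (u : (R -> C) -> C) : Prop :=
  (forall phi psi : R -> C, test_function phi -> test_function psi ->
     u (fun t => (phi t + psi t)%C) = (u phi + u psi)%C) /\
  (forall (a : C) (phi : R -> C), test_function phi ->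
     u (fun t => (a * phi t)%C) = (a * u phi)%C) /\
  (exists (N : nat) (K : R), forall (phi : R -> C) (B : R),
     test_function phi ->
     (forall (j : nat) (t : R), (j <= N)%nat -> Cmod (CDerive_n phi j t) <= B) ->
     Cmod (u phi) <= K * B).

Definition polar (r t : R) : C := (r * cos t, r * sin t).

(* The distribution defined by the function g(e^{it}), with respect to the
   normalized arc length dt / 2pi. *)
Definition function_pairing (g : R -> C) (phi : R -> C) : C :=
  (RtoC (/ (2 * PI)) *
   RInt (V := C_R_CompleteNormedModule)
        (fun t => (g t * phi t)%C) 0 (2 * PI))%C.

Definition boundary_value (f : C -> C) (fstar : (R -> C) -> C) : Prop :=
  forall phi : R -> C, test_function phi ->
    filterlim (fun r : R => function_pairing (fun t => f (polar r t)) phi)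
              (at_left 1) (locally (fstar phi)).

Definition dirichlet_solution
    (alpha : R) (f : C -> C) (fstar : (R -> C) -> C) : Prop :=
  C2_disk f /\
  (forall z : C, in_disk z -> T_op alpha f z = RtoC 0) /\
  circle_distribution fstar /\
  boundary_value f fstar.

Fixpoint pochhammer (a : R) (n : nat) : R :=
  match n with
  | O => 1
  | S m => pochhammer a m * (a + INR m)
  end.

Definition hyp_coef (a b c : R) (n : nat) : R :=
  pochhammer a n * pochhammer b n / pochhammer c n / INR (fact n).

(* Used only for 0 <= x <= 1. *)
Definition hypergeom (a b c x : R) : R :=
  if Req_EM_T x 1
  then iota (fun l : R =>
         filterlim (PSeries (hyp_coef a b c)) (at_left 1) (locally l))
  else PSeries (hyp_coef a b c) x.

(* F(-alpha/2, k - alpha/2; k + 1; x) *)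
Definition F_alpha (alpha : R) (k : nat) (x : R) : R :=
  hypergeom (- (alpha / 2)) (INR k - alpha / 2) (INR k + 1) x.

Definition has_expansion (alpha : R) (c : Z -> C) (f : C -> C) : Prop :=
  forall z : C, in_disk z ->
    exists s1 s2 : C,
      is_series (K := C_AbsRing) (V := C_NormedModule)
        (fun k : nat =>
           (c (Z.of_nat k) * RtoC (F_alpha alpha k (Cmod z ^ 2))
            * Cpow z k)%C) s1 /\
      is_series (K := C_AbsRing) (V := C_NormedModule)
        (fun j : nat =>
           (c (- Z.of_nat (S j))%Z * RtoC (F_alpha alpha (S j) (Cmod z ^ 2))
            * Cpow (Cconj z) (S j))%C) s2 /\
      f z = (s1 + s2)%C.

(* [Rpower 0 y] is 1, hence the case distinction. *)
Definition nth_root (n : nat) (x : R) : R :=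
  if Req_EM_T x 0 then 0 else Rpower x (/ INR n).

(* limsup of u k as |k| tends to infinity *)
Definition LimSup_Z (u : Z -> R) : Rbar :=
  Inf_seq (fun n : nat =>
    Lub_Rbar (fun x : R =>
      exists k : Z, (Z.of_nat n <= Z.abs k)%Z /\ x = u k)).

Definition bounded_solution
    (alpha M : R) (f : C -> C) (fstar : (R -> C) -> C) (c : Z -> C) : Prop :=
  dirichlet_solution alpha f fstar /\
  has_expansion alpha c f /\
  Rbar_le (LimSup_Z (fun k => nth_root (Z.abs_nat k) (Cmod (c k)))) 1 /\
  (forall z : C, in_disk z -> Cmod (f z) <= M).

(* The branch with Clog 1 = 0 on the right half-plane; not meaningful elsewhere. *)
Definition Clog (z : C) : C := (ln (Cmod z), atan (Im z / Re z)).

Definition extremal_map (M : R) (k : nat) (eps theta z : C) : C :=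
  (RtoC 2 * eps * RtoC M / RtoC PI
   * RtoC (Im (Clog ((RtoC 1 + theta * Cpow z k)
                     / (RtoC 1 - theta * Cpow z k)))))%C.

(* Equality holds for index k in the coefficient estimate with alpha = 0. *)
Definition extremal (M : R) (k : nat) (f : C -> C) : Prop :=
  exists (fstar : (R -> C) -> C) (c : Z -> C),
    bounded_solution 0 M f fstar c /\
    Cmod (c (Z.of_nat k) * RtoC (F_alpha 0 k 1))
    + Cmod (c (- Z.of_nat k)%Z * RtoC (F_alpha 0 k 1)) = 4 * M / PI.

(* Main.v *)
Require Import Defs.
From Stdlib Require Import Lra Lia Psatz.

(** Integrating the expansion over the circle of radius [r] gives the Fourier
    coefficients [c_k F_k(r^2) r^|k|]. Write [c_k = |c_k| e^{i(gamma + beta)}] and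
    [c_{-k} = |c_{-k}| e^{i(gamma - beta)}]; then
    [F_k(r^2) r^k (|c_k| + |c_{-k}|)] is [1 / pi] times the integral of
    [e^{-i gamma} f(r e^{it}) cos(kt + beta)], hence at most [(M / pi) * 4] in modulus,
    and [r -> 1] gives the estimate.

    For [alpha = 0], equality forces [e^{-i gamma} f(r e^{it})] to approach
    [M sgn(cos(kt + beta))] in the weighted norm [L^1(|cos(kt + beta)| dt)]. The extremal
    map with [eps = e^{i gamma}] and [vartheta = i e^{i beta}] does the same, so the
    difference [d_r] of the two functions tends to [0] in that norm. It is bounded, and
    [1 <= sin^{2m} + m cos^2] with [int sin^{2m} -> 0], so all its Fourier coefficients
    vanish. *)

(** * Complex series and integrals *)

(** The boundary datum is only a distribution, so the equality case cannot be read off from a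
    boundary function; everything is measured on circles of radius r < 1. With w = cos(kt + beta),
    the bound M |w| integrates to 4M for all k >= 1 and all beta, which is the origin of 4M / pi. If
    alpha = 0 and equality holds, the integral of M |w| - Re(e^{-i gamma} f) w is exactly 4M (1 -
    r^k), an explicit quantity tending to 0. The weight |w| vanishes at the zeros of the cosine, so
    smallness in the weighted norm gives no control near them. There only the bound 2M on the
    difference is available, and the term sin^{2m} confines its use to a set of small weight. The
    converse needs the extremal map to be a full solution, boundary distribution included. Its
    coefficients and the Fourier coefficients of a test function are both O(1/|n|), so their
    products are summable and the pairings converge by dominated convergence. *)

Definition cis (t : R) : C := (cos t, sin t).

Lemma C_ext (z w : C) : Re z = Re w -> Im z = Im w -> z = w.
Proof. destruct z, w; simpl; intros; subst; reflexivity. Qed.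

Lemma Cmod_sq (z : C) : Cmod z ^ 2 = Re z ^ 2 + Im z ^ 2.
Proof.
unfold Cmod. rewrite pow2_sqrt; [reflexivity|].
generalize (pow2_ge_0 (fst z)) (pow2_ge_0 (snd z)); lra.
Qed.

Lemma Cmod_eq_of_sq (z : C) (r : R) :
  0 <= r -> Re z ^ 2 + Im z ^ 2 = r ^ 2 -> Cmod z = r.
Proof.
intros Hr H. rewrite <- Cmod_sq in H.
apply Rsqr_inj; auto using Cmod_ge_0. unfold Rsqr. nra.
Qed.

Lemma Cmod_cis t : Cmod (cis t) = 1.
Proof.
apply Cmod_eq_of_sq; [lra|]. simpl.
generalize (sin2_cos2 t); unfold Rsqr; lra.
Qed.

Lemma cis_0 : cis 0 = RtoC 1.
Proof. unfold cis, RtoC. now rewrite cos_0, sin_0. Qed.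

Lemma cis_plus a b : cis (a + b) = (cis a * cis b)%C.
Proof. apply C_ext; simpl; [apply cos_plus | rewrite sin_plus; ring]. Qed.

Lemma Cconj_cis t : Cconj (cis t) = cis (- t).
Proof. apply C_ext; simpl; [now rewrite cos_neg | now rewrite sin_neg]. Qed.

Lemma cis_pow t n : Cpow (cis t) n = cis (INR n * t).
Proof.
induction n as [|n IH].
- simpl. now rewrite Rmult_0_l, cis_0.
- rewrite Cpow_S, IH, <- cis_plus, S_INR. f_equal; ring.
Qed.

Lemma polar_cis r t : polar r t = (RtoC r * cis t)%C.
Proof. apply C_ext; simpl; ring. Qed.

Lemma Cmod_polar r t : 0 <= r -> Cmod (polar r t) = r.
Proof.
intros Hr. rewrite polar_cis, Cmod_mult, Cmod_cis, Cmod_R, Rabs_pos_eq; lra.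
Qed.

Lemma unit_cis z : Cmod z = 1 -> exists t, z = cis t.
Proof.
intros H. assert (H2 := Cmod_sq z). rewrite H in H2.
destruct z as [x y]; simpl in H2.
assert (Hx : -1 <= x <= 1) by nra.
assert (Hs : sin (acos x) = sqrt (1 - x²)) by (apply sin_acos; lra).
assert (Hyy : 1 - x² = y²) by (unfold Rsqr; lra).
rewrite Hyy, sqrt_Rsqr_abs in Hs.
destruct (Rle_dec 0 y) as [Hy|Hy].
- exists (acos x). apply C_ext; simpl; [now rewrite cos_acos|].
  rewrite Hs, Rabs_pos_eq; auto.
- exists (- acos x). apply C_ext; simpl; [now rewrite cos_neg, cos_acos|].
  rewrite sin_neg, Hs, Rabs_left; lra.
Qed.

Lemma polar_form z : exists t, z = (RtoC (Cmod z) * cis t)%C.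
Proof.
destruct (Req_dec (Cmod z) 0) as [H|H].
- exists 0. rewrite H. apply Cmod_eq_0 in H. rewrite H. ring.
- destruct (unit_cis (z / RtoC (Cmod z))%C) as [t Ht].
  + rewrite Cmod_div by (intros E; apply H; injection E; auto).
    rewrite Cmod_R, Rabs_pos_eq by apply Cmod_ge_0. field; auto.
  + exists t. rewrite <- Ht. field. intros E; apply H; injection E; auto.
Qed.

Notation is_series_C := (is_series (K := C_AbsRing) (V := C_NormedModule)).
Notation is_RInt_C := (is_RInt (V := C_R_NormedModule)).

Lemma sum_n_Re (a : nat -> C) n :
  Re (sum_n (G := C_AbelianMonoid) a n) = sum_n (fun k => Re (a k)) n.
Proof.
induction n as [|n IH]; [now rewrite !sum_O|].
rewrite !sum_Sn, <- IH. reflexivity.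
Qed.

Lemma sum_n_Im (a : nat -> C) n :
  Im (sum_n (G := C_AbelianMonoid) a n) = sum_n (fun k => Im (a k)) n.
Proof.
induction n as [|n IH]; [now rewrite !sum_O|].
rewrite !sum_Sn, <- IH. reflexivity.
Qed.

Lemma filterlim_C {T} (F : (T -> Prop) -> Prop) {FF : Filter F} (f : T -> C) (l : C) :
  filterlim f F (locally (T := C_UniformSpace) l) <->
  filterlim (fun x => Re (f x)) F (locally (Re l)) /\
  filterlim (fun x => Im (f x)) F (locally (Im l)).
Proof.
split.
- intros H. split; intros P [e He].
  + apply (H (fun z => P (Re z))). exists e. intros z [H1 H2]. apply He, H1.
  + apply (H (fun z => P (Im z))). exists e. intros z [H1 H2]. apply He, H2.
- intros [H1 H2] P [e He].
  assert (A1 : F (fun x => ball (Re l) e (Re (f x)))) by apply (H1 _ (locally_ball (Re l) e)).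
  assert (A2 : F (fun x => ball (Im l) e (Im (f x)))) by apply (H2 _ (locally_ball (Im l) e)).
  unfold filtermap.
  apply (filter_imp (fun x => ball (Re l) e (Re (f x)) /\ ball (Im l) e (Im (f x))));
    [|now apply filter_and].
  intros x [Hx Hy]. apply He. split; assumption.
Qed.

Lemma is_series_C_iff (a : nat -> C) (l : C) :
  is_series_C a l <->
  is_series (fun k => Re (a k)) (Re l) /\ is_series (fun k => Im (a k)) (Im l).
Proof.
unfold is_series.
etransitivity; [apply (filterlim_C eventually (sum_n a) l)|].
split; intros [H1 H2]; split;
 [ eapply filterlim_ext, H1 | eapply filterlim_ext, H2
 | eapply filterlim_ext, H1 | eapply filterlim_ext, H2 ];
 intros n; first [exact (sum_n_Re a n) | exact (sum_n_Im a n)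
   | exact (eq_sym (sum_n_Re a n)) | exact (eq_sym (sum_n_Im a n))].
Qed.

Lemma is_series_C_unique (a : nat -> C) (l l' : C) :
  is_series_C a l -> is_series_C a l' -> l = l'.
Proof.
intros H1 H2. apply is_series_C_iff in H1; apply is_series_C_iff in H2.
destruct H1 as [A1 A2], H2 as [B1 B2].
apply C_ext; [rewrite <- (is_series_unique _ _ A1); now apply is_series_unique
 | rewrite <- (is_series_unique _ _ A2); now apply is_series_unique].
Qed.

Lemma is_series_C_ext (a b : nat -> C) (l : C) :
  (forall n, a n = b n) -> is_series_C a l -> is_series_C b l.
Proof. intros H. apply is_series_ext, H. Qed.

Lemma Rabs_Re_le (z : C) : Rabs (Re z) <= Cmod z.
Proof.
apply Rsqr_incr_0; auto using Cmod_ge_0, Rabs_pos.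
rewrite <- Rsqr_abs. unfold Rsqr. generalize (Cmod_sq z) (pow2_ge_0 (Im z)). nra.
Qed.

Lemma Rabs_Im_le (z : C) : Rabs (Im z) <= Cmod z.
Proof.
apply Rsqr_incr_0; auto using Cmod_ge_0, Rabs_pos.
rewrite <- Rsqr_abs. unfold Rsqr. generalize (Cmod_sq z) (pow2_ge_0 (Re z)). nra.
Qed.

Lemma ex_series_C_abs (a : nat -> C) (b : nat -> R) :
  (forall n, Cmod (a n) <= b n) -> ex_series b -> exists l, is_series_C a l.
Proof.
intros Hab Hb.
assert (H1 : ex_series (fun k => Re (a k))).
{ apply (ex_series_le (K := R_AbsRing) (V := R_CompleteNormedModule) _ b); [|assumption].
  intros n. eapply Rle_trans; [apply Rabs_Re_le | apply Hab]. }
assert (H2 : ex_series (fun k => Im (a k))).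
{ apply (ex_series_le (K := R_AbsRing) (V := R_CompleteNormedModule) _ b); [|assumption].
  intros n. eapply Rle_trans; [apply Rabs_Im_le | apply Hab]. }
destruct H1 as [l1 H1], H2 as [l2 H2].
exists (l1, l2). apply is_series_C_iff. split; assumption.
Qed.

Lemma is_RInt_C_iff (f : R -> C) (a b : R) (l : C) :
  is_RInt_C f a b l <->
  is_RInt (fun t => Re (f t)) a b (Re l) /\ is_RInt (fun t => Im (f t)) a b (Im l).
Proof.
split.
- intros H. split.
  + exact (is_RInt_fct_extend_fst (U := R_NormedModule) (V := R_NormedModule) f a b l H).
  + exact (is_RInt_fct_extend_snd (U := R_NormedModule) (V := R_NormedModule) f a b l H).
- intros [H1 H2]. rewrite (surjective_pairing l).
  apply (is_RInt_fct_extend_pair (U := R_NormedModule) (V := R_NormedModule) f a b _ _ H1 H2).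
Qed.

Lemma is_RInt_C_plus (f g : R -> C) a b (l m : C) :
  is_RInt_C f a b l -> is_RInt_C g a b m ->
  is_RInt_C (fun t => (f t + g t)%C) a b (l + m)%C.
Proof. apply (is_RInt_plus (V := C_R_NormedModule)). Qed.

Lemma is_RInt_C_scal (f : R -> C) a b (c l : C) :
  is_RInt_C f a b l -> is_RInt_C (fun t => (c * f t)%C) a b (c * l)%C.
Proof.
intros H. apply is_RInt_C_iff in H. destruct H as [H1 H2].
apply is_RInt_C_iff. split.
- exact (is_RInt_minus _ _ _ _ _ _ (is_RInt_scal _ _ _ (Re c) _ H1) (is_RInt_scal _ _ _ (Im c) _ H2)).
- exact (is_RInt_plus _ _ _ _ _ _ (is_RInt_scal _ _ _ (Re c) _ H2) (is_RInt_scal _ _ _ (Im c) _ H1)).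
Qed.

Lemma is_RInt_C_ext (f g : R -> C) a b (l : C) :
  (forall t, f t = g t) -> is_RInt_C f a b l -> is_RInt_C g a b l.
Proof. intros H. apply is_RInt_ext. intros; apply H. Qed.

Lemma Cmod_RInt_le (f : R -> C) (g : R -> R) a b (lf : C) (lg : R) :
  a <= b -> (forall t, Cmod (f t) <= g t) ->
  is_RInt_C f a b lf -> is_RInt g a b lg -> Cmod lf <= lg.
Proof.
intros Hab Hfg Hf Hg.
rewrite Cmod_norm.
apply (norm_RInt_le (V := C_R_NormedModule) f g a b lf lg); auto.
intros t _. rewrite <- Cmod_norm. apply Hfg.
Qed.

(** The triangle inequality bounds every finite block after N, and the bound survives the limit. The
    right-hand side depends on the majorant alone, which gives the uniformity behind both termwise
    integration and dominated convergence below. *)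
Lemma series_tail_le (u a : nat -> R) (g A : R) (N : nat) :
  (forall k, Rabs (u k) <= a k) -> is_series a A -> is_series u g ->
  Rabs (g - sum_n u N) <= A - sum_n a N.
Proof.
intros Hu Ha Hg.
assert (H : forall m, Rabs (sum_n u (m + N) - sum_n u N) <= sum_n a (m + N) - sum_n a N).
{ induction m as [|m IH].
  - simpl. rewrite !Rminus_diag, Rabs_R0. lra.
  - simpl. rewrite !sum_Sn. change plus with Rplus.
    replace (sum_n u (m + N) + u (S (m + N)) - sum_n u N)
      with ((sum_n u (m + N) - sum_n u N) + u (S (m + N))) by ring.
    eapply Rle_trans; [apply Rabs_triang|]. specialize (Hu (S (m + N))). lra. }
assert (La : is_lim_seq (fun m => sum_n a (m + N) - sum_n a N) (A - sum_n a N)).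
{ apply is_lim_seq_minus'; [|apply is_lim_seq_const].
  apply (is_lim_seq_incr_n (sum_n a)). exact Ha. }
assert (Lu : is_lim_seq (fun m => Rabs (sum_n u (m + N) - sum_n u N)) (Rabs (g - sum_n u N))).
{ apply (is_lim_seq_abs _ (g - sum_n u N)). apply is_lim_seq_minus'; [|apply is_lim_seq_const].
  apply (is_lim_seq_incr_n (sum_n u)). exact Hg. }
exact (is_lim_seq_le _ _ _ _ H Lu La).
Qed.

(** Weierstrass M-test: the tails of the majorant bound the remainders uniformly in t, and uniform
    convergence allows the integral and the sum to be exchanged. *)
Lemma is_RInt_series (u : nat -> R -> R) (a I : nat -> R) (g : R -> R) (x y : R) :
  (forall k t, Rabs (u k t) <= a k) -> ex_series a ->
  (forall k, is_RInt (u k) x y (I k)) ->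
  (forall t, is_series (fun k => u k t) (g t)) ->
  exists J, is_series I J /\ is_RInt g x y J.
Proof.
intros Hu [A HA] HI Hg.
destruct (filterlim_RInt (V := R_CompleteNormedModule)
  (fun N t => sum_n (fun k => u k t) N) x y eventually _ g (fun N => sum_n I N)) as [J [H1 H2]].
- intros N. induction N as [|N IH].
  + apply is_RInt_ext with (u O); [intros; now rewrite sum_O|]. rewrite sum_O. apply HI.
  + apply is_RInt_ext with (fun t => plus (sum_n (fun k => u k t) N) (u (S N) t)).
    { intros; now rewrite sum_Sn. }
    rewrite sum_Sn. apply (is_RInt_plus (V := R_NormedModule)); [exact IH | apply HI].
- apply filterlim_locally. intros e.
  generalize (proj1 (filterlim_locally _ _) HA e). apply filter_imp.
  intros N HN t. apply ball_sym in HN.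
  change (Rabs (sum_n (fun k => u k t) N - g t) < e).
  change (Rabs (A - sum_n a N) < e) in HN.
  rewrite Rabs_minus_sym.
  eapply Rle_lt_trans; [apply (series_tail_le _ a _ A N); auto|].
  eapply Rle_lt_trans; [apply Rle_abs | exact HN].
- exists J; split; assumption.
Qed.

Lemma is_RInt_series_C (u : nat -> R -> C) (a : nat -> R) (I : nat -> C) (g : R -> C) (x y : R) :
  (forall k t, Cmod (u k t) <= a k) -> ex_series a ->
  (forall k, is_RInt_C (u k) x y (I k)) ->
  (forall t, is_series_C (fun k => u k t) (g t)) ->
  exists J, is_series_C I J /\ is_RInt_C g x y J.
Proof.
intros Hu Ha HI Hg.
destruct (is_RInt_series (fun k t => Re (u k t)) a (fun k => Re (I k)) (fun t => Re (g t)) x y)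
  as [J1 [A1 B1]]; auto.
{ intros k t. eapply Rle_trans; [apply Rabs_Re_le | apply Hu]. }
{ intros k. specialize (HI k). now apply is_RInt_C_iff in HI as [H _]. }
{ intros t. specialize (Hg t). now apply is_series_C_iff in Hg as [H _]. }
destruct (is_RInt_series (fun k t => Im (u k t)) a (fun k => Im (I k)) (fun t => Im (g t)) x y)
  as [J2 [A2 B2]]; auto.
{ intros k t. eapply Rle_trans; [apply Rabs_Im_le | apply Hu]. }
{ intros k. specialize (HI k). now apply is_RInt_C_iff in HI as [_ H]. }
{ intros t. specialize (Hg t). now apply is_series_C_iff in Hg as [_ H]. }
exists (J1, J2). split; [apply is_series_C_iff | apply is_RInt_C_iff]; split; assumption.
Qed.

Lemma is_RInt_val (f : R -> R) (a b l l' : R) :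
  is_RInt f a b l -> l = l' -> is_RInt f a b l'.
Proof. now intros H <-. Qed.

Lemma is_RInt_cst (c a b : R) : is_RInt (fun _ => c) a b ((b - a) * c).
Proof. apply (is_RInt_const (V := R_NormedModule)). Qed.

(** * Fourier coefficients of absolutely convergent trigonometric series *)

Lemma cis_2PI_Z (n : Z) : cis (IZR n * (2 * PI)) = RtoC 1.
Proof.
assert (H : cis (2 * PI) = RtoC 1) by (apply C_ext; simpl; [apply cos_2PI | apply sin_2PI]).
assert (Hn : forall n, cis (INR n * (2 * PI)) = RtoC 1)
  by (intros m; rewrite <- cis_pow, H; apply Cpow_1_l).
destruct (Z_le_dec 0 n) as [h|h].
- rewrite <- (Z2Nat.id n h), <- INR_IZR_INZ. apply Hn.
- replace (IZR n * (2 * PI)) with (- (INR (Z.to_nat (- n)) * (2 * PI))).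
  + rewrite <- Cconj_cis, Hn. apply C_ext; simpl; ring.
  + rewrite INR_IZR_INZ, Z2Nat.id, opp_IZR by lia. ring.
Qed.

Lemma is_RInt_cis (m : Z) :
  is_RInt_C (fun t => cis (IZR m * t)) 0 (2 * PI)
    (if Z.eq_dec m 0 then RtoC (2 * PI) else RtoC 0).
Proof.
destruct (Z.eq_dec m 0) as [->|Hm].
- apply is_RInt_C_ext with (fun _ => RtoC 1).
  { intros t. now rewrite Rmult_0_l, cis_0. }
  apply is_RInt_C_iff. simpl. split.
  + eapply is_RInt_val; [apply is_RInt_cst | ring].
  + eapply is_RInt_val; [apply is_RInt_cst | ring].
- assert (Hm' : IZR m <> 0) by (intros E; apply Hm; now apply eq_IZR in E).
  assert (Hp := cis_2PI_Z m).
  injection Hp as Hc Hs.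
  apply is_RInt_C_iff. simpl. split.
  + apply is_RInt_val with (minus (sin (IZR m * (2 * PI)) / IZR m) (sin (IZR m * 0) / IZR m)).
    2: { rewrite Hs, Rmult_0_r, sin_0. unfold minus, plus, opp; simpl. field; auto. }
    apply (is_RInt_derive (fun t => sin (IZR m * t) / IZR m)).
    * intros t _. auto_derive; [auto|]. field; auto.
    * intros t _. apply (ex_derive_continuous (fun t => cos (IZR m * t))). now auto_derive.
  + apply is_RInt_val with (minus (- cos (IZR m * (2 * PI)) / IZR m) (- cos (IZR m * 0) / IZR m)).
    2: { rewrite Hc, Rmult_0_r, cos_0. unfold minus, plus, opp; simpl. field; auto. }
    apply (is_RInt_derive (fun t => - cos (IZR m * t) / IZR m)).
    * intros t _. auto_derive; [auto|]. field; auto.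
    * intros t _. apply (ex_derive_continuous (fun t => sin (IZR m * t))). now auto_derive.
Qed.

Lemma is_series_single (u : nat -> C) (k0 : nat) :
  (forall k, k <> k0 -> u k = RtoC 0) -> is_series_C u (u k0).
Proof.
intros H.
assert (G : forall v : nat -> R, (forall k, k <> k0 -> v k = 0) -> is_series v (v k0)).
{ intros v Hv.
  assert (Z : forall n, (n < k0)%nat -> sum_n v n = 0).
  { induction n as [|n IH]; intros Hn.
    - rewrite sum_O. apply Hv; lia.
    - rewrite sum_Sn, IH by lia. rewrite Hv by lia. apply Rplus_0_r. }
  assert (W : forall n, sum_n v (n + k0) = v k0).
  { induction n as [|n IH].
    - destruct k0 as [|m]; [apply sum_O|]. simpl. rewrite sum_Sn, Z by lia. apply Rplus_0_l.
    - simpl. rewrite sum_Sn, IH, (Hv (S (n + k0))) by lia. apply Rplus_0_r. }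
  apply (is_lim_seq_incr_n (sum_n v) k0 (v k0)).
  apply is_lim_seq_ext with (fun _ => v k0); [intros; now rewrite W|].
  apply is_lim_seq_const. }
apply is_series_C_iff. split.
- apply (G (fun k => Re (u k))). intros k Hk. now rewrite H.
- apply (G (fun k => Im (u k))). intros k Hk. now rewrite H.
Qed.

(** The two-sided sum is split into n = k and n = -(j + 1), as in [has_expansion], so that index 0
    is counted once and each half is an ordinary series. *)
Definition laurent_sum (a : Z -> C) (t : R) (l : C) : Prop :=
  exists s1 s2 : C,
    is_series_C (fun k => (a (Z.of_nat k) * cis (IZR (Z.of_nat k) * t))%C) s1 /\
    is_series_C (fun j => (a (- Z.of_nat (S j))%Z * cis (IZR (- Z.of_nat (S j)) * t))%C) s2 /\
    l = (s1 + s2)%C.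

(** Termwise integration against a bounded phi with moments m. The two halves are folded into one
    series whose term k carries the indices k and -(k + 1). It is applied with phi a character, for
    Fourier coefficients, and with phi a test function, for boundary values. *)
Lemma integral_laurent (a : Z -> C) (b : nat -> R) (g phi : R -> C) (B : R) (m : Z -> C) :
  (forall n, Cmod (a n) <= b (Z.abs_nat n)) -> ex_series b ->
  (forall t, Cmod (phi t) <= B) ->
  (forall n, is_RInt_C (fun t => (cis (IZR n * t) * phi t)%C) 0 (2 * PI) (m n)) ->
  (forall t, laurent_sum a t (g t)) ->
  exists J,
    is_series_C (fun k => (a (Z.of_nat k) * m (Z.of_nat k)
                  + a (- Z.of_nat (S k))%Z * m (- Z.of_nat (S k))%Z)%C) J /\
    is_RInt_C (fun t => (g t * phi t)%C) 0 (2 * PI) J.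
Proof.
intros Ha Hb HB Hm Hg.
apply (is_RInt_series_C
  (fun k t => (a (Z.of_nat k) * (cis (IZR (Z.of_nat k) * t) * phi t)
    + a (- Z.of_nat (S k))%Z * (cis (IZR (- Z.of_nat (S k)) * t) * phi t))%C)
  (fun k => (b k + b (S k)) * B)).
- intros k t.
  eapply Rle_trans; [apply Cmod_triangle|].
  rewrite !Cmod_mult, !Cmod_cis.
  generalize (Ha (Z.of_nat k)) (Ha (- Z.of_nat (S k))%Z) (HB t) (Cmod_ge_0 (phi t))
    (Cmod_ge_0 (a (Z.of_nat k))) (Cmod_ge_0 (a (- Z.of_nat (S k))%Z)).
  replace (Z.abs_nat (Z.of_nat k)) with k by lia.
  replace (Z.abs_nat (- Z.of_nat (S k))) with (S k) by lia.
  intros. rewrite Rmult_plus_distr_r. apply Rplus_le_compat; rewrite Rmult_1_l;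
  apply Rmult_le_compat; auto.
- apply (ex_series_scal_r B (fun k => b k + b (S k))).
  apply (ex_series_plus (K := R_AbsRing) (V := R_NormedModule)); [assumption|].
  now apply (ex_series_incr_1 (K := R_AbsRing) (V := R_NormedModule)) in Hb.
- intros k. apply is_RInt_C_plus; apply is_RInt_C_scal, Hm.
- intros t. destruct (Hg t) as [s1 [s2 [H1 [H2 ->]]]].
  apply (is_series_scal (K := C_AbsRing) (V := C_NormedModule) (phi t)) in H1.
  apply (is_series_scal (K := C_AbsRing) (V := C_NormedModule) (phi t)) in H2.
  assert (H := is_series_plus _ _ _ _ H1 H2).
  replace ((s1 + s2) * phi t)%C with (plus (scal (phi t) s1) (scal (phi t) s2) : C).
  2: { change ((phi t * s1 + phi t * s2) = (s1 + s2) * phi t)%C. ring. }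
  eapply is_series_C_ext; [|exact H]. intros n.
  match goal with |- ?x = ?y => change (x = y :> C) end.
  unfold plus, scal; simpl. unfold mult; simpl. ring.
Qed.

Lemma fourier_coef (a : Z -> C) (b : nat -> R) (g : R -> C) (n : Z) :
  (forall n, Cmod (a n) <= b (Z.abs_nat n)) -> ex_series b ->
  (forall t, laurent_sum a t (g t)) ->
  is_RInt_C (fun t => (g t * cis (- (IZR n * t)))%C) 0 (2 * PI) (RtoC (2 * PI) * a n)%C.
Proof.
intros Ha Hb Hg.
destruct (integral_laurent a b g (fun t => cis (- (IZR n * t))) 1
  (fun m => if Z.eq_dec (m - n) 0 then RtoC (2 * PI) else RtoC 0)) as [J [H1 H2]]; auto.
{ intros t. rewrite Cmod_cis; lra. }
{ intros m. eapply is_RInt_C_ext; [|apply (is_RInt_cis (m - n))].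
  intros t. rewrite <- cis_plus, minus_IZR. f_equal; ring. }
replace (RtoC (2 * PI) * a n)%C with J; [assumption|].
(* Orthogonality leaves one nonzero term of the folded series: index n sits in term n if n >= 0 and
   in term -n - 1 otherwise. *)
destruct (Z_le_dec 0 n) as [Hn|Hn].
- eapply is_series_C_unique; [exact H1|].
  match type of H1 with is_series ?u _ => assert (H := is_series_single u (Z.to_nat n)) end.
  cbv beta in H. rewrite (Z2Nat.id n Hn) in H.
  destruct (Z.eq_dec (n - n) 0) as [_|E]; [|lia].
  destruct (Z.eq_dec (- Z.of_nat (S (Z.to_nat n)) - n) 0) as [E|_]; [lia|].
  replace (RtoC (2 * PI) * a n)%C with (a n * RtoC (2 * PI)
    + a (- Z.of_nat (S (Z.to_nat n)))%Z * RtoC 0)%C by ring.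
  apply H. intros k Hk.
  destruct (Z.eq_dec (Z.of_nat k - n) 0) as [E|_]; [lia|].
  destruct (Z.eq_dec (- Z.of_nat (S k) - n) 0) as [E|_]; [lia|]. ring.
- eapply is_series_C_unique; [exact H1|].
  match type of H1 with is_series ?u _ => assert (H := is_series_single u (Z.to_nat (- n - 1))) end.
  cbv beta in H.
  replace (- Z.of_nat (S (Z.to_nat (- n - 1))))%Z with n in H by lia.
  destruct (Z.eq_dec (n - n) 0) as [_|E]; [|lia].
  destruct (Z.eq_dec (Z.of_nat (Z.to_nat (- n - 1)) - n) 0) as [E|_]; [lia|].
  replace (RtoC (2 * PI) * a n)%C with (a (Z.of_nat (Z.to_nat (- n - 1))) * RtoC 0
    + a n * RtoC (2 * PI))%C by ring.
  apply H. intros k Hk.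
  destruct (Z.eq_dec (Z.of_nat k - n) 0) as [E|_]; [lia|].
  destruct (Z.eq_dec (- Z.of_nat (S k) - n) 0) as [E|_]; [lia|]. ring.
Qed.

(** * Dominated convergence of series *)

Lemma filterlim_sum_n {T} (F : (T -> Prop) -> Prop) {FF : Filter F}
    (u : nat -> T -> R) (l : nat -> R) (N : nat) :
  (forall n, filterlim (u n) F (locally (l n))) ->
  filterlim (fun x => sum_n (fun n => u n x) N) F (locally (sum_n l N)).
Proof.
intros H. induction N as [|N IH].
- rewrite sum_O. eapply filterlim_ext; [|apply H]. intros; now rewrite sum_O.
- rewrite sum_Sn.
  apply filterlim_ext with (fun x => plus (sum_n (fun n => u n x) N) (u (S N) x)).
  { intros; now rewrite sum_Sn. }
  eapply filterlim_comp_2; [exact IH | apply H |].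
  apply (filterlim_plus (K := R_AbsRing) (V := R_NormedModule)).
Qed.

(** Dominated convergence for series along a filter. The limits inherit the majorant, so one cut-off
    N makes both tails small at once, and the remaining finite sum converges termwise. *)
Lemma tannery {T} (F : (T -> Prop) -> Prop) {FF : ProperFilter F}
    (u : nat -> T -> R) (l a : nat -> R) (s : T -> R) :
  (forall n, F (fun x => Rabs (u n x) <= a n)) -> ex_series a ->
  (forall n, filterlim (u n) F (locally (l n))) ->
  F (fun x => (forall n, Rabs (u n x) <= a n) /\ is_series (fun n => u n x) (s x)) ->
  exists L, is_series l L /\ filterlim s F (locally L).
Proof.
intros Hu [A HA] Hl Hs.
assert (Hla : forall n, Rabs (l n) <= a n).
{ intros n.
  assert (E : Rbar_le (Rabs (l n)) (a n)); [|exact E].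
  apply (filterlim_le (F := F) (fun x => Rabs (u n x)) (fun _ => a n)).
  - apply Hu.
  - eapply filterlim_comp; [apply Hl|]. apply (continuous_Rabs (l n)).
  - apply filterlim_const. }
assert (Hex : ex_series l).
{ apply (ex_series_le (K := R_AbsRing) (V := R_CompleteNormedModule) l a); [exact Hla | now exists A]. }
destruct Hex as [L HL]. exists L. split; [assumption|].
apply filterlim_locally. intros eps.
assert (He : 0 < eps / 3) by (generalize (cond_pos eps); lra).
destruct (proj1 (filterlim_locally _ _) HA (mkposreal _ He)) as [N HN].
specialize (HN N (le_n _)).
change (Rabs (sum_n a N - A) < eps / 3) in HN.
apply Rabs_def2 in HN.
assert (HF := filterlim_sum_n F u l N Hl).
assert (HF' := proj1 (filterlim_locally _ _) HF (mkposreal _ He)).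
generalize (filter_and _ _ HF' Hs). apply filter_imp.
intros x [H1 [H2 H3]].
change (Rabs (s x - L) < eps).
change (Rabs (sum_n (fun n => u n x) N - sum_n l N) < eps / 3) in H1.
assert (T1 := series_tail_le _ _ _ _ N H2 HA H3).
assert (T2 := series_tail_le _ _ _ _ N Hla HA HL).
replace (s x - L) with ((s x - sum_n (fun n => u n x) N)
  + (sum_n (fun n => u n x) N - sum_n l N) - (L - sum_n l N)) by ring.
unfold Rminus at 1. eapply Rle_lt_trans; [apply Rabs_triang|]. rewrite Rabs_Ropp.
eapply Rle_lt_trans; [apply Rplus_le_compat_r, Rabs_triang|]. lra.
Qed.

Lemma at_left_1_unit : at_left 1 (fun r => 0 < r < 1).
Proof.
exists (mkposreal 1 Rlt_0_1). intros y Hy Hy1.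
change (Rabs (y - 1) < 1) in Hy. apply Rabs_def2 in Hy. lra.
Qed.

Lemma at_left_1_filter : ProperFilter (at_left 1).
Proof. apply at_left_proper_filter. Qed.

Lemma continuous_at_left (f : R -> R) (x : R) :
  continuous f x -> filterlim f (at_left x) (locally (f x)).
Proof.
intros H P HP. apply (filter_le_within (F := locally x)). apply H, HP.
Qed.

Lemma pow_le_1 r n : 0 <= r <= 1 -> r ^ n <= 1.
Proof. intros H. rewrite <- (pow1 n). now apply pow_incr. Qed.

(** Abel's limit theorem under absolute convergence, where |a n| itself is a majorant for all x in
    (0, 1). *)
Lemma PSeries_abel (a : nat -> R) :
  ex_series (fun n => Rabs (a n)) ->
  filterlim (PSeries a) (at_left 1) (locally (Series a)).
Proof.
intros Ha.
destruct (tannery (at_left 1) (fun n x => a n * x ^ n) a (fun n => Rabs (a n)) (PSeries a))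
  as [L [H1 H2]]; auto.
- intros n. generalize at_left_1_unit. apply filter_imp. intros x Hx.
  rewrite Rabs_mult, (Rabs_pos_eq (x ^ n)) by (apply pow_le; lra).
  generalize (pow_le_1 x n) (Rabs_pos (a n)). nra.
- intros n. assert (C : continuous (fun x => a n * x ^ n) 1).
  { apply (ex_derive_continuous (fun x => a n * x ^ n)). now auto_derive. }
  apply continuous_at_left in C. now rewrite pow1, Rmult_1_r in C.
- generalize at_left_1_unit. apply filter_imp. intros x Hx.
  assert (B : forall n, Rabs (a n * x ^ n) <= Rabs (a n)).
  { intros n. rewrite Rabs_mult, (Rabs_pos_eq (x ^ n)) by (apply pow_le; lra).
    generalize (pow_le_1 x n) (Rabs_pos (a n)). nra. }
  split; [exact B|].
  apply Series_correct, ex_series_Rabs.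
  apply (ex_series_le (K := R_AbsRing) (V := R_CompleteNormedModule) _ (fun n => Rabs (a n))); [|assumption].
  intros n. change (Rabs (Rabs (a n * x ^ n)) <= Rabs (a n)). rewrite Rabs_Rabsolu. apply B.
- now rewrite (is_series_unique _ _ H1).
Qed.

Lemma ex_series_bounded (u : nat -> R) (M : R) :
  (forall n, 0 <= u n) -> (forall n, sum_n u n <= M) -> ex_series u.
Proof.
intros Hu HM.
destruct (ex_finite_lim_seq_incr (sum_n u) M) as [l Hl]; auto.
- intros n. rewrite sum_Sn. change plus with Rplus. specialize (Hu (S n)). lra.
- exists l. exact Hl.
Qed.

(** * Hypergeometric factors *)

Lemma pochhammer_pos c n : 0 < c -> 0 < pochhammer c n.
Proof.
intros Hc. induction n as [|n IH]; simpl; [lra|].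
generalize (pos_INR n); nra.
Qed.

Lemma hyp_coef_S a b c n : 0 < c ->
  hyp_coef a b c (S n)
  = hyp_coef a b c n * ((a + INR n) * (b + INR n) / ((c + INR n) * (INR n + 1))).
Proof.
intros Hc. unfold hyp_coef.
assert (H1 := pochhammer_pos c n Hc). assert (H2 := pos_INR n).
assert (H3 := INR_fact_neq_0 n).
rewrite fact_simpl, mult_INR, S_INR. simpl pochhammer. field.
repeat split; lra.
Qed.

(* Raabe's test in telescoped form: [(n + 1) w (n + 1) - n w n <= - delta w n]. *)
Lemma ex_series_hyp_coef a b c : 0 < c -> a + b < c ->
  ex_series (fun n => Rabs (hyp_coef a b c n)).
Proof.
intros Hc Habc.
set (w := fun n => Rabs (hyp_coef a b c n)).
(* Since c - a - b = 2 delta, the inequality (a + n)(b + n) <= (n - delta)(c + n) needed below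
   reduces to a b + delta c <= delta n. *)
set (delta := (c - a - b) / 2). assert (Hd : 0 < delta) by (unfold delta; lra).
destruct (nfloor_ex (Rabs a + Rabs b + (Rabs (a * b) + delta * c) / delta)) as [N0 [_ HN0]].
{ generalize (Rabs_pos a) (Rabs_pos b) (Rabs_pos (a * b)); intros.
  assert (0 <= (Rabs (a * b) + delta * c) / delta) by (apply Rdiv_le_0_compat; nra). lra. }
set (N := S N0).
assert (HN : forall n, (N <= n)%nat ->
  Rabs a + Rabs b + (Rabs (a * b) + delta * c) / delta < INR n).
{ intros n Hn. apply le_INR in Hn. unfold N in Hn. rewrite S_INR in Hn. lra. }
assert (step : forall n, (N <= n)%nat ->
  delta * w n <= INR n * w n - INR (S n) * w (S n)).
{ intros n Hn. specialize (HN n Hn).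
  assert (Ha := Rle_abs (- a)). rewrite Rabs_Ropp in Ha.
  assert (Hb := Rle_abs (- b)). rewrite Rabs_Ropp in Hb.
  assert (H0 : 0 <= (Rabs (a * b) + delta * c) / delta).
  { apply Rdiv_le_0_compat; [|assumption]. generalize (Rabs_pos (a * b)); nra. }
  assert (Hdn : a * b + delta * c <= delta * INR n).
  { assert (Rabs (a * b) + delta * c
      = delta * ((Rabs (a * b) + delta * c) / delta)) by (field; lra).
    generalize (Rle_abs (a * b)) (Rabs_pos a) (Rabs_pos b). nra. }
  assert (Hwn : 0 <= w n) by apply Rabs_pos.
  assert (Pa := Rabs_pos a). assert (Pb := Rabs_pos b).
  assert (Hcn : 0 < c + INR n) by (generalize (pos_INR n); lra).
  unfold w at 3. rewrite hyp_coef_S by assumption. rewrite Rabs_mult. fold (w n).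
  rewrite Rabs_pos_eq.
  2: { apply Rdiv_le_0_compat; [apply Rmult_le_pos; lra|]. generalize (pos_INR n); nra. }
  rewrite S_INR.
  replace ((INR n + 1) * (w n * ((a + INR n) * (b + INR n) / ((c + INR n) * (INR n + 1)))))
    with (w n * ((a + INR n) * (b + INR n) / (c + INR n)))
    by (field; split; generalize (pos_INR n); lra).
  assert (Hq : (a + INR n) * (b + INR n) / (c + INR n) <= INR n - delta).
  { apply Rmult_le_reg_r with (c + INR n); [assumption|].
    unfold Rdiv. rewrite Rmult_assoc, Rinv_l, Rmult_1_r by lra.
    unfold delta in *. nra. }
  nra. }
apply (ex_series_incr_n (K := R_AbsRing) (V := R_NormedModule)) with N.
apply ex_series_bounded with (INR N * w N / delta).
{ intros n. apply Rabs_pos. }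
assert (tel : forall m, delta * sum_n (fun j => w (N + j)%nat) m
   <= INR N * w N - INR (S (N + m)) * w (S (N + m))).
{ induction m as [|m IH].
  - rewrite sum_O, Nat.add_0_r. apply step; lia.
  - rewrite sum_Sn. change plus with Rplus.
    assert (H := step (N + S m)%nat ltac:(lia)).
    replace (S (N + m)) with (N + S m)%nat in IH by lia. lra. }
intros m. specialize (tel m).
apply Rmult_le_reg_l with delta; [assumption|].
replace (delta * (INR N * w N / delta)) with (INR N * w N) by (field; lra).
assert (0 <= INR (S (N + m)) * w (S (N + m))).
{ apply Rmult_le_pos; [apply pos_INR | apply Rabs_pos]. }
change (delta * sum_n (fun j => w (N + j)%nat) m <= INR N * w N). lra.
Qed.

Lemma F_alpha_PSeries alpha k x : x <> 1 ->
  F_alpha alpha k x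
  = PSeries (hyp_coef (- (alpha / 2)) (INR k - alpha / 2) (INR k + 1)) x.
Proof.
intros Hx. unfold F_alpha, hypergeom. destruct (Req_EM_T x 1); [contradiction | reflexivity].
Qed.

(** For these parameters c - a - b = 1 + alpha, so alpha > -1 makes the coefficients absolutely
    summable. [F_alpha] at 1 is an [iota] over limits, hence meaningful only once Abel's theorem has
    produced the limit. *)
Lemma F_alpha_limit alpha k : -1 < alpha ->
  filterlim (fun r => F_alpha alpha k (r ^ 2)) (at_left 1) (locally (F_alpha alpha k 1)).
Proof.
intros Ha.
set (u := hyp_coef (- (alpha / 2)) (INR k - alpha / 2) (INR k + 1)).
assert (Hk := pos_INR k).
assert (L : filterlim (PSeries u) (at_left 1) (locally (Series u))).
{ apply PSeries_abel, ex_series_hyp_coef; lra. }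
assert (E : F_alpha alpha k 1 = Series u).
{ unfold F_alpha, hypergeom. destruct (Req_EM_T 1 1) as [_|n]; [|now contradict n].
  apply (iota_filterlim_locally (K := R_AbsRing) (V := R_CompleteNormedModule)). exact L. }
rewrite E.
(* L is a one-sided limit, so r^2 has to approach 1 while staying strictly below it. *)
assert (L2 : filterlim (fun r => r ^ 2) (at_left 1) (at_left 1)).
{ intros P [d Hd]. unfold filtermap.
  assert (C : locally 1 (fun r : R => Rabs (r ^ 2 - 1) < d)).
  { assert (C : continuous (fun r : R => r ^ 2) 1)
      by (apply (ex_derive_continuous (fun r : R => r ^ 2)); now auto_derive).
    assert (C' := proj1 (filterlim_locally _ _) C d).
    revert C'. apply filter_imp. intros r Hr.
    change (Rabs (r ^ 2 - 1 ^ 2) < d) in Hr. now rewrite pow1 in Hr. }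
  generalize (filter_and _ _ at_left_1_unit (filter_le_within (F := locally 1) (fun r => r < 1) _ C)).
  apply filter_imp. intros r [Hr Hr2]. apply Hd; [exact Hr2 | nra]. }
eapply filterlim_ext_loc; [|exact (filterlim_comp _ _ _ _ _ _ _ _ L2 L)].
generalize at_left_1_unit. apply filter_imp. intros r Hr. symmetry.
apply F_alpha_PSeries. nra.
Qed.

(** The first hypergeometric parameter is 0, so its Pochhammer symbols vanish from index 1 on and
    only the constant term is left. *)
Lemma F_alpha_0 k x : F_alpha 0 k x = 1.
Proof.
assert (Hc : forall n, hyp_coef (- (0 / 2)) (INR k - 0 / 2) (INR k + 1) (S n) = 0).
{ assert (P : forall n, pochhammer (- (0 / 2)) (S n) = 0).
  { induction n as [|n IH].
    - simpl. field.
    - change (pochhammer (- (0 / 2)) (S n) * (- (0 / 2) + INR (S n)) = 0). rewrite IH; ring. }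
  intros n. unfold hyp_coef. rewrite P. unfold Rdiv; ring. }
assert (H0 : hyp_coef (- (0 / 2)) (INR k - 0 / 2) (INR k + 1) 0 = 1).
{ unfold hyp_coef; simpl. field. }
assert (PS : forall y, PSeries (hyp_coef (- (0 / 2)) (INR k - 0 / 2) (INR k + 1)) y = 1).
{ intros y. unfold PSeries. apply is_series_unique.
  apply (is_lim_seq_ext (fun _ => 1) _ 1); [|apply is_lim_seq_const].
  intros n. induction n as [|n IH].
  - rewrite sum_O, H0. simpl. ring.
  - rewrite sum_Sn, <- IH, Hc. change (1 = 1 + 0 * y ^ S n). ring. }
unfold F_alpha, hypergeom. destruct (Req_EM_T x 1) as [_|_]; [|apply PS].
apply (iota_filterlim_locally (K := R_AbsRing) (V := R_CompleteNormedModule)).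
apply filterlim_ext with (fun _ => 1); [intros; now rewrite PS | apply filterlim_const].
Qed.

(** Uniformity in k is what the summability of the radial coefficients requires. For k > |alpha / 2|
    the factor (k - alpha/2 + n) / (k + 1 + n) has modulus at most 1, so the coefficients are
    dominated by (p)_n / n!, those of (1 - x)^{-p}, which do not depend on k. *)
Lemma F_alpha_bound alpha x : -1 < alpha -> 0 <= x < 1 ->
  exists B K, forall k, (K <= k)%nat -> Rabs (F_alpha alpha k x) <= B.
Proof.
intros Ha Hx.
(* The extra 1 keeps p, and with it every v n, positive even when alpha = 0, as the ratio test
   requires. *)
set (p := Rabs (alpha / 2) + 1). assert (Hp : 1 <= p) by (unfold p; generalize (Rabs_pos (alpha / 2)); lra).
set (v := fun n => pochhammer p n / INR (fact n)).
assert (Hv : forall n, 0 < v n).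
{ intros n. apply Rdiv_lt_0_compat; [apply pochhammer_pos; lra | apply INR_fact_lt_0]. }
assert (Hex : ex_series (fun n => v n * x ^ n)).
{ destruct (Req_dec x 0) as [->|Hx0].
  - apply (ex_series_incr_1 (K := R_AbsRing) (V := R_NormedModule)).
    apply ex_series_ext with (fun _ => 0).
    { intros n. simpl. change (0 = v (S n) * (0 * 0 ^ n)). ring. }
    exists 0. apply (is_lim_seq_ext (fun _ => 0) _ 0); [|apply is_lim_seq_const].
    intros n; induction n; [now rewrite sum_O|]. rewrite sum_Sn, <- IHn. change (0 = 0 + 0). ring.
  - apply ex_series_Rabs. apply ex_series_DAlembert with x; [lra | |].
    { intros n. specialize (Hv n). assert (0 < x ^ n) by (apply pow_lt; lra). nra. }
    apply is_lim_seq_ext with (fun n => (1 + (p - 1) * / INR (S n)) * x).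
    { intros n. assert (H1 := Hv n). assert (H2 := Hv (S n)).
      assert (0 < x ^ n) by (apply pow_lt; lra).
      assert (E : v (S n) = v n * (p + INR n) / (INR n + 1)).
      { unfold v. rewrite fact_simpl, mult_INR, S_INR. simpl pochhammer.
        field. split; [apply INR_fact_neq_0 | generalize (pos_INR n); lra]. }
      rewrite E, S_INR. simpl pow.
      replace (v n * (p + INR n) / (INR n + 1) * (x * x ^ n) / (v n * x ^ n))
        with ((1 + (p - 1) * / (INR n + 1)) * x)
        by (field; repeat split; generalize (pos_INR n); lra).
      rewrite Rabs_pos_eq; [reflexivity|].
      apply Rmult_le_pos; [|lra].
      assert (0 < / (INR n + 1)) by (apply Rinv_0_lt_compat; generalize (pos_INR n); lra). nra. }
    replace (Finite x) with (Finite ((1 + (p - 1) * 0) * x)) by (f_equal; ring).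
    apply is_lim_seq_mult'; [|apply is_lim_seq_const].
    apply is_lim_seq_plus'; [apply is_lim_seq_const|].
    apply is_lim_seq_mult'; [apply is_lim_seq_const|].
    apply (is_lim_seq_incr_1 (fun n => / INR n)).
    replace (Finite 0) with (Rbar_inv p_infty) by reflexivity.
    apply is_lim_seq_inv; [apply is_lim_seq_INR | easy]. }
destruct (nfloor_ex (Rabs (alpha / 2))) as [K0 [_ HK0]]; [apply Rabs_pos|].
exists (Series (fun n => v n * x ^ n)), (S K0). intros k Hk.
assert (HkR : Rabs (alpha / 2) < INR k).
{ apply le_INR in Hk. rewrite S_INR in Hk. lra. }
rewrite F_alpha_PSeries by lra. unfold PSeries.
set (u := hyp_coef (- (alpha / 2)) (INR k - alpha / 2) (INR k + 1)).
assert (Hu : forall n, Rabs (u n) <= v n).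
{ induction n as [|n IH].
  - unfold u, v, hyp_coef; simpl. rewrite Rabs_pos_eq by lra. lra.
  - unfold u. assert (Hn := pos_INR n). rewrite hyp_coef_S by (generalize (pos_INR k); lra). fold u.
    assert (E : v (S n) = v n * ((p + INR n) / (INR n + 1))).
    { unfold v. rewrite fact_simpl, mult_INR, S_INR. simpl pochhammer.
      field. split; [lra | apply INR_fact_neq_0]. }
    rewrite E, Rabs_mult. apply Rmult_le_compat; auto using Rabs_pos.
    assert (A := Rabs_triang (- (alpha / 2)) (INR n)). rewrite Rabs_Ropp, (Rabs_pos_eq (INR n)) in A by lra.
    assert (Q : Rabs (INR k - alpha / 2 + INR n) <= INR k + 1 + INR n).
    { generalize (Rle_abs (alpha / 2)). intros. rewrite Rabs_pos_eq by lra. lra. }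
    unfold Rdiv. rewrite Rinv_mult, !Rabs_mult.
    rewrite (Rabs_pos_eq (/ (INR k + 1 + INR n))) by (left; apply Rinv_0_lt_compat; generalize (pos_INR k); lra).
    rewrite (Rabs_pos_eq (/ (INR n + 1))) by (left; apply Rinv_0_lt_compat; lra).
    assert (I1 : 0 < / (INR n + 1)) by (apply Rinv_0_lt_compat; lra).
    assert (I2 : Rabs (INR k - alpha / 2 + INR n) * / (INR k + 1 + INR n) <= 1).
    { apply Rmult_le_reg_r with (INR k + 1 + INR n); [generalize (pos_INR k); lra|].
      rewrite Rmult_assoc, Rinv_l, Rmult_1_r by (generalize (pos_INR k); lra). lra. }
    replace (Rabs (- (alpha * / 2) + INR n) * Rabs (INR k - alpha * / 2 + INR n) *
      (/ (INR k + 1 + INR n) * / (INR n + 1)))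
      with ((Rabs (- (alpha / 2) + INR n) * / (INR n + 1)) *
       (Rabs (INR k - alpha / 2 + INR n) * / (INR k + 1 + INR n))) by (unfold Rdiv; ring).
    assert (0 <= Rabs (- (alpha / 2) + INR n) * / (INR n + 1)).
    { apply Rmult_le_pos; [apply Rabs_pos | lra]. }
    apply Rle_trans with (Rabs (- (alpha / 2) + INR n) * / (INR n + 1) * 1).
    + apply Rmult_le_compat_l; assumption.
    + rewrite Rmult_1_r. apply Rmult_le_compat_r; [lra|]. unfold p. lra. }
assert (Hux : forall n, 0 <= Rabs (u n * x ^ n) <= v n * x ^ n).
{ intros n. split; [apply Rabs_pos|]. rewrite Rabs_mult, (Rabs_pos_eq (x ^ n)) by (apply pow_le; lra).
  apply Rmult_le_compat_r; [apply pow_le; lra | apply Hu]. }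
eapply Rle_trans; [apply Series_Rabs | apply Series_le; assumption].
apply (ex_series_le (K := R_AbsRing) (V := R_CompleteNormedModule) _ (fun n => v n * x ^ n)); [|assumption].
intros n. change (Rabs (Rabs (u n * x ^ n)) <= v n * x ^ n). rewrite Rabs_Rabsolu. apply Hux.
Qed.

(** * Coefficient estimates *)

Notation limsup_root_le_1 c :=
  (Rbar_le (LimSup_Z (fun k => nth_root (Z.abs_nat k) (Cmod (c k)))) 1).

Lemma nth_root_le (m : nat) (x rho : R) : (1 <= m)%nat -> 0 <= x -> 0 <= rho ->
  nth_root m x <= rho -> x <= rho ^ m.
Proof.
intros Hm Hx Hr. unfold nth_root. destruct (Req_EM_T x 0) as [->|Hx0].
- intros _. now apply pow_le.
- intros H. assert (Hm' : 0 < INR m) by (apply lt_0_INR; lia).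
  assert (E : x = Rpower x (/ INR m) ^ m).
  { rewrite <- Rpower_pow by (unfold Rpower; apply exp_pos).
    rewrite Rpower_mult, Rinv_l, Rpower_1 by lra. reflexivity. }
  rewrite E. apply pow_incr. split; [unfold Rpower; left; apply exp_pos | assumption].
Qed.

(** [LimSup_Z] is an infimum of suprema over |k| >= n. An infimum at most 1 < rho forces one of
    these suprema below rho, and it then bounds every later root. *)
Lemma limsup_root_bound (c : Z -> C) (rho : R) : limsup_root_le_1 c -> 1 < rho ->
  exists N, forall k, (N <= Z.abs_nat k)%nat -> Cmod (c k) <= rho ^ Z.abs_nat k.
Proof.
intros H Hrho. unfold LimSup_Z in H.
set (U := fun n : nat => Lub_Rbar (fun x : R => exists k : Z,
  (Z.of_nat n <= Z.abs k)%Z /\ x = nth_root (Z.abs_nat k) (Cmod (c k)))) in H.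
assert (HU : exists n, Rbar_lt (U n) rho).
{ assert (HI := Inf_seq_correct U).
  destruct (Inf_seq U) as [l| |] eqn:E; simpl in H.
  - assert (He : 0 < rho - 1) by lra.
    destruct (HI (mkposreal _ He)) as [_ [n Hn]]. exists n.
    eapply Rbar_lt_le_trans; [exact Hn|]. simpl. lra.
  - contradiction.
  - apply (HI rho). }
(* Index 0 is excluded because [nth_root] has no meaning as a root there. *)
destruct HU as [n Hn]. exists (max n 1). intros k Hk.
apply nth_root_le; try lia; [apply Cmod_ge_0 | lra |].
destruct (Lub_Rbar_correct (fun x : R => exists k : Z,
  (Z.of_nat n <= Z.abs k)%Z /\ x = nth_root (Z.abs_nat k) (Cmod (c k)))) as [Hub _].
assert (L : Rbar_le (nth_root (Z.abs_nat k) (Cmod (c k))) (U n)).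
{ apply Hub. exists k. split; [lia | reflexivity]. }
assert (L' := Rbar_le_lt_trans _ _ _ L Hn). simpl in L'. lra.
Qed.

(** The n-th Fourier coefficient of t -> f(r e^{it}), as [radial_fourier] confirms. *)
Definition radial_coef (alpha : R) (c : Z -> C) (r : R) (n : Z) : C :=
  (c n * RtoC (F_alpha alpha (Z.abs_nat n) (r ^ 2)) * RtoC (r ^ Z.abs_nat n))%C.

Lemma radial_coef_summable alpha c r :
  -1 < alpha -> 0 <= r < 1 -> limsup_root_le_1 c ->
  exists b, ex_series b /\ forall n, Cmod (radial_coef alpha c r n) <= b (Z.abs_nat n).
Proof.
intros Ha Hr Hc.
destruct (F_alpha_bound alpha (r ^ 2) Ha) as [B [K HB]]; [nra|].
(* A number with rho > 1 and rho r < 1, valid at r = 0 too: the coefficients grow at most like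
   rho^|n|, and r^|n| still makes the product geometric. *)
set (rho := 2 / (1 + r)).
assert (Hrho : 1 < rho).
{ unfold rho. apply Rmult_lt_reg_r with (1 + r); [lra|]. field_simplify; lra. }
assert (Hq : 0 <= rho * r < 1).
{ split; [apply Rmult_le_pos; lra|]. unfold rho. apply Rmult_lt_reg_r with (1 + r); [lra|].
  field_simplify; lra. }
destruct (limsup_root_bound c rho Hc Hrho) as [N HN].
(* Adding the moduli at m and -m gives a majorant that depends on |n| only and also covers the
   finitely many indices below N + K. *)
set (b := fun m => (Cmod (c (Z.of_nat m)) + Cmod (c (- Z.of_nat m)%Z))
  * (Rabs (F_alpha alpha m (r ^ 2)) * r ^ m)).
exists b. split.
- apply (ex_series_incr_n (K := R_AbsRing) (V := R_NormedModule)) with (N + K)%nat.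
  apply (ex_series_le (K := R_AbsRing) (V := R_CompleteNormedModule) _
    (fun m => (2 * B * (rho * r) ^ (N + K)) * (rho * r) ^ m)).
  + intros m. set (j := (N + K + m)%nat).
    assert (Hr0 : 0 <= r ^ j) by (apply pow_le; lra).
    assert (H1 := HN (Z.of_nat j) ltac:(unfold j; lia)).
    assert (H2 := HN (- Z.of_nat j)%Z ltac:(unfold j; lia)).
    replace (Z.abs_nat (Z.of_nat j)) with j in H1 by lia.
    replace (Z.abs_nat (- Z.of_nat j)) with j in H2 by lia.
    assert (H3 := HB j ltac:(unfold j; lia)).
    assert (P1 := Cmod_ge_0 (c (Z.of_nat j))). assert (P2 := Cmod_ge_0 (c (- Z.of_nat j)%Z)).
    assert (P3 := Rabs_pos (F_alpha alpha j (r ^ 2))).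
    change (Rabs (b j) <= 2 * B * (rho * r) ^ (N + K) * (rho * r) ^ m).
    replace (2 * B * (rho * r) ^ (N + K) * (rho * r) ^ m)
      with ((rho ^ j + rho ^ j) * (B * r ^ j)).
    2: { unfold j. rewrite !Rpow_mult_distr, !pow_add. ring. }
    unfold b. rewrite Rabs_pos_eq.
    2: { apply Rmult_le_pos; [lra | now apply Rmult_le_pos]. }
    apply Rmult_le_compat; [lra | now apply Rmult_le_pos | lra |].
    now apply Rmult_le_compat_r.
  + apply (ex_series_scal (K := R_AbsRing) (V := R_NormedModule) (2 * B * (rho * r) ^ (N + K))
      (fun m => (rho * r) ^ m)).
    apply ex_series_geom. rewrite Rabs_pos_eq; lra.
- intros n. unfold radial_coef, b. rewrite !Cmod_mult, !Cmod_R, Rmult_assoc.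
  assert (P : 0 <= Rabs (F_alpha alpha (Z.abs_nat n) (r ^ 2)) * r ^ Z.abs_nat n).
  { apply Rmult_le_pos; [apply Rabs_pos | apply pow_le; lra]. }
  rewrite (Rabs_pos_eq (r ^ Z.abs_nat n)) by (apply pow_le; lra).
  apply Rmult_le_compat_r; [assumption|].
  generalize (Cmod_ge_0 (c (Z.of_nat (Z.abs_nat n)))) (Cmod_ge_0 (c (- Z.of_nat (Z.abs_nat n))%Z)).
  intros. destruct (Z_le_dec 0 n).
  + replace (Z.of_nat (Z.abs_nat n)) with n in * by lia. lra.
  + replace (- Z.of_nat (Z.abs_nat n))%Z with n in * by lia. lra.
Qed.

Lemma polar_pow r t k : Cpow (polar r t) k = (RtoC (r ^ k) * cis (INR k * t))%C.
Proof. now rewrite polar_cis, Cpow_mult_l, cis_pow, RtoC_pow. Qed.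

Lemma expansion_laurent alpha c f r t :
  has_expansion alpha c f -> 0 <= r < 1 ->
  laurent_sum (radial_coef alpha c r) t (f (polar r t)).
Proof.
intros H Hr.
assert (Hm := Cmod_polar r t (proj1 Hr)).
destruct (H (polar r t)) as [s1 [s2 [H1 [H2 H3]]]].
{ unfold in_disk. lra. }
exists s1, s2. rewrite Hm in H1, H2. split; [|split; [|exact H3]].
- eapply is_series_C_ext; [|exact H1]. intros k. cbv beta. unfold radial_coef.
  replace (Z.abs_nat (Z.of_nat k)) with k by lia.
  rewrite polar_pow, <- INR_IZR_INZ. ring.
- eapply is_series_C_ext; [|exact H2]. intros j. cbv beta. unfold radial_coef.
  replace (Z.abs_nat (- Z.of_nat (S j))) with (S j) by lia.
  rewrite <- Cpow_conj, polar_pow, opp_IZR, <- INR_IZR_INZ.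
  rewrite Cmult_conj, Cconj_cis.
  replace (- (INR (S j) * t)) with (- INR (S j) * t) by ring.
  replace (Cconj (RtoC (r ^ S j))) with (RtoC (r ^ S j)) by (apply C_ext; simpl; ring).
  ring.
Qed.

Lemma radial_fourier alpha c f r n :
  -1 < alpha -> 0 <= r < 1 -> limsup_root_le_1 c -> has_expansion alpha c f ->
  is_RInt_C (fun t => (f (polar r t) * cis (- (IZR n * t)))%C) 0 (2 * PI)
    (RtoC (2 * PI) * radial_coef alpha c r n)%C.
Proof.
intros Ha Hr Hc Hf.
destruct (radial_coef_summable alpha c r Ha Hr Hc) as [b [Hb1 Hb2]].
apply (fourier_coef _ b); auto. intros t. now apply expansion_laurent.
Qed.

(** * The integral of |cos(kt + beta)| over a period *)

Lemma continuous_abs_cos x : continuous (fun t => Rabs (cos t)) x.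
Proof.
apply continuous_comp; [|apply continuous_Rabs].
apply (ex_derive_continuous cos). now auto_derive.
Qed.

Lemma ex_RInt_abs_cos a b : ex_RInt (fun t => Rabs (cos t)) a b.
Proof. apply (ex_RInt_continuous (V := R_CompleteNormedModule)). intros; apply continuous_abs_cos. Qed.

(** |cos| has period pi, so the integral over [y, y + pi], called G y below, has derivative 0 in y.
    It is evaluated at y = -pi/2, where the cosine is nonnegative throughout. *)
Lemma is_RInt_abs_cos_half_period x : is_RInt (fun t => Rabs (cos t)) x (x + PI) 2.
Proof.
assert (PI0 := PI_RGT_0).
set (J := RInt (V := R_CompleteNormedModule) (fun t => Rabs (cos t)) 0 : R -> R).
assert (HJ : forall y, is_derive J y (Rabs (cos y))).
{ intros y. apply (is_derive_RInt (V := R_NormedModule) (fun t => Rabs (cos t)) J 0 y).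
  - apply filter_forall. intros z. apply (RInt_correct (V := R_CompleteNormedModule)), ex_RInt_abs_cos.
  - apply continuous_abs_cos. }
assert (HJd : forall a b, is_RInt (fun t => Rabs (cos t)) a b (J b - J a)).
{ intros a b. apply is_RInt_val with (RInt (fun t => Rabs (cos t)) a b).
  - apply (RInt_correct (V := R_CompleteNormedModule)), ex_RInt_abs_cos.
  - unfold J. rewrite <- (RInt_Chasles (V := R_CompleteNormedModule) _ 0 a b) by apply ex_RInt_abs_cos.
    match goal with |- ?x = plus ?u ?v - ?w => change (v = u + v - u) end. lra. }
set (G := fun y => J (y + PI) - J y).
assert (HG : forall y, is_derive G y 0).
{ intros y. unfold G.
  replace 0 with (minus (1 * Rabs (cos (y + PI))) (Rabs (cos y))).
  2: { rewrite neg_cos, Rabs_Ropp. unfold minus, plus, opp; simpl. ring. }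
  apply (is_derive_minus (fun y => J (y + PI)) J); [|apply HJ].
  apply (is_derive_comp J (fun y => y + PI)); [apply HJ|]. auto_derive; [auto|ring]. }
assert (Gc : forall a b, a < b -> G a = G b).
{ intros a b Hab. apply (eq_is_derive (V := R_NormedModule) G a b); [|assumption].
  intros t _. apply HG. }
assert (G0 : G (- (PI / 2)) = 2).
{ unfold G. rewrite <- (is_RInt_unique _ _ _ _ (HJd (- (PI / 2)) (- (PI / 2) + PI))).
  apply is_RInt_unique. apply is_RInt_ext with cos.
  - intros t. replace (- (PI / 2) + PI) with (PI / 2) by field.
    rewrite Rmin_left, Rmax_right by lra. intros Ht.
    rewrite Rabs_pos_eq; [reflexivity|]. apply cos_ge_0; lra.
  - apply is_RInt_val with (minus (sin (- (PI / 2) + PI)) (sin (- (PI / 2)))).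
    + apply (is_RInt_derive sin cos).
      * intros t _. auto_derive; [auto|ring].
      * intros t _. apply (ex_derive_continuous cos). now auto_derive.
    + replace (- (PI / 2) + PI) with (PI / 2) by field. rewrite sin_neg, sin_PI2.
      unfold minus, plus, opp; simpl. ring. }
apply is_RInt_val with (J (x + PI) - J x); [apply HJd|].
change (G x = 2).
destruct (Rtotal_order x (- (PI / 2))) as [h|[->|h]]; [|assumption|].
- now rewrite (Gc _ _ h).
- now rewrite <- (Gc _ _ h).
Qed.

(** The substitution u = kt + beta runs through 2k half periods, each contributing 2, and dt = du /
    k removes the dependence on k. *)
Lemma is_RInt_abs_cos (k : nat) (beta : R) : (1 <= k)%nat ->
  is_RInt (fun t => Rabs (cos (INR k * t + beta))) 0 (2 * PI) 4.
Proof.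
intros Hk. assert (Hk' : 0 < INR k) by (apply lt_0_INR; lia).
assert (P : forall n x, is_RInt (fun t => Rabs (cos t)) x (x + INR n * PI) (2 * INR n)).
{ induction n as [|n IH]; intros x.
  - simpl. rewrite Rmult_0_l, Rplus_0_r, Rmult_0_r.
    apply (is_RInt_point (V := R_NormedModule)).
  - rewrite S_INR. apply is_RInt_val with (plus (2 * INR n) 2); [|simpl; unfold plus; simpl; ring].
    apply (is_RInt_Chasles (V := R_NormedModule)) with (x + INR n * PI); [apply IH|].
    replace (x + (INR n + 1) * PI) with (x + INR n * PI + PI) by ring.
    apply is_RInt_abs_cos_half_period. }
assert (H : is_RInt (fun t => Rabs (cos t)) (INR k * 0 + beta) (INR k * (2 * PI) + beta) (4 * INR k)).
{ specialize (P (2 * k)%nat beta). rewrite mult_INR in P. simpl INR in P.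
  replace (INR k * 0 + beta) with beta by ring.
  replace (INR k * (2 * PI) + beta) with (beta + (1 + 1) * INR k * PI) by ring.
  replace (4 * INR k) with (2 * ((1 + 1) * INR k)) by ring. exact P. }
apply (is_RInt_comp_lin (V := R_NormedModule)) in H.
apply (is_RInt_scal (V := R_NormedModule) _ _ _ (/ INR k)) in H.
eapply is_RInt_ext; [|eapply is_RInt_val; [exact H|]].
- intros t _. cbv beta. unfold scal; simpl. unfold mult; simpl. field. lra.
- unfold scal; simpl. unfold mult; simpl. field. lra.
Qed.

(** The cosine is the half-sum of e^{i(kt + beta)} and its conjugate, which select the coefficients
    at -k and k. Their phases cancel against e^{-i gamma} and e^{i beta}, e^{-i beta}, so the moment
    is real and contains rho1 + rho2 rather than a sum with interference. *)
Lemma cos_moment alpha c f r k gamma beta rho1 rho2 :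
  -1 < alpha -> 0 <= r < 1 -> limsup_root_le_1 c -> has_expansion alpha c f ->
  c (Z.of_nat k) = (RtoC rho1 * cis (gamma + beta))%C ->
  c (- Z.of_nat k)%Z = (RtoC rho2 * cis (gamma - beta))%C ->
  is_RInt_C (fun t => (cis (- gamma) * f (polar r t) * RtoC (cos (INR k * t + beta)))%C) 0 (2 * PI)
    (RtoC (PI * (F_alpha alpha k (r ^ 2) * r ^ k * (rho1 + rho2)))).
Proof.
intros Ha Hr Hc Hf H1 H2.
assert (I1 := is_RInt_C_scal _ _ _ (RtoC (/ 2) * cis (- (gamma + beta)))%C _
  (radial_fourier alpha c f r (Z.of_nat k) Ha Hr Hc Hf)).
assert (I2 := is_RInt_C_scal _ _ _ (RtoC (/ 2) * cis (- (gamma - beta)))%C _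
  (radial_fourier alpha c f r (- Z.of_nat k) Ha Hr Hc Hf)).
assert (I := is_RInt_C_plus _ _ _ _ _ _ I1 I2).
assert (E : forall x y : R, (cis (- (x + y)) * cis (x + y))%C = RtoC 1).
{ intros. now rewrite <- cis_plus, Rplus_opp_l, cis_0. }
unfold radial_coef in I. rewrite H1, H2 in I.
replace (Z.abs_nat (Z.of_nat k)) with k in I by lia.
replace (Z.abs_nat (- Z.of_nat k)) with k in I by lia.
match type of I with is_RInt _ _ _ ?v => replace (RtoC (PI * (F_alpha alpha k (r ^ 2) * r ^ k * (rho1 + rho2)))) with v end.
- eapply is_RInt_C_ext; [|exact I]. intros t. cbv beta.
  replace (RtoC (cos (INR k * t + beta)))
    with (RtoC (/ 2) * (cis (INR k * t + beta) + cis (- (INR k * t + beta))))%C.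
  2: { apply C_ext; simpl; rewrite ?cos_neg, ?sin_neg; field. }
  rewrite opp_IZR, <- INR_IZR_INZ.
  replace (- (gamma + beta)) with (- gamma + - beta) by ring.
  replace (- (gamma - beta)) with (- gamma + beta) by ring.
  replace (- (INR k * t + beta)) with (- beta + - (INR k * t)) by ring.
  replace (- (- INR k * t)) with (INR k * t) by ring.
  rewrite !cis_plus. ring.
- match goal with |- ?x = ?y => change (x = y :> C) end.
  transitivity (RtoC (/ 2) * RtoC (2 * PI) * RtoC (F_alpha alpha k (r ^ 2)) * RtoC (r ^ k) *
   (RtoC rho1 * (cis (- (gamma + beta)) * cis (gamma + beta))
    + RtoC rho2 * (cis (- (gamma - beta)) * cis (gamma - beta))))%C; [ring|].
  unfold Rminus. rewrite (E gamma beta), (E gamma (- beta)).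
  rewrite <- !RtoC_mult, <- RtoC_plus, <- !RtoC_mult. f_equal. field.
Qed.

Lemma filterlim_le_bound (g : R -> R) (l b : R) :
  filterlim g (at_left 1) (locally l) -> (forall r, 0 < r < 1 -> g r <= b) -> l <= b.
Proof.
intros Hg Hb.
assert (E : Rbar_le l b); [|exact E].
assert (P := at_left_1_filter).
apply (filterlim_le (F := at_left 1) g (fun _ => b)).
- generalize at_left_1_unit. apply filter_imp. exact Hb.
- exact Hg.
- apply filterlim_const.
Qed.

Lemma filterlim_pow_at_left_1 k : filterlim (fun r : R => r ^ k) (at_left 1) (locally 1).
Proof.
assert (C : continuous (fun x : R => x ^ k) 1).
{ apply (ex_derive_continuous (fun x : R => x ^ k)). now auto_derive. }
apply continuous_at_left in C. now rewrite pow1 in C.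
Qed.

Lemma filterlim_mult_R (g h : R -> R) (a b : R) :
  filterlim g (at_left 1) (locally a) -> filterlim h (at_left 1) (locally b) ->
  filterlim (fun r => g r * h r) (at_left 1) (locally (a * b)).
Proof.
intros Hg Hh. eapply filterlim_comp_2; [exact Hg | exact Hh |].
apply (filterlim_mult (K := R_AbsRing) a b).
Qed.

Lemma angle_split (a b : R) : exists gamma beta, a = gamma + beta /\ b = gamma - beta.
Proof. exists ((a + b) / 2), ((a - b) / 2). split; field. Qed.

Lemma coefficient_bound alpha M f c k :
  -1 < alpha -> limsup_root_le_1 c -> has_expansion alpha c f ->
  (forall z, in_disk z -> Cmod (f z) <= M) -> (1 <= k)%nat ->
  Cmod (c (Z.of_nat k) * RtoC (F_alpha alpha k 1))
  + Cmod (c (- Z.of_nat k)%Z * RtoC (F_alpha alpha k 1)) <= 4 * M / PI.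
Proof.
intros Ha Hc Hf HM Hk.
destruct (polar_form (c (Z.of_nat k))) as [a Ea].
destruct (polar_form (c (- Z.of_nat k)%Z)) as [b Eb].
set (rho1 := Cmod (c (Z.of_nat k))) in *. set (rho2 := Cmod (c (- Z.of_nat k)%Z)) in *.
assert (P1 : 0 <= rho1) by apply Cmod_ge_0. assert (P2 : 0 <= rho2) by apply Cmod_ge_0.
destruct (angle_split a b) as [gamma [beta [-> ->]]].
rewrite !Cmod_mult, !Cmod_R. fold rho1 rho2.
assert (PI0 := PI_RGT_0).
(* The sign of [F_alpha] is not tracked, so its absolute value is carried through the limit. *)
assert (L : filterlim (fun r => Rabs (F_alpha alpha k (r ^ 2)) * (r ^ k * (rho1 + rho2)))
  (at_left 1) (locally (Rabs (F_alpha alpha k 1) * (1 * (rho1 + rho2))))).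
{ apply filterlim_mult_R.
  - eapply filterlim_comp; [now apply F_alpha_limit|]. apply (continuous_Rabs (F_alpha alpha k 1)).
  - apply filterlim_mult_R; [apply filterlim_pow_at_left_1 | apply filterlim_const]. }
assert (B := filterlim_le_bound _ _ (4 * M / PI) L).
replace (rho1 * Rabs (F_alpha alpha k 1) + rho2 * Rabs (F_alpha alpha k 1))
  with (Rabs (F_alpha alpha k 1) * (1 * (rho1 + rho2))) by ring.
apply B. intros r Hr.
assert (I := cos_moment alpha c f r k gamma beta rho1 rho2 Ha ltac:(lra) Hc Hf Ea Eb).
assert (Q' : Cmod (RtoC (PI * (F_alpha alpha k (r ^ 2) * r ^ k * (rho1 + rho2)))) <= M * 4).
{ refine (Cmod_RInt_le _ (fun t => M * Rabs (cos (INR k * t + beta))) 0 (2 * PI) _ (M * 4) ltac:(lra) _ I _).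
  - intros t. rewrite !Cmod_mult, Cmod_cis, Cmod_R, Rmult_1_l.
    apply Rmult_le_compat_r; [apply Rabs_pos|]. apply HM. unfold in_disk.
    rewrite Cmod_polar; lra.
  - apply (is_RInt_scal (V := R_NormedModule) _ _ _ M _ (is_RInt_abs_cos k beta Hk)). }
assert (0 <= r ^ k) by (apply pow_le; lra).
rewrite Cmod_R, Rabs_mult, Rabs_pos_eq, !Rabs_mult, (Rabs_pos_eq (r ^ k)), (Rabs_pos_eq (rho1 + rho2)) in Q' by lra.
apply Rmult_le_reg_l with PI; [assumption|].
replace (PI * (4 * M / PI)) with (M * 4) by (field; lra). lra.
Qed.

(** Index 0 has no partner -k to combine with, so the plain mean over the circle replaces the cosine
    moment and the factor 4 / pi does not appear. *)
Lemma zeroth_coefficient_bound alpha M f c :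
  -1 < alpha -> limsup_root_le_1 c -> has_expansion alpha c f ->
  (forall z, in_disk z -> Cmod (f z) <= M) ->
  Cmod (c 0%Z * RtoC (F_alpha alpha 0 1)) <= M.
Proof.
intros Ha Hc Hf HM. assert (PI0 := PI_RGT_0).
rewrite Cmod_mult, Cmod_R.
apply (filterlim_le_bound (fun r => Cmod (c 0%Z) * Rabs (F_alpha alpha 0 (r ^ 2)))).
{ apply filterlim_mult_R; [apply filterlim_const|].
  eapply filterlim_comp; [now apply F_alpha_limit|]. apply (continuous_Rabs (F_alpha alpha 0 1)). }
intros r Hr.
assert (I := radial_fourier alpha c f r 0 Ha ltac:(lra) Hc Hf).
assert (Q : Cmod (RtoC (2 * PI) * radial_coef alpha c r 0) <= (2 * PI - 0) * M).
{ refine (Cmod_RInt_le _ (fun _ => M) 0 (2 * PI) _ _ ltac:(lra) _ I (is_RInt_cst M 0 (2 * PI))).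
  intros t. rewrite Cmod_mult, Cmod_cis, Rmult_1_r. apply HM. unfold in_disk.
  rewrite Cmod_polar; lra. }
unfold radial_coef in Q. simpl Z.abs_nat in Q. rewrite !Cmod_mult, !Cmod_R in Q.
rewrite (Rabs_pos_eq (2 * PI)) in Q by lra. simpl (_ ^ 0) in Q. rewrite Rabs_R1 in Q.
apply Rmult_le_reg_l with (2 * PI); lra.
Qed.

(** * Uniqueness of extremal coefficients *)

(** Wallis integrals: with W m the integral of sin^{2m}, the recurrence (2m + 1) W m = (2m + 2) W (m
    + 1) makes (2m + 1) (W m)^2 nonincreasing, hence W m = O(m^{-1/2}). *)
Lemma sin_power_integral_small (k : nat) (beta e : R) : (1 <= k)%nat -> 0 < e ->
  exists (m : nat) (W : R), is_RInt (fun t => (sin (INR k * t + beta) ^ 2) ^ m) 0 (2 * PI) W /\ W < e.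
Proof.
intros Hk He. assert (Hk' : 0 < INR k) by (apply lt_0_INR; lia).
assert (PI0 := PI_RGT_0).
set (s := fun m t => (sin (INR k * t + beta) ^ 2) ^ m).
set (W := fun m => RInt (V := R_CompleteNormedModule) (s m) 0 (2 * PI) : R).
assert (HW : forall m, is_RInt (s m) 0 (2 * PI) (W m)).
{ intros m. apply (RInt_correct (V := R_CompleteNormedModule)).
  apply (ex_RInt_continuous (V := R_CompleteNormedModule)). intros t _.
  apply (ex_derive_continuous (s m)). unfold s. now auto_derive. }
assert (Hpos : forall m, 0 <= W m).
{ intros m. apply (is_RInt_le (fun _ => 0) (s m) 0 (2 * PI) 0 (W m)); [lra| |apply HW|].
  - eapply is_RInt_val; [apply is_RInt_cst | ring].
  - intros t _. unfold s. apply pow_le, pow2_ge_0. }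
assert (Hrec : forall m, (2 * INR m + 1) * W m = (2 * INR m + 2) * W (S m)).
{ intros m.
  (* P = sin^{2m+1} cos / k has derivative (2m + 1) sin^{2m} - (2m + 2) sin^{2m+2} after cos^2 is
     eliminated; its values at the two ends agree by periodicity. *)
  set (P := fun t => (sin (INR k * t + beta) ^ 2) ^ m * (sin (INR k * t + beta) * cos (INR k * t + beta)) / INR k).
  assert (D : is_RInt (fun t => (2 * INR m + 1) * s m t - (2 * INR m + 2) * s (S m) t) 0 (2 * PI)
     (minus (P (2 * PI)) (P 0))).
  { apply (is_RInt_derive P).
    - intros t _. unfold P, s. auto_derive; [auto|].
      assert (C2 : cos (INR k * t + beta) ^ 2 = 1 - sin (INR k * t + beta) ^ 2).
      { generalize (sin2_cos2 (INR k * t + beta)). unfold Rsqr. lra. }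
      set (x := sin (INR k * t + beta)) in *. set (y := cos (INR k * t + beta)) in *.
      destruct m as [|m].
      + simpl. transitivity (y ^ 2 - x ^ 2); [field; lra | rewrite C2; ring].
      + replace (Nat.pred (S m)) with m by reflexivity.
        replace (y * (y * 1)) with (1 - x ^ 2) by (rewrite <- C2; ring).
        rewrite S_INR. simpl (_ ^ S _).
        transitivity (((2 * (INR m + 1) + 1) * y ^ 2 - x ^ 2) * ((x * (x * 1)) * (x * (x * 1)) ^ m)).
        * field. lra.
        * rewrite C2. ring.
    - intros t _. apply (ex_derive_continuous (fun t => (2 * INR m + 1) * s m t - (2 * INR m + 2) * s (S m) t)).
      unfold s. now auto_derive. }
  assert (D' := is_RInt_minus _ _ _ _ _ _ (is_RInt_scal _ _ _ (2 * INR m + 1) _ (HW m))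
    (is_RInt_scal _ _ _ (2 * INR m + 2) _ (HW (S m)))).
  apply (is_RInt_unique (V := R_CompleteNormedModule)) in D.
  apply (is_RInt_unique (V := R_CompleteNormedModule)) in D'.
  assert (E : minus (P (2 * PI)) (P 0) = 0).
  { unfold P. replace (INR k * (2 * PI) + beta) with (beta + 2 * INR k * PI) by ring.
    rewrite sin_period, cos_period, Rmult_0_r, Rplus_0_l. unfold minus, plus, opp; simpl. ring. }
  rewrite E in D.
  assert (F : minus (scal (2 * INR m + 1) (W m)) (scal (2 * INR m + 2) (W (S m))) = 0).
  { etransitivity; [symmetry; exact D' | exact D]. }
  unfold minus, plus, opp, scal in F; simpl in F; unfold mult in F; simpl in F. lra. }
assert (Hb : forall m, (2 * INR m + 1) * W m ^ 2 <= 4 * PI ^ 2).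
{ induction m as [|m IH].
  - assert (W 0%nat = 2 * PI).
    { unfold W, s. simpl. rewrite (is_RInt_unique _ _ _ _ (is_RInt_cst 1 0 (2 * PI))). ring. }
    rewrite H. simpl. lra.
  - specialize (Hrec m). assert (Hm := pos_INR m). rewrite S_INR.
    assert (E : W (S m) = (2 * INR m + 1) / (2 * INR m + 2) * W m).
    { apply Rmult_eq_reg_l with (2 * INR m + 2); [|lra]. rewrite <- Hrec. field. lra. }
    rewrite E.
    apply Rle_trans with ((2 * INR m + 1) * W m ^ 2); [|assumption].
    replace ((2 * (INR m + 1) + 1) * ((2 * INR m + 1) / (2 * INR m + 2) * W m) ^ 2)
      with (((2 * INR m + 3) * (2 * INR m + 1) / (2 * INR m + 2) ^ 2) * ((2 * INR m + 1) * W m ^ 2)) by (field; lra).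
    rewrite <- (Rmult_1_l ((2 * INR m + 1) * W m ^ 2)) at 2.
    apply Rmult_le_compat_r; [generalize (pow2_ge_0 (W m)); nra|].
    apply Rmult_le_reg_r with ((2 * INR m + 2) ^ 2); [nra|].
    unfold Rdiv. rewrite Rmult_assoc, Rinv_l by nra. nra. }
(* Chosen so that (m + 1) e^2 > 4 pi^2, which contradicts [Hb] at m + 1 if W (m + 1) >= e. *)
destruct (nfloor_ex (4 * PI ^ 2 / e ^ 2)) as [m [_ Hm]].
{ apply Rdiv_le_0_compat; nra. }
exists (S m), (W (S m)). split; [apply HW|].
apply Rnot_le_lt. intros Hc. specialize (Hb (S m)). rewrite S_INR in Hb.
assert (Q : 4 * PI ^ 2 < (INR m + 1) * e ^ 2).
{ apply Rmult_lt_reg_r with (/ e ^ 2); [apply Rinv_0_lt_compat; nra|].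
  rewrite (Rmult_assoc (INR m + 1)), Rinv_r, Rmult_1_r by nra. exact Hm. }
assert (e ^ 2 <= W (S m) ^ 2) by (apply pow_incr; lra).
generalize (pos_INR m). nra.
Qed.

(** Bernoulli's inequality. With q = cos^2 it majorizes the constant 1 by a weight of small integral
    plus a multiple of a weight dominated by |cos|. *)
Lemma one_le_pow_add (q : R) (m : nat) : 0 <= q <= 1 -> 1 <= (1 - q) ^ m + INR m * q.
Proof.
intros Hq. induction m as [|m IH]; [simpl; lra|].
rewrite S_INR. simpl.
assert ((1 - q) ^ m <= 1) by (apply pow_le_1; lra). nra.
Qed.

(* [M sgn w - g], weighted by [|w|], is controlled by the defect of [Re g * w] from its maximum
   [M |w|]: the square of the left-hand side is at most [2 M |w| (M |w| - Re g * w)]. *)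
Lemma weighted_defect (g : C) (w M eta : R) : 0 < M -> 0 < eta -> Rabs w <= 1 -> Cmod g <= M ->
  Cmod (RtoC (Rabs w) * g - RtoC (M * w)) <= eta + M / (2 * eta) * (M * Rabs w - Re g * w).
Proof.
intros HM He Hw Hg.
set (s := Cmod _).
assert (Hs : 0 <= s) by apply Cmod_ge_0.
assert (Hs2 : s ^ 2 = Rabs w ^ 2 * Cmod g ^ 2 - 2 * M * Rabs w * (w * Re g) + M ^ 2 * w ^ 2).
{ unfold s. rewrite !Cmod_sq. destruct g as [x y]. simpl. ring. }
assert (Hww : w ^ 2 = Rabs w ^ 2) by (now rewrite pow2_abs).
assert (Hx : w * Re g <= M * Rabs w).
{ eapply Rle_trans; [apply Rle_abs|]. rewrite Rabs_mult, Rmult_comm.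
  apply Rmult_le_compat_r; [apply Rabs_pos|]. eapply Rle_trans; [apply Rabs_Re_le | assumption]. }
assert (Hg2 : Cmod g ^ 2 <= M ^ 2) by (apply pow_incr; split; [apply Cmod_ge_0 | assumption]).
assert (Hb : s ^ 2 <= 2 * M * (M * Rabs w - w * Re g)).
{ assert (Pw := Rabs_pos w).
  assert (Rabs w ^ 2 * Cmod g ^ 2 <= Rabs w ^ 2 * M ^ 2)
    by (apply Rmult_le_compat_l; [apply pow2_ge_0 | assumption]).
  apply Rle_trans with (2 * M * Rabs w * (M * Rabs w - w * Re g)); [nra|].
  apply Rmult_le_compat_r; [lra|]. nra. }
(* Expanding (s - 2 eta)^2 >= 0 trades the square root of the defect for an expression linear in it,
   which can be integrated directly without a Cauchy-Schwarz inequality. *)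
assert (Hsq : s <= eta + s ^ 2 / (4 * eta)).
{ apply Rmult_le_reg_r with (4 * eta); [lra|].
  replace ((eta + s ^ 2 / (4 * eta)) * (4 * eta)) with (4 * eta ^ 2 + s ^ 2) by (field; lra).
  generalize (pow2_ge_0 (s - 2 * eta)). nra. }
eapply Rle_trans; [exact Hsq|]. apply Rplus_le_compat_l.
replace (M / (2 * eta) * (M * Rabs w - Re g * w))
  with (2 * M * (M * Rabs w - w * Re g) / (4 * eta)) by (field; lra).
apply Rmult_le_compat_r; [left; apply Rinv_0_lt_compat; lra | assumption].
Qed.

(** Both functions approach the same target M sgn(w) because they share gamma and beta. Only the
    sums of the moduli are prescribed, so the two coefficients of an extremal function may start out
    with different moduli; equality of the moduli is part of the conclusion once f' is an extremal
    map. *)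
Lemma extremal_coefficients_unique M f f' c c' k gamma beta rho1 rho2 rho1' rho2' :
  0 < M -> (1 <= k)%nat ->
  limsup_root_le_1 c -> has_expansion 0 c f -> (forall z, in_disk z -> Cmod (f z) <= M) ->
  limsup_root_le_1 c' -> has_expansion 0 c' f' -> (forall z, in_disk z -> Cmod (f' z) <= M) ->
  c (Z.of_nat k) = (RtoC rho1 * cis (gamma + beta))%C ->
  c (- Z.of_nat k)%Z = (RtoC rho2 * cis (gamma - beta))%C ->
  c' (Z.of_nat k) = (RtoC rho1' * cis (gamma + beta))%C ->
  c' (- Z.of_nat k)%Z = (RtoC rho2' * cis (gamma - beta))%C ->
  rho1 + rho2 = 4 * M / PI -> rho1' + rho2' = 4 * M / PI ->
  forall n, c n = c' n.
Proof.
intros HM Hk Hc Hf Hb Hc' Hf' Hb' E1 E2 E1' E2' Er Er' n.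
assert (PI0 := PI_RGT_0).
(* The integral of M |w| is 4M, and [cos_moment] with hypergeometric factor 1 subtracts pi r^k (4M /
   pi). *)
assert (defect : forall f c rho1 rho2 r, limsup_root_le_1 c -> has_expansion 0 c f ->
  c (Z.of_nat k) = (RtoC rho1 * cis (gamma + beta))%C ->
  c (- Z.of_nat k)%Z = (RtoC rho2 * cis (gamma - beta))%C ->
  rho1 + rho2 = 4 * M / PI -> 0 < r < 1 ->
  is_RInt (fun t => M * Rabs (cos (INR k * t + beta))
    - Re (cis (- gamma) * f (polar r t)) * cos (INR k * t + beta)) 0 (2 * PI)
    (4 * M * (1 - r ^ k))).
{ clear - HM Hk PI0. intros f c rho1 rho2 r Hc Hf E1 E2 Er Hr.
  assert (I := cos_moment 0 c f r k gamma beta rho1 rho2 ltac:(lra) ltac:(lra) Hc Hf E1 E2).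
  apply is_RInt_C_iff in I. destruct I as [I _].
  rewrite F_alpha_0, Er in I.
  assert (J := is_RInt_minus _ _ _ _ _ _ (is_RInt_scal _ _ _ M _ (is_RInt_abs_cos k beta Hk)) I).
  eapply is_RInt_ext; [|eapply is_RInt_val; [exact J|]].
  - intros t _. cbv beta. unfold minus, plus, opp, scal; simpl. unfold mult; simpl. ring.
  - unfold minus, plus, opp, scal; simpl. unfold mult; simpl. field. lra. }
assert (Em1 : RtoC (-1) = (- RtoC 1)%C) by (apply C_ext; simpl; lra).
set (d := Cmod (c n - c' n)).
assert (Hd0 : 0 <= d) by apply Cmod_ge_0.
assert (main : forall m W eta r, 0 < eta -> 0 < r < 1 ->
  is_RInt (fun t => (sin (INR k * t + beta) ^ 2) ^ m) 0 (2 * PI) W ->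
  2 * PI * (d * r ^ Z.abs_nat n) <= 2 * M * W
   + INR m * (2 * PI * (2 * eta) + M / (2 * eta) * (8 * M * (1 - r ^ k)))).
{ intros m W eta r He Hr HW.
  assert (I := is_RInt_C_plus _ _ _ _ _ _
    (radial_fourier 0 c f r n ltac:(lra) ltac:(lra) Hc Hf)
    (is_RInt_C_scal _ _ _ (RtoC (-1)) _ (radial_fourier 0 c' f' r n ltac:(lra) ltac:(lra) Hc' Hf'))).
  unfold radial_coef in I. rewrite F_alpha_0 in I.
  replace (2 * PI * (d * r ^ Z.abs_nat n)) with
   (Cmod (RtoC (2 * PI) * (c n * RtoC 1 * RtoC (r ^ Z.abs_nat n))
    + RtoC (-1) * (RtoC (2 * PI) * (c' n * RtoC 1 * RtoC (r ^ Z.abs_nat n))))).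
  2: { replace (RtoC (2 * PI) * (c n * RtoC 1 * RtoC (r ^ Z.abs_nat n))
    + RtoC (-1) * (RtoC (2 * PI) * (c' n * RtoC 1 * RtoC (r ^ Z.abs_nat n))))%C
      with (RtoC (2 * PI) * ((c n - c' n) * RtoC (r ^ Z.abs_nat n)))%C
      by (rewrite Em1; ring).
    rewrite !Cmod_mult, !Cmod_R. fold d. rewrite !Rabs_pos_eq; [reflexivity| |lra].
    apply pow_le; lra. }
  assert (D1 := defect f c rho1 rho2 r Hc Hf E1 E2 Er Hr).
  assert (D2 := defect f' c' rho1' rho2' r Hc' Hf' E1' E2' Er' Hr).
  assert (D := is_RInt_scal _ _ _ (M / (2 * eta)) _ (is_RInt_plus _ _ _ _ _ _ D1 D2)).
  assert (G := is_RInt_plus _ _ _ _ _ _ (is_RInt_scal _ _ _ (2 * M) _ HW)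
    (is_RInt_scal _ _ _ (INR m) _ (is_RInt_plus _ _ _ _ _ _ (is_RInt_cst (2 * eta) 0 (2 * PI)) D))).
  eapply Rle_trans; [refine (Cmod_RInt_le _ _ 0 (2 * PI) _ _ ltac:(lra) _ I G)|].
  2: { unfold plus, scal; simpl. unfold mult; simpl. right; ring. }
  intros t. unfold plus, scal; simpl. unfold mult; simpl.
  set (w := cos (INR k * t + beta)).
  assert (Hw : Rabs w <= 1) by (apply Rabs_le; unfold w; generalize (COS_bound (INR k * t + beta)); lra).
  assert (Hin : in_disk (polar r t)) by (unfold in_disk; rewrite Cmod_polar; lra).
  assert (B := Hb _ Hin). assert (B' := Hb' _ Hin).
  set (z := f (polar r t)) in *. set (z' := f' (polar r t)) in *.
  replace (z * cis (- (IZR n * t)) + RtoC (-1) * (z' * cis (- (IZR n * t))))%C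
    with ((z - z') * cis (- (IZR n * t)))%C by (rewrite Em1; ring).
  rewrite Cmod_mult, Cmod_cis, Rmult_1_r.
  assert (V := weighted_defect (cis (- gamma) * z) w M eta HM He Hw
    ltac:(rewrite Cmod_mult, Cmod_cis, Rmult_1_l; assumption)).
  assert (V' := weighted_defect (cis (- gamma) * z') w M eta HM He Hw
    ltac:(rewrite Cmod_mult, Cmod_cis, Rmult_1_l; assumption)).
  (* The common target M w is inserted between the two functions; rotation by e^{-i gamma} does not
     change the modulus. *)
  assert (T : Cmod (z - z') * Rabs w <= Cmod (RtoC (Rabs w) * (cis (- gamma) * z) - RtoC (M * w))
    + Cmod (RtoC (Rabs w) * (cis (- gamma) * z') - RtoC (M * w))).
  { replace (Cmod (z - z') * Rabs w) with (Cmod ((RtoC (Rabs w) * (cis (- gamma) * z) - RtoC (M * w))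
     + - (RtoC (Rabs w) * (cis (- gamma) * z') - RtoC (M * w)))).
    - eapply Rle_trans; [apply Cmod_triangle|]. rewrite Cmod_opp. lra.
    - replace ((RtoC (Rabs w) * (cis (- gamma) * z) - RtoC (M * w))
     + - (RtoC (Rabs w) * (cis (- gamma) * z') - RtoC (M * w)))%C
       with ((z - z') * (cis (- gamma) * RtoC (Rabs w)))%C by ring.
      rewrite !Cmod_mult, Cmod_cis, Cmod_R, Rabs_Rabsolu. ring. }
  assert (Tr : Cmod (z - z') <= 2 * M).
  { unfold Cminus. eapply Rle_trans; [apply Cmod_triangle|]. rewrite Cmod_opp. lra. }
  assert (Hw2 : w ^ 2 <= Rabs w).
  { rewrite <- pow2_abs. generalize (Rabs_pos w). nra. }
  assert (Hw3 : 0 <= w ^ 2 <= 1) by (generalize (pow2_ge_0 w); lra).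
  assert (O := one_le_pow_add (w ^ 2) m Hw3).
  replace (1 - w ^ 2) with (sin (INR k * t + beta) ^ 2) in O.
  2: { unfold w. generalize (sin2_cos2 (INR k * t + beta)). unfold Rsqr. lra. }
  assert (Ps : 0 <= (sin (INR k * t + beta) ^ 2) ^ m) by apply pow_le, pow2_ge_0.
  simpl in V, V', Ps, O |- *.
  set (p := (sin (INR k * t + beta) * (sin (INR k * t + beta) * 1)) ^ m) in *.
  assert (Pz := Cmod_ge_0 (z - z')).
  assert (Pm := pos_INR m).
  (* Bernoulli's inequality together with w^2 <= |w|. The first summand will be bounded by 2 M p,
     the second by the two weighted defects. *)
  assert (K1 : Cmod (z - z') <= Cmod (z - z') * p + INR m * (Cmod (z - z') * Rabs w)).
  { apply Rle_trans with (Cmod (z - z') * (p + INR m * (w * (w * 1)))).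
    - rewrite <- (Rmult_1_r (Cmod (z - z'))) at 1. now apply Rmult_le_compat_l.
    - rewrite Rmult_plus_distr_l. apply Rplus_le_compat_l.
      replace (Cmod (z - z') * (INR m * (w * (w * 1)))) with (INR m * (Cmod (z - z') * w ^ 2)) by ring.
      apply Rmult_le_compat_l; [assumption|]. now apply Rmult_le_compat_l. }
  eapply Rle_trans; [exact K1|]. apply Rplus_le_compat.
  - now apply Rmult_le_compat_r.
  - apply Rmult_le_compat_l; [assumption|]. lra. }
assert (lim1 : forall m W eta, 0 < eta ->
  is_RInt (fun t => (sin (INR k * t + beta) ^ 2) ^ m) 0 (2 * PI) W ->
  2 * PI * d <= 2 * M * W + INR m * (2 * PI * (2 * eta))).
{ intros m W eta He HW.
  (* With m and eta fixed, the defects contribute A (1 - r^k), which vanishes as r -> 1. The part A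
     r^k is moved to the left so that the right-hand side is constant in r. *)
  set (A := INR m * (M / (2 * eta) * (8 * M))).
  assert (L : filterlim (fun r => (2 * PI * d) * r ^ Z.abs_nat n + A * r ^ k) (at_left 1)
    (locally ((2 * PI * d) * 1 + A * 1))).
  { eapply filterlim_comp_2; [| |apply (filterlim_plus (K := R_AbsRing) (V := R_NormedModule))];
    (apply filterlim_mult_R; [apply filterlim_const | apply filterlim_pow_at_left_1]). }
  assert (B := filterlim_le_bound _ _ (2 * M * W + INR m * (2 * PI * (2 * eta)) + A) L).
  enough (2 * PI * d * 1 + A * 1 <= 2 * M * W + INR m * (2 * PI * (2 * eta)) + A) by lra.
  apply B. intros r Hr. specialize (main m W eta r He Hr HW).
  unfold A. nra. }
assert (Hd : d = 0).
(* If d > 0, choose m so that 2 M W < d, and only afterwards eta = d / (4 (m + 1)), which makes the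
   other term at most pi d. Then 2 pi d < d + pi d, against pi > 1. *)
{ destruct (Req_dec d 0) as [|Hd]; [assumption|exfalso].
  assert (Hd1 : 0 < d) by lra.
  destruct (sin_power_integral_small k beta (d / (2 * M)) Hk) as [m [W [HW HWd]]].
  { apply Rdiv_lt_0_compat; lra. }
  assert (HWd' : 2 * M * W < d).
  { apply Rmult_lt_reg_l with (/ (2 * M)); [apply Rinv_0_lt_compat; lra|].
    replace (/ (2 * M) * (2 * M * W)) with W by (field; lra).
    replace (/ (2 * M) * d) with (d / (2 * M)) by (field; lra). assumption. }
  assert (Pm := pos_INR m).
  assert (He : 0 < d / (4 * (INR m + 1))) by (apply Rdiv_lt_0_compat; lra).
  specialize (lim1 m W _ He HW).
  assert (X : INR m * (2 * PI * (2 * (d / (4 * (INR m + 1))))) <= PI * d).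
  { replace (INR m * (2 * PI * (2 * (d / (4 * (INR m + 1)))))) with (PI * d * (INR m / (INR m + 1))) by (field; lra).
    rewrite <- (Rmult_1_r (PI * d)) at 2. apply Rmult_le_compat_l; [nra|].
    apply Rmult_le_reg_r with (INR m + 1); [lra|]. unfold Rdiv. rewrite Rmult_assoc, Rinv_l; lra. }
  generalize PI2_1. nra. }
apply Cmod_eq_0 in Hd.
replace (c n) with ((c n - c' n) + c' n)%C by ring. rewrite Hd. ring.
Qed.

Lemma expansion_unique alpha c c' f f' z :
  has_expansion alpha c f -> has_expansion alpha c' f' -> (forall n, c n = c' n) ->
  in_disk z -> f z = f' z.
Proof.
intros H H' Hc Hz.
destruct (H z Hz) as [s1 [s2 [A1 [A2 ->]]]]. destruct (H' z Hz) as [s1' [s2' [A1' [A2' ->]]]].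
f_equal.
- eapply is_series_C_unique; [exact A1|]. eapply is_series_C_ext; [|exact A1'].
  intros n. cbv beta. now rewrite Hc.
- eapply is_series_C_unique; [exact A2|]. eapply is_series_C_ext; [|exact A2'].
  intros n. cbv beta. now rewrite Hc.
Qed.

(** * Series expansion of the extremal maps *)

(** The quotient has real part (1 - |w|^2) / |1 - w|^2 > 0 and imaginary part 2 Im w / |1 - w|^2; it
    lies in the right half-plane, where [Clog] is the intended branch, and |1 - w|^2 cancels in the
    ratio. *)
Lemma Im_Clog_cayley (w : C) : Cmod w < 1 ->
  Im (Clog ((RtoC 1 + w) / (RtoC 1 - w))) = atan (2 * Im w / (1 - Re w ^ 2 - Im w ^ 2)).
Proof.
intros Hw. assert (H := Cmod_sq w). assert (P := Cmod_ge_0 w).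
assert (Hlt : Re w ^ 2 + Im w ^ 2 < 1) by nra.
destruct w as [u v]. simpl in *. f_equal.
assert (D : 0 < (1 - u) ^ 2 + v ^ 2).
{ assert (u < 1) by nra. nra. }
field. repeat split; nra.
Qed.

(** For 0 <= x < 1 this is Im log((1 + w) / (1 - w)), twice the imaginary part of artanh w, at w = x
    e^{i tau}. *)
Definition atanh_im (tau x : R) : R := atan (2 * (x * sin tau) / (1 - x ^ 2)).

Definition odd_sine_term (tau x : R) (j : nat) : R :=
  2 / INR (2 * j + 1) * (x ^ (2 * j + 1) * sin (INR (2 * j + 1) * tau)).

(* Imaginary part of [2 e (x e)^(2N + 2) / (1 - (x e)^2)] with [e = e^{i tau}]: what remains of the
   geometric series for the derivative of [log ((1 + x e) / (1 - x e))]. *)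
Definition atanh_im_remainder (tau x : R) (N : nat) : R :=
  2 * x ^ (2 * N + 2) * (sin (INR (2 * N + 3) * tau) - x ^ 2 * sin (INR (2 * N + 1) * tau))
  / ((1 - x ^ 2) ^ 2 + 4 * x ^ 2 * sin tau ^ 2).

(** sin(x + 2 tau) + sin(x - 2 tau) = 2 cos(2 tau) sin x. Writing 2 cos(2 tau) as 2 - 4 sin^2 tau
    leaves sin tau as the only extra quantity, as in the denominator of the remainder. *)
Lemma sin_odd_recurrence (tau : R) (N : nat) :
  sin (INR (2 * S N + 3) * tau)
  = (2 - 4 * sin tau ^ 2) * sin (INR (2 * N + 3) * tau) - sin (INR (2 * N + 1) * tau).
Proof.
set (x := INR (2 * N + 3) * tau).
replace (INR (2 * S N + 3) * tau) with (x + 2 * tau)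
  by (unfold x; rewrite !plus_INR, !mult_INR, (S_INR N); simpl INR; ring).
replace (INR (2 * N + 1) * tau) with (x - 2 * tau)
  by (unfold x; rewrite !plus_INR, !mult_INR; simpl INR; ring).
rewrite sin_plus, sin_minus, cos_2a_sin. ring.
Qed.

(** The expression is |1 - x^2 e^{2 i tau}|^2. *)
Lemma cayley_denominator_pos (tau x : R) : 0 <= x < 1 ->
  0 < (1 - x ^ 2) ^ 2 + 4 * x ^ 2 * sin tau ^ 2.
Proof.
intros Hx. assert (0 < (1 - x ^ 2) ^ 2) by (apply pow_lt; nra).
generalize (pow2_ge_0 (x * sin tau)). nra.
Qed.

(** The derivative of the j-th term is 2 x^{2j} sin((2j + 1) tau), a geometric progression in
    imaginary parts, so the remainder has a closed form and the induction removes one term at a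
    time. *)
Lemma is_derive_atanh_im_remainder (tau x : R) (N : nat) : 0 <= x < 1 ->
  is_derive (fun x => atanh_im tau x - sum_n (odd_sine_term tau x) N) x
    (atanh_im_remainder tau x N).
Proof.
intros Hx. assert (HQ := cayley_denominator_pos tau x Hx).
assert (Hx2 : 0 < 1 - x ^ 2) by nra.
assert (Ht : forall j, is_derive (fun x => odd_sine_term tau x j) x
  (2 * x ^ (2 * j) * sin (INR (2 * j + 1) * tau))).
{ intros j. unfold odd_sine_term. auto_derive; [auto|].
  replace (Nat.pred (j + (j + 0) + 1)) with (2 * j)%nat by lia.
  replace (j + (j + 0) + 1)%nat with (2 * j + 1)%nat by lia.
  field. apply not_0_INR; lia. }
induction N as [|N IH].
- apply is_derive_ext with (fun x => atanh_im tau x - odd_sine_term tau x 0).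
  { intros t. now rewrite sum_O. }
  replace (atanh_im_remainder tau x 0)
    with (minus (2 * sin tau * (1 + x ^ 2) / ((1 - x ^ 2) ^ 2 + 4 * x ^ 2 * sin tau ^ 2))
      (2 * x ^ (2 * 0) * sin (INR (2 * 0 + 1) * tau))).
  + apply (is_derive_minus (atanh_im tau) (fun x => odd_sine_term tau x 0)); [|apply Ht].
    unfold atanh_im. auto_derive; [nra|]. field. repeat split; nra.
  + unfold atanh_im_remainder. simpl INR.
    replace ((1 + 1 + 1) * tau) with (tau + 2 * tau) by ring. rewrite Rmult_1_l.
    rewrite sin_plus, cos_2a_sin, sin_2a.
    assert (C2 : cos tau * cos tau = 1 - sin tau * sin tau) by (generalize (sin2_cos2 tau); unfold Rsqr; lra).
    replace (cos tau * (2 * sin tau * cos tau)) with (2 * sin tau * (cos tau * cos tau)) by ring.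
    rewrite C2. unfold minus, plus, opp; simpl. simpl in HQ. field. lra.
- apply is_derive_ext with (fun x => (atanh_im tau x - sum_n (odd_sine_term tau x) N) - odd_sine_term tau x (S N)).
  { intros t. rewrite sum_Sn. change plus with Rplus.
    match goal with |- ?a = ?b => change (@eq R a b) end. ring. }
  replace (atanh_im_remainder tau x (S N))
    with (minus (atanh_im_remainder tau x N) (2 * x ^ (2 * S N) * sin (INR (2 * S N + 1) * tau))).
  + apply (is_derive_minus (fun x => atanh_im tau x - sum_n (odd_sine_term tau x) N)
      (fun x => odd_sine_term tau x (S N))); [exact IH | apply Ht].
  + unfold atanh_im_remainder. rewrite sin_odd_recurrence.
    replace (2 * S N + 1)%nat with (2 * N + 3)%nat by lia.
    replace (2 * S N + 2)%nat with (2 * N + 2 + 2)%nat by lia.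
    replace (2 * S N)%nat with (2 * N + 2)%nat by lia.
    rewrite (pow_add x (2 * N + 2) 2). unfold minus, plus, opp; simpl. simpl in HQ. field. lra.
Qed.

(** A real-variable argument along the ray of angle tau: the error after N terms vanishes at 0, so
    the mean value theorem bounds it by its derivative, which is O(x^{2N}) uniformly on [0, x]. *)
Lemma is_series_atanh_im (tau x : R) : 0 <= x < 1 ->
  is_series (odd_sine_term tau x) (atanh_im tau x).
Proof.
intros Hx.
(* In the remainder at an intermediate y, the prefactor and the bracket of sines are each at most 2
   up to the power of y, and the denominator is at least (1 - y^2)^2 >= (1 - x^2)^2; the length x of
   the interval is at most 1. *)
assert (B : forall N, Rabs (atanh_im tau x - sum_n (odd_sine_term tau x) N)
  <= 4 / (1 - x ^ 2) ^ 2 * (x ^ 2) ^ N).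
{ intros N.
  set (D := fun x => atanh_im tau x - sum_n (odd_sine_term tau x) N).
  destruct (MVT_gen D 0 x (fun y => atanh_im_remainder tau y N)) as [y [Hy HD]].
  { rewrite Rmin_left, Rmax_right by lra. intros y Hy. apply is_derive_atanh_im_remainder. lra. }
  { rewrite Rmin_left, Rmax_right by lra. intros y Hy.
    apply continuity_pt_filterlim. apply (ex_derive_continuous D). eexists.
    apply is_derive_atanh_im_remainder. lra. }
  rewrite Rmin_left, Rmax_right in Hy by lra.
  assert (D0 : D 0 = 0).
  { unfold D, atanh_im. replace (2 * (0 * sin tau) / (1 - 0 ^ 2)) with 0 by (simpl; field).
    rewrite atan_0.
    assert (Z : forall n, sum_n (odd_sine_term tau 0) n = 0).
    { assert (T : forall j, odd_sine_term tau 0 j = 0).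
      { intros j. unfold odd_sine_term. rewrite pow_i by lia. ring. }
      induction n as [|n IHn]; [rewrite sum_O; apply T|]. rewrite sum_Sn, IHn, T. apply Rplus_0_l. }
    rewrite Z. ring. }
  rewrite D0, !Rminus_0_r in HD. change (Rabs (D x) <= 4 / (1 - x ^ 2) ^ 2 * (x ^ 2) ^ N). rewrite HD.
  assert (HQ := cayley_denominator_pos tau y ltac:(lra)).
  assert (Hx2 : 0 < (1 - x ^ 2) ^ 2) by (apply pow_lt; nra).
  assert (HQx : (1 - x ^ 2) ^ 2 <= (1 - y ^ 2) ^ 2 + 4 * y ^ 2 * sin tau ^ 2).
  { assert ((1 - x ^ 2) ^ 2 <= (1 - y ^ 2) ^ 2) by (apply pow_incr; nra).
    generalize (pow2_ge_0 (y * sin tau)). nra. }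
  unfold atanh_im_remainder. set (Q := (1 - y ^ 2) ^ 2 + 4 * y ^ 2 * sin tau ^ 2) in *.
  assert (S1 : Rabs (sin (INR (2 * N + 3) * tau) - y ^ 2 * sin (INR (2 * N + 1) * tau)) <= 2).
  { unfold Rminus. eapply Rle_trans; [apply Rabs_triang|]. rewrite Rabs_Ropp, Rabs_mult.
    assert (Rabs (sin (INR (2 * N + 3) * tau)) <= 1) by (apply Rabs_le; generalize (SIN_bound (INR (2 * N + 3) * tau)); lra).
    assert (Rabs (sin (INR (2 * N + 1) * tau)) <= 1) by (apply Rabs_le; generalize (SIN_bound (INR (2 * N + 1) * tau)); lra).
    rewrite (Rabs_pos_eq (y ^ 2)) by apply pow2_ge_0.
    assert (0 <= y ^ 2 <= 1) by nra. generalize (Rabs_pos (sin (INR (2 * N + 1) * tau))). nra. }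
  assert (Py : 0 <= y ^ (2 * N + 2) <= (x ^ 2) ^ N).
  { split; [apply pow_le; lra|]. rewrite pow_add, pow_mult.
    assert (0 <= (y ^ 2) ^ N) by apply pow_le, pow2_ge_0.
    assert ((y ^ 2) ^ N <= (x ^ 2) ^ N) by (apply pow_incr; nra).
    assert (0 <= y ^ 2 <= 1) by nra. nra. }
  unfold Rdiv. rewrite !Rabs_mult, (Rabs_pos_eq 2), (Rabs_pos_eq x), (Rabs_pos_eq (y ^ (2 * N + 2))) by lra.
  rewrite Rabs_inv, (Rabs_pos_eq Q) by lra.
  assert (I : 0 < / Q <= / (1 - x ^ 2) ^ 2).
  { split; [now apply Rinv_0_lt_compat | now apply Rinv_le_contravar]. }
  set (A := Rabs _) in *. assert (HA : 0 <= A) by apply Rabs_pos.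
  apply Rle_trans with (2 * (x ^ 2) ^ N * 2 * / (1 - x ^ 2) ^ 2 * 1); [|right; ring].
  apply Rmult_le_compat; try lra.
  { repeat apply Rmult_le_pos; lra. }
  apply Rmult_le_compat; try lra.
  { repeat apply Rmult_le_pos; lra. }
  apply Rmult_le_compat; lra. }
assert (L : is_lim_seq (fun N => 4 / (1 - x ^ 2) ^ 2 * (x ^ 2) ^ N) 0).
{ replace (Finite 0) with (Rbar_mult (4 / (1 - x ^ 2) ^ 2) 0) by (simpl; f_equal; ring).
  apply is_lim_seq_scal_l. apply is_lim_seq_geom. rewrite Rabs_pos_eq; nra. }
change (is_lim_seq (sum_n (odd_sine_term tau x)) (atanh_im tau x)).
assert (L2 : is_lim_seq (fun N => atanh_im tau x - sum_n (odd_sine_term tau x) N) 0).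
{ apply is_lim_seq_abs_0. apply is_lim_seq_le_le with (3 := L) (u := fun _ => 0).
  - intros N. split; [apply Rabs_pos | apply B].
  - apply is_lim_seq_const. }
replace (Finite (atanh_im tau x)) with (Finite (atanh_im tau x - 0)) by (f_equal; ring).
apply is_lim_seq_ext with (fun N => atanh_im tau x - (atanh_im tau x - sum_n (odd_sine_term tau x) N)).
{ intros; ring. }
apply is_lim_seq_minus'; [apply is_lim_seq_const | exact L2].
Qed.

Lemma is_series_Im_atanh (w : C) : Cmod w < 1 ->
  is_series (fun j => Im (Cpow w (2 * j + 1) * RtoC (/ INR (2 * j + 1))))
    (Im (Clog ((RtoC 1 + w) / (RtoC 1 - w))) / 2).
Proof.
intros Hw. destruct (polar_form w) as [tau Ht].
assert (HS := is_series_atanh_im tau (Cmod w) (conj (Cmod_ge_0 w) Hw)).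
apply (is_series_scal (K := R_AbsRing) (V := R_NormedModule) (/ 2)) in HS.
rewrite Im_Clog_cayley by assumption.
replace (atan (2 * Im w / (1 - Re w ^ 2 - Im w ^ 2)) / 2) with (scal (/ 2) (atanh_im tau (Cmod w))).
- eapply is_series_ext; [|exact HS]. intros j. unfold odd_sine_term, scal; simpl scal.
  rewrite Ht at 2. rewrite Cpow_mult_l, cis_pow, <- RtoC_pow.
  simpl. unfold mult; simpl. field.
  replace (j + (j + 0) + 1)%nat with (S (2 * j)) by lia. apply not_0_INR; lia.
- unfold atanh_im, scal; simpl scal. unfold mult; simpl mult.
  rewrite Cmod_sq. replace (Cmod w * sin tau) with (Im w).
  + unfold Rdiv. rewrite Rmult_comm. f_equal. f_equal. f_equal. f_equal. ring.
  + rewrite Ht at 1. simpl. ring.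
Qed.

(** Turns a series in odd powers of w = theta z^k into a power series in z: term q is moved to
    position k (2q + 1) and the gaps are filled with zeros. *)
Lemma is_series_sparse {K : AbsRing} {V : NormedModule K} (u : nat -> V) (l : V) (k : nat) :
  (1 <= k)%nat -> is_series u l ->
  is_series (fun n => if (n mod (2 * k) =? k)%nat then u (n / (2 * k))%nat else zero) l.
Proof.
intros Hk Hu.
set (v := fun n => if (n mod (2 * k) =? k)%nat then u (n / (2 * k))%nat else zero).
(* T q sums the first q terms. There are floor((N + k) / (2k)) odd multiples of k up to N, which is
   the number of terms reached by the spread-out partial sum. *)
set (T := fun q => match q with O => zero | S J => sum_n u J end).
assert (TS : forall q, T (S q) = plus (T q) (u q)).
{ intros [|q]; simpl; [now rewrite sum_O, plus_zero_l | apply sum_Sn]. }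
assert (HS : forall N, sum_n v N = T ((N + k) / (2 * k))%nat).
{ induction N as [|N IH].
  - rewrite sum_O. unfold v. rewrite Nat.Div0.mod_0_l.
    replace (0 =? k)%nat with false by (symmetry; apply Nat.eqb_neq; lia).
    rewrite Nat.div_small by lia. reflexivity.
  - rewrite sum_Sn, IH. unfold v.
    assert (E1 := Nat.div_mod_eq (S N) (2 * k)).
    assert (B1 := Nat.mod_upper_bound (S N) (2 * k) ltac:(lia)).
    set (q := (S N / (2 * k))%nat) in *. set (m := (S N mod (2 * k))%nat) in *.
    destruct (Nat.eqb_spec m k) as [Em|Em].
    + replace ((S N + k) / (2 * k))%nat with (S q).
      2: { apply Nat.div_unique with 0%nat; nia. }
      replace ((N + k) / (2 * k))%nat with q.
      2: { apply Nat.div_unique with (2 * k - 1)%nat; nia. }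
      now rewrite TS.
    + rewrite plus_zero_r. f_equal.
      destruct (Nat.lt_ge_cases m k) as [Hm|Hm].
      * transitivity q; [symmetry|].
        -- apply Nat.div_unique with (m + k - 1)%nat; nia.
        -- apply Nat.div_unique with (m + k)%nat; nia.
      * transitivity (S q); [symmetry|].
        -- apply Nat.div_unique with (m - k - 1)%nat; nia.
        -- apply Nat.div_unique with (m - k)%nat; nia. }
intros P HP. destruct (Hu P HP) as [N0 HN0].
exists (2 * k * (N0 + 1))%nat. intros n Hn. fold v. rewrite HS.
assert (Hq : (N0 + 1 <= (n + k) / (2 * k))%nat) by (apply Nat.div_le_lower_bound; lia).
destruct ((n + k) / (2 * k))%nat as [|J]; [lia|]. apply HN0. lia.
Qed.

(* Supported on the odd multiples [m = k (2 j + 1)] of [k], for which [j = m / (2 k)]. *)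
Definition extremal_coef (M : R) (k : nat) (eps theta : C) (n : Z) : C :=
  let m := Z.abs_nat n in
  if (m mod (2 * k) =? k)%nat then
    (RtoC 2 * eps * RtoC M / RtoC PI * (if (0 <=? n)%Z then - Ci else Ci)
     * (Cpow (if (0 <=? n)%Z then theta else Cconj theta) (2 * (m / (2 * k)) + 1)
        * RtoC (/ INR (2 * (m / (2 * k)) + 1))))%C
  else RtoC 0.

Lemma RtoC_neq_0 (x : R) : x <> 0 -> RtoC x <> RtoC 0.
Proof. intros H E. apply H. now injection E. Qed.

Lemma Cpow_Cmod_1 (theta : C) n : Cmod theta = 1 -> Cmod (Cpow theta n) = 1.
Proof. intros H. now rewrite Cmod_pow, H, pow1. Qed.

Lemma Cmod_Cconj (z : C) : Cmod (Cconj z) = Cmod z.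
Proof. apply Cmod_eq_of_sq; [apply Cmod_ge_0|]. rewrite Cmod_sq. destruct z; simpl; ring. Qed.

Lemma Cmod_Ci : Cmod Ci = 1.
Proof. apply Cmod_eq_of_sq; [lra|]. simpl. ring. Qed.

Lemma extremal_factor_Cmod M eps : 0 < M -> Cmod eps = 1 ->
  Cmod (RtoC 2 * eps * RtoC M / RtoC PI) = 2 * M / PI.
Proof.
intros HM He. assert (PI0 := PI_RGT_0).
rewrite Cmod_div by (apply RtoC_neq_0; lra).
rewrite !Cmod_mult, !Cmod_R, He, !Rabs_pos_eq by lra. field. lra.
Qed.

Lemma odd_multiple (m k : nat) : (m mod (2 * k))%nat = k -> m = (k * (2 * (m / (2 * k)) + 1))%nat.
Proof. intros H. assert (E := Nat.div_mod_eq m (2 * k)). rewrite H in E. nia. Qed.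

(** On the support |n| = k (2q + 1) and the modulus is 2M / (pi (2q + 1)), so equality holds there.
    The resulting O(1/|n|) decay serves both the root condition and the existence of boundary
    values. *)
Lemma extremal_coef_bound M k eps theta n :
  0 < M -> (1 <= k)%nat -> Cmod eps = 1 -> Cmod theta = 1 ->
  Cmod (extremal_coef M k eps theta n) * INR (Z.abs_nat n) <= 2 * M / PI * INR k.
Proof.
intros HM Hk He Ht. assert (PI0 := PI_RGT_0). unfold extremal_coef. cbv zeta.
set (m := Z.abs_nat n).
assert (P : 0 <= 2 * M / PI) by (apply Rdiv_le_0_compat; lra).
destruct (Nat.eqb_spec (m mod (2 * k)) k) as [Em|Em].
- set (q := (m / (2 * k))%nat) in *.
  assert (Hm : m = (k * (2 * q + 1))%nat) by now apply odd_multiple.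
  rewrite Cmod_mult, Cmod_mult, extremal_factor_Cmod, Cmod_mult by assumption.
  replace (Cmod (if (0 <=? n)%Z then - Ci else Ci)) with 1
    by (destruct (0 <=? n)%Z; rewrite ?Cmod_opp, Cmod_Ci; reflexivity).
  rewrite Cpow_Cmod_1 by (destruct (0 <=? n)%Z; rewrite ?Cmod_Cconj; assumption).
  assert (Hq : 0 < INR (2 * q + 1)) by (apply lt_0_INR; lia).
  rewrite Cmod_R, Rabs_pos_eq by (left; now apply Rinv_0_lt_compat).
  rewrite Hm, mult_INR. right. field. split; lra.
- rewrite Cmod_0, Rmult_0_l. apply Rmult_le_pos; [assumption | apply pos_INR].
Qed.

Lemma limsup_root_of_bound (c : Z -> C) (C0 : R) :
  (forall n, Cmod (c n) * INR (Z.abs_nat n) <= C0) -> limsup_root_le_1 c.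
Proof.
intros H. unfold LimSup_Z.
set (U := fun n : nat => Lub_Rbar (fun x : R => exists k : Z,
  (Z.of_nat n <= Z.abs k)%Z /\ x = nth_root (Z.abs_nat k) (Cmod (c k)))).
assert (HC : 0 <= C0).
{ specialize (H 0%Z). simpl in H. lra. }
(* Beyond N + 1 > C0 the hypothesis forces |c k| <= 1, hence every root is at most 1, so a single
   tail supremum settles the bound. *)
destruct (nfloor_ex C0 HC) as [N [_ HN]].
assert (HU : Rbar_le (U (S N)) 1).
{ apply Lub_Rbar_correct. intros x [k [Hk ->]].
  assert (HkN : (S N <= Z.abs_nat k)%nat) by lia.
  assert (Hk' := le_INR _ _ HkN). rewrite S_INR in Hk'.
  assert (H1 : Cmod (c k) <= 1).
  { specialize (H k). generalize (pos_INR N). intros.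
    apply Rmult_le_reg_r with (INR (Z.abs_nat k)); lra. }
  simpl. unfold nth_root. destruct (Req_EM_T (Cmod (c k)) 0); [lra|].
  rewrite <- exp_0.
  assert (HP : 0 < Cmod (c k)) by (generalize (Cmod_ge_0 (c k)); lra).
  unfold Rpower.
  destruct (Req_dec (Cmod (c k)) 1) as [->|E1].
  - rewrite ln_1, Rmult_0_r. lra.
  - left. apply exp_increasing.
    assert (L : ln (Cmod (c k)) < 0) by (rewrite <- ln_1; apply ln_increasing; lra).
    assert (0 < / INR (Z.abs_nat k)) by (apply Rinv_0_lt_compat; generalize (pos_INR N); lra). nra. }
assert (HI := Inf_seq_correct U). fold U.
destruct (Inf_seq U) as [l| |] eqn:E; simpl in HI |- *.
- apply Rnot_lt_le. intros Hl. assert (He : 0 < l - 1) by lra.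
  destruct (HI (mkposreal _ He)) as [A _]. specialize (A (S N)). change (Rbar_lt (l - (l - 1)) (U (S N))) in A.
  assert (X := Rbar_lt_le_trans _ _ _ A HU). simpl in X. lra.
- specialize (HI 1 (S N)). change (Rbar_lt 1 (U (S N))) in HI. assert (X := Rbar_lt_le_trans _ _ _ HI HU). simpl in X. lra.
- exact I.
Qed.

Lemma monomial_lt_1 k theta z : (1 <= k)%nat -> Cmod theta = 1 -> in_disk z ->
  Cmod (theta * Cpow z k) < 1.
Proof.
intros Hk Ht Hz. rewrite Cmod_mult, Ht, Cmod_pow, Rmult_1_l.
unfold in_disk in Hz. destruct k as [|n]; [lia|]. simpl.
assert (Cmod z ^ n <= 1) by (apply pow_le_1; generalize (Cmod_ge_0 z); lra).
generalize (Cmod_ge_0 z) (pow_le (Cmod z) n (Cmod_ge_0 z)). nra.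
Qed.

(** With L = artanh w, the angle equals 2 Im L = -i (L - conj L). The series of L supplies the
    powers of z and its conjugate the powers of conj z, which explains the factors -i and i in
    [extremal_coef]. *)
Lemma extremal_map_expansion M k eps theta f :
  (1 <= k)%nat -> Cmod theta = 1 ->
  (forall z, in_disk z -> f z = extremal_map M k eps theta z) ->
  has_expansion 0 (extremal_coef M k eps theta) f.
Proof.
intros Hk Ht Hf z Hz.
set (w := (theta * Cpow z k)%C).
assert (Hw : Cmod w < 1) by now apply monomial_lt_1.
set (kappa := (RtoC 2 * eps * RtoC M / RtoC PI)%C).
set (u := fun j => (Cpow w (2 * j + 1) * RtoC (/ INR (2 * j + 1)))%C).
(* Absolute convergence gives some sum L; only its imaginary part has to be identified, since the
   real part cancels in L - conj L. *)
destruct (ex_series_C_abs u (fun j => Cmod w ^ j)) as [L HL].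
{ intros j. unfold u. rewrite Cmod_mult, Cmod_pow, Cmod_R.
  assert (Hj : 1 <= INR (2 * j + 1)) by (apply (le_INR 1); lia).
  rewrite Rabs_pos_eq by (left; apply Rinv_0_lt_compat; lra).
  assert (I1 : 0 < / INR (2 * j + 1) <= 1).
  { split; [apply Rinv_0_lt_compat; lra|]. rewrite <- Rinv_1. apply Rinv_le_contravar; lra. }
  replace (2 * j + 1)%nat with (j + (j + 1))%nat at 1 by lia. rewrite pow_add.
  assert (P1 := pow_le (Cmod w) j (Cmod_ge_0 w)).
  assert (P2 := pow_le (Cmod w) (j + 1) (Cmod_ge_0 w)).
  assert (P3 := pow_le_1 (Cmod w) (j + 1) (conj (Cmod_ge_0 w) (Rlt_le _ _ Hw))).
  assert (0 <= Cmod w ^ j * Cmod w ^ (j + 1) <= Cmod w ^ j) by nra. nra. }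
{ apply ex_series_geom. rewrite Rabs_pos_eq by apply Cmod_ge_0. assumption. }
assert (HIm : Im L = Im (Clog ((RtoC 1 + w) / (RtoC 1 - w))) / 2).
{ apply is_series_C_iff in HL. destruct HL as [_ HL].
  rewrite <- (is_series_unique _ _ HL). now apply is_series_unique, is_series_Im_atanh. }
assert (HLc : is_series_C (fun j => Cconj (u j)) (Cconj L)).
{ apply is_series_C_iff in HL. destruct HL as [H1 H2]. apply is_series_C_iff. split; [exact H1|].
  simpl. apply (is_series_opp (K := R_AbsRing) (V := R_NormedModule)) in H2. exact H2. }
assert (S1 := is_series_sparse (K := C_AbsRing) (V := C_NormedModule) _ _ k Hk
  (is_series_scal (K := C_AbsRing) (V := C_NormedModule) (kappa * - Ci)%C _ _ HL)).
assert (S2 := is_series_sparse (K := C_AbsRing) (V := C_NormedModule) _ _ k Hk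
  (is_series_scal (K := C_AbsRing) (V := C_NormedModule) (kappa * Ci)%C _ _ HLc)).
exists (kappa * - Ci * L)%C, (kappa * Ci * Cconj L)%C. split; [|split].
- eapply is_series_C_ext; [|exact S1]. intros n. cbv beta. rewrite F_alpha_0.
  unfold extremal_coef. cbv zeta.
  replace (Z.abs_nat (Z.of_nat n)) with n by lia.
  replace (0 <=? Z.of_nat n)%Z with true by (symmetry; apply Z.leb_le; lia).
  destruct (Nat.eqb_spec (n mod (2 * k)) k) as [En|En].
  + fold kappa. set (q := (n / (2 * k))%nat).
    assert (Hn : n = (k * (2 * q + 1))%nat) by now apply odd_multiple.
    change (kappa * - Ci * u q = kappa * - Ci * (Cpow theta (2 * q + 1) * RtoC (/ INR (2 * q + 1)))
      * RtoC 1 * Cpow z n)%C.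
    rewrite Hn, Cpow_mult_r. unfold u, w. rewrite Cpow_mult_l. ring.
  + change (RtoC 0 = RtoC 0 * RtoC 1 * Cpow z n)%C. ring.
- apply is_series_C_ext with (a := fun j => (fun n => (extremal_coef M k eps theta (- Z.of_nat n)%Z
    * Cpow (Cconj z) n)%C) (S j)).
  { intros j. cbv beta. rewrite F_alpha_0. ring. }
  (* The negative half starts at index 1. Index 0 is restored to fit [is_series_sparse], at no cost
     because 0 is not an odd multiple of k. *)
  apply (is_series_incr_1 (K := C_AbsRing) (V := C_NormedModule)
    (fun n => (extremal_coef M k eps theta (- Z.of_nat n)%Z * Cpow (Cconj z) n)%C)).
  match goal with |- is_series _ ?v => replace v with (kappa * Ci * Cconj L)%C end.
  2: { unfold extremal_coef. simpl Z.abs_nat. cbv zeta. rewrite Nat.Div0.mod_0_l.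
       replace (0 =? k)%nat with false by (symmetry; apply Nat.eqb_neq; lia).
       change (kappa * Ci * Cconj L = kappa * Ci * Cconj L + RtoC 0 * Cpow (Cconj z) 0)%C. ring. }
  eapply is_series_C_ext; [|exact S2]. intros n. cbv beta.
  unfold extremal_coef. cbv zeta.
  replace (Z.abs_nat (- Z.of_nat n)) with n by lia.
  destruct (Nat.eqb_spec (n mod (2 * k)) k) as [En|En].
  + fold kappa. set (q := (n / (2 * k))%nat).
    assert (Hn : n = (k * (2 * q + 1))%nat) by now apply odd_multiple.
    replace (0 <=? - Z.of_nat n)%Z with false by (symmetry; apply Z.leb_gt; nia).
    change (kappa * Ci * Cconj (u q) = kappa * Ci * (Cpow (Cconj theta) (2 * q + 1) * RtoC (/ INR (2 * q + 1)))
      * Cpow (Cconj z) n)%C.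
    rewrite Hn, Cpow_mult_r. unfold u, w.
    rewrite Cmult_conj, Cpow_conj, Cmult_conj, Cpow_mult_l, Cpow_conj.
    replace (Cconj (RtoC (/ INR (2 * q + 1)))) with (RtoC (/ INR (2 * q + 1))) by (apply C_ext; simpl; ring).
    ring.
  + change (RtoC 0 = RtoC 0 * Cpow (Cconj z) n)%C. ring.
- rewrite Hf by assumption. unfold extremal_map. fold w kappa.
  replace (Im (Clog ((RtoC 1 + w) / (RtoC 1 - w)))) with (2 * Im L) by (rewrite HIm; field).
  replace (kappa * - Ci * L + kappa * Ci * Cconj L)%C with (kappa * (- Ci * (L - Cconj L)))%C by ring.
  f_equal. apply C_ext; destruct L; simpl; ring.
Qed.

(** The imaginary part of [Clog] is an arctangent at every argument, so its modulus is at most pi /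
    2, and the factor 2M / pi turns this into M. *)
Lemma extremal_map_bound M k eps theta z :
  0 < M -> (1 <= k)%nat -> Cmod eps = 1 -> Cmod (extremal_map M k eps theta z) <= M.
Proof.
intros HM Hk He. assert (PI0 := PI_RGT_0).
unfold extremal_map. rewrite Cmod_mult, extremal_factor_Cmod, Cmod_R by assumption.
assert (A : forall w, Rabs (Im (Clog w)) <= PI / 2).
{ intros w. change (Rabs (atan (Im w / Re w)) <= PI / 2). apply Rabs_le.
  generalize (atan_bound (Im w / Re w)). lra. }
apply Rle_trans with (2 * M / PI * (PI / 2)); [|right; field; lra].
apply Rmult_le_compat_l; [apply Rdiv_le_0_compat; lra | apply A].
Qed.

Lemma extremal_coef_k M k eps theta : (1 <= k)%nat ->
  extremal_coef M k eps theta (Z.of_nat k) = (RtoC 2 * eps * RtoC M / RtoC PI * (- Ci) * theta)%C /\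
  extremal_coef M k eps theta (- Z.of_nat k)
    = (RtoC 2 * eps * RtoC M / RtoC PI * Ci * Cconj theta)%C.
Proof.
intros Hk. unfold extremal_coef. cbv zeta.
replace (Z.abs_nat (Z.of_nat k)) with k by lia.
replace (Z.abs_nat (- Z.of_nat k)) with k by lia.
rewrite Nat.mod_small, Nat.div_small, Nat.eqb_refl by lia.
replace (0 <=? Z.of_nat k)%Z with true by (symmetry; apply Z.leb_le; lia).
replace (0 <=? - Z.of_nat k)%Z with false by (symmetry; apply Z.leb_gt; lia).
simpl (INR _). rewrite Rinv_1.
change (2 * 0 + 1)%nat with 1%nat. rewrite !Cpow_1_r.
split; ring.
Qed.

(** * Harmonicity of the extremal maps *)

Definition cont_C (F : C -> C) (x y : R) : Prop :=
  continuity_2d_pt (fun s t => Re (F (s, t))) x y /\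
  continuity_2d_pt (fun s t => Im (F (s, t))) x y.

(* Complex differentiability, stated through the Cauchy-Riemann equations. *)
Definition has_C_derive (F : C -> C) (x y : R) (l : C) : Prop :=
  is_derive (fun s => Re (F (s, y))) x (Re l) /\
  is_derive (fun s => Im (F (s, y))) x (Im l) /\
  is_derive (fun t => Re (F (x, t))) y (- Im l) /\
  is_derive (fun t => Im (F (x, t))) y (Re l).

Lemma cont_C_const c x y : cont_C (fun _ => c) x y.
Proof. split; apply continuity_2d_pt_const. Qed.

Lemma cont_C_id x y : cont_C (fun z => z) x y.
Proof. split; [apply continuity_2d_pt_id1 | apply continuity_2d_pt_id2]. Qed.

Lemma cont_C_opp F x y : cont_C F x y -> cont_C (fun z => (- F z)%C) x y.
Proof. intros [H1 H2]. split; now apply continuity_2d_pt_opp. Qed.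

Lemma cont_C_plus F G x y : cont_C F x y -> cont_C G x y -> cont_C (fun z => (F z + G z)%C) x y.
Proof. intros [F1 F2] [G1 G2]. split; now apply continuity_2d_pt_plus. Qed.

Lemma cont_C_mult F G x y : cont_C F x y -> cont_C G x y -> cont_C (fun z => (F z * G z)%C) x y.
Proof.
intros [F1 F2] [G1 G2]. split.
- apply continuity_2d_pt_minus; now apply continuity_2d_pt_mult.
- apply continuity_2d_pt_plus; now apply continuity_2d_pt_mult.
Qed.

Lemma C_neq_0_sq (z : C) : z <> RtoC 0 -> Re z ^ 2 + Im z ^ 2 <> 0.
Proof.
intros Hz E. apply Hz. apply Cmod_eq_0. apply Cmod_eq_of_sq; [lra|]. rewrite E. ring.
Qed.

Lemma cont_C_inv F x y : F (x, y) <> RtoC 0 -> cont_C F x y -> cont_C (fun z => (/ F z)%C) x y.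
Proof.
intros Hz [F1 F2]. apply C_neq_0_sq in Hz.
assert (Q : continuity_2d_pt (fun s t => / (Re (F (s, t)) ^ 2 + Im (F (s, t)) ^ 2)) x y).
{ apply continuity_2d_pt_inv; [|exact Hz].
  apply continuity_2d_pt_plus; simpl;
  repeat (apply continuity_2d_pt_mult; [assumption|]); apply continuity_2d_pt_const. }
split.
- apply (continuity_2d_pt_mult _ _ x y F1 Q).
- apply (continuity_2d_pt_mult (fun s t => - Im (F (s, t))) _ x y); [|exact Q].
  now apply continuity_2d_pt_opp.
Qed.

Lemma cont_C_pow n x y : cont_C (fun z => Cpow z n) x y.
Proof.
induction n as [|n IH]; [exact (cont_C_const (RtoC 1) x y)|].
apply (cont_C_mult (fun z => z) (fun z => Cpow z n)); [apply cont_C_id | exact IH].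
Qed.

Lemma is_derive_mul_R (f g : R -> R) (x f' g' : R) :
  is_derive f x f' -> is_derive g x g' ->
  is_derive (fun t => f t * g t) x (f' * g x + f x * g').
Proof.
intros Hf Hg. apply (is_derive_mult f g x f' g' Hf Hg). intros; apply Rmult_comm.
Qed.

Lemma is_derive_R_eq (f : R -> R) (x l l' : R) : is_derive f x l -> l = l' -> is_derive f x l'.
Proof. now intros H <-. Qed.

Lemma has_C_derive_eq F x y l l' : has_C_derive F x y l -> l = l' -> has_C_derive F x y l'.
Proof. now intros H <-. Qed.

Lemma has_C_derive_const c x y : has_C_derive (fun _ => c) x y (RtoC 0).
Proof.
refine (conj _ (conj _ (conj _ _)));
(eapply is_derive_R_eq; [apply (is_derive_const (V := R_NormedModule))|]);
unfold zero; simpl; ring.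
Qed.

Lemma has_C_derive_id x y : has_C_derive (fun z => z) x y (RtoC 1).
Proof. refine (conj _ (conj _ (conj _ _))); simpl; auto_derive; auto; ring. Qed.

Lemma has_C_derive_opp F x y l :
  has_C_derive F x y l -> has_C_derive (fun z => (- F z)%C) x y (- l)%C.
Proof.
intros [F1 [F2 [F3 F4]]].
refine (conj _ (conj _ (conj _ _))).
- apply (is_derive_opp _ _ _ F1).
- apply (is_derive_opp _ _ _ F2).
- apply (is_derive_opp _ _ _ F3).
- apply (is_derive_opp _ _ _ F4).
Qed.

Lemma has_C_derive_plus F G x y l m :
  has_C_derive F x y l -> has_C_derive G x y m ->
  has_C_derive (fun z => (F z + G z)%C) x y (l + m)%C.
Proof.
intros [F1 [F2 [F3 F4]]] [G1 [G2 [G3 G4]]].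
refine (conj _ (conj _ (conj _ _))).
- apply (is_derive_plus _ _ _ _ _ F1 G1).
- apply (is_derive_plus _ _ _ _ _ F2 G2).
- eapply is_derive_R_eq; [apply (is_derive_plus _ _ _ _ _ F3 G3)|]. unfold Re, Im, plus; simpl; ring.
- apply (is_derive_plus _ _ _ _ _ F4 G4).
Qed.

Lemma has_C_derive_mult F G x y l m :
  has_C_derive F x y l -> has_C_derive G x y m ->
  has_C_derive (fun z => (F z * G z)%C) x y (l * G (x, y) + F (x, y) * m)%C.
Proof.
intros [F1 [F2 [F3 F4]]] [G1 [G2 [G3 G4]]].
refine (conj _ (conj _ (conj _ _))).
- eapply is_derive_R_eq; [apply (is_derive_minus _ _ _ _ _ (is_derive_mul_R _ _ _ _ _ F1 G1)
    (is_derive_mul_R _ _ _ _ _ F2 G2))|]. unfold Re, Im, minus, plus, opp; simpl; ring.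
- eapply is_derive_R_eq; [apply (is_derive_plus _ _ _ _ _ (is_derive_mul_R _ _ _ _ _ F1 G2)
    (is_derive_mul_R _ _ _ _ _ F2 G1))|]. unfold Re, Im, plus; simpl; ring.
- eapply is_derive_R_eq; [apply (is_derive_minus _ _ _ _ _ (is_derive_mul_R _ _ _ _ _ F3 G3)
    (is_derive_mul_R _ _ _ _ _ F4 G4))|]. unfold Re, Im, minus, plus, opp; simpl; ring.
- eapply is_derive_R_eq; [apply (is_derive_plus _ _ _ _ _ (is_derive_mul_R _ _ _ _ _ F3 G4)
    (is_derive_mul_R _ _ _ _ _ F4 G3))|]. unfold Re, Im, plus; simpl; ring.
Qed.

(** The two functions are the real and imaginary parts of 1 / (a + i b) along a real variable; the
    horizontal and vertical derivatives of a reciprocal are both instances. *)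
Lemma is_derive_inv_parts (a b : R -> R) (x a' b' : R) :
  is_derive a x a' -> is_derive b x b' -> a x ^ 2 + b x ^ 2 <> 0 ->
  is_derive (fun t => a t / (a t ^ 2 + b t ^ 2)) x
    ((a' * (b x ^ 2 - a x ^ 2) - 2 * a x * b x * b') / (a x ^ 2 + b x ^ 2) ^ 2) /\
  is_derive (fun t => - b t / (a t ^ 2 + b t ^ 2)) x
    ((2 * a x * b x * a' - b' * (a x ^ 2 - b x ^ 2)) / (a x ^ 2 + b x ^ 2) ^ 2).
Proof.
intros Ha Hb Hq.
assert (Ea : ex_derive a x) by (eexists; exact Ha).
assert (Eb : ex_derive b x) by (eexists; exact Hb).
assert (Da := is_derive_unique _ _ _ Ha). assert (Db := is_derive_unique _ _ _ Hb).
split; (auto_derive; [repeat split; auto|]);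
change (Derive (fun x0 : R => a x0) x) with (Derive a x);
change (Derive (fun x0 : R => b x0) x) with (Derive b x);
rewrite Da, Db; field; simpl in Hq |- *; rewrite ?Rmult_1_r in *; exact Hq.
Qed.

Lemma has_C_derive_inv F x y l : F (x, y) <> RtoC 0 ->
  has_C_derive F x y l -> has_C_derive (fun z => (/ F z)%C) x y (- (l * (/ F (x, y) * / F (x, y))))%C.
Proof.
intros Hz [F1 [F2 [F3 F4]]]. apply C_neq_0_sq in Hz.
destruct (is_derive_inv_parts _ _ x _ _ F1 F2 Hz) as [A1 A2].
destruct (is_derive_inv_parts _ _ y _ _ F3 F4 Hz) as [B1 B2].
refine (conj _ (conj _ (conj _ _))).
- eapply is_derive_R_eq; [exact A1|]. unfold Re, Im in *. simpl in *. field. rewrite !Rmult_1_r in Hz. exact Hz.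
- eapply is_derive_R_eq; [exact A2|]. unfold Re, Im in *. simpl in *. field. rewrite !Rmult_1_r in Hz. exact Hz.
- eapply is_derive_R_eq; [exact B1|]. unfold Re, Im in *. simpl in *. field. rewrite !Rmult_1_r in Hz. exact Hz.
- eapply is_derive_R_eq; [exact B2|]. unfold Re, Im in *. simpl in *. field. rewrite !Rmult_1_r in Hz. exact Hz.
Qed.

Definition dpow (n : nat) (z : C) : C :=
  match n with O => RtoC 0 | S m => (RtoC (INR n) * Cpow z m)%C end.

Definition ddpow (n : nat) (z : C) : C :=
  match n with O => RtoC 0 | S m => (RtoC (INR n) * dpow m z)%C end.

Lemma has_C_derive_pow n x y : has_C_derive (fun z => Cpow z n) x y (dpow n (x, y)).
Proof.
induction n as [|n IH]; [exact (has_C_derive_const (RtoC 1) x y)|].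
eapply has_C_derive_eq;
 [apply (has_C_derive_mult (fun z => z) (fun z => Cpow z n)); [apply has_C_derive_id | exact IH]|].
destruct n as [|n]; [simpl; ring|].
unfold dpow. rewrite (S_INR (S n)), RtoC_plus. simpl Cpow. ring.
Qed.

Lemma has_C_derive_dpow n x y : has_C_derive (dpow n) x y (ddpow n (x, y)).
Proof.
destruct n as [|n]; [exact (has_C_derive_const (RtoC 0) x y)|].
eapply has_C_derive_eq;
 [apply (has_C_derive_mult (fun _ => RtoC (INR (S n))) (fun z => Cpow z n));
   [apply has_C_derive_const | apply has_C_derive_pow]|].
unfold ddpow. ring.
Qed.

Lemma cont_C_dpow n x y : cont_C (dpow n) x y.
Proof.
destruct n as [|n]; [exact (cont_C_const (RtoC 0) x y)|].
apply (cont_C_mult (fun _ => RtoC (INR (S n))) (fun z => Cpow z n)); [apply cont_C_const | apply cont_C_pow].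
Qed.

Lemma cont_C_ddpow n x y : cont_C (ddpow n) x y.
Proof.
destruct n as [|n]; [exact (cont_C_const (RtoC 0) x y)|].
apply (cont_C_mult (fun _ => RtoC (INR (S n))) (dpow n)); [apply cont_C_const | apply cont_C_dpow].
Qed.

(** The chain rule along a real curve w = u + i v with velocity p + i q: the derivative of log((1 +
    w) / (1 - w)) is 2 w' / (1 - w^2). *)
Lemma is_derive_cayley_arg (u v : R -> R) (x p q : R) :
  is_derive u x p -> is_derive v x q -> u x ^ 2 + v x ^ 2 < 1 ->
  is_derive (fun s => atan (2 * v s / (1 - u s ^ 2 - v s ^ 2))) x
    (Im (RtoC 2 * (p, q) * / (RtoC 1 + - ((u x, v x) * (u x, v x))))%C).
Proof.
intros Hu Hv Hlt.
assert (Eu : ex_derive u x) by (eexists; exact Hu).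
assert (Ev : ex_derive v x) by (eexists; exact Hv).
assert (Du := is_derive_unique _ _ _ Hu). assert (Dv := is_derive_unique _ _ _ Hv).
auto_derive; [repeat split; auto; simpl in Hlt; lra|].
change (Derive (fun x0 : R => u x0) x) with (Derive u x);
change (Derive (fun x0 : R => v x0) x) with (Derive v x).
rewrite Du, Dv. simpl.
set (a := u x) in *. set (b := v x) in *. simpl in Hlt.
assert (0 < 1 - a * (a * 1) - b * (b * 1)) by lra.
assert (0 < (1 - a * a - b * b) ^ 2) by (apply pow_lt; lra).
field. repeat split; try lra.
assert (0 <= b * b) by nra. nra.
Qed.

Lemma in_disk_pair x y : in_disk (x, y) <-> x ^ 2 + y ^ 2 < 1.
Proof.
unfold in_disk. assert (H := Cmod_sq (x, y)). simpl in H |- *.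
assert (P := Cmod_ge_0 (x, y)). split; intros; nra.
Qed.

Lemma in_disk_locally_2d x y : in_disk (x, y) -> locally_2d (fun s t => in_disk (s, t)) x y.
Proof.
intros H. apply in_disk_pair in H.
assert (C : continuity_2d_pt (fun s t => s * s + t * t) x y).
{ apply continuity_2d_pt_plus; apply continuity_2d_pt_mult;
  first [apply continuity_2d_pt_id1 | apply continuity_2d_pt_id2]. }
assert (He : 0 < 1 - (x * x + y * y)) by (simpl in H; lra).
generalize (C (mkposreal _ He)). apply locally_2d_impl, locally_2d_forall.
intros s t Hst. apply in_disk_pair. simpl in Hst |- *. apply Rabs_def2 in Hst. lra.
Qed.

Lemma in_disk_locally_x x y : in_disk (x, y) -> locally x (fun s => in_disk (s, y)).
Proof.
intros H. destruct (in_disk_locally_2d x y H) as [d Hd]. exists d. intros s Hs.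
apply Hd; [exact Hs|]. rewrite Rminus_diag, Rabs_R0. apply cond_pos.
Qed.

Lemma in_disk_locally_y x y : in_disk (x, y) -> locally y (fun t => in_disk (x, t)).
Proof.
intros H. destruct (in_disk_locally_2d x y H) as [d Hd]. exists d. intros t Ht.
apply Hd; [|exact Ht]. rewrite Rminus_diag, Rabs_R0. apply cond_pos.
Qed.

(** [ex_diff_n] is phrased with [Derive], which agrees with the named partials only inside the disk.
    The disk is open, so the agreement is local at each of its points and differentiability
    transfers. *)
Lemma ex_diff_2_of_partials (g g1 g2 g11 g12 g21 g22 : R -> R -> R) :
  (forall x y, in_disk (x, y) ->
     is_derive (fun s => g s y) x (g1 x y) /\ is_derive (fun t => g x t) y (g2 x y)) ->
  (forall x y, in_disk (x, y) ->
     is_derive (fun s => g1 s y) x (g11 x y) /\ is_derive (fun t => g1 x t) y (g12 x y)) ->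
  (forall x y, in_disk (x, y) ->
     is_derive (fun s => g2 s y) x (g21 x y) /\ is_derive (fun t => g2 x t) y (g22 x y)) ->
  (forall x y, in_disk (x, y) ->
     continuity_2d_pt g x y /\ continuity_2d_pt g1 x y /\ continuity_2d_pt g2 x y /\
     continuity_2d_pt g11 x y /\ continuity_2d_pt g12 x y /\
     continuity_2d_pt g21 x y /\ continuity_2d_pt g22 x y) ->
  forall x y, in_disk (x, y) -> ex_diff_n g 2 x y.
Proof.
intros H H1 H2 HC.
assert (step : forall h h1 h2 : R -> R -> R, forall n,
  (forall x y, in_disk (x, y) -> continuity_2d_pt h x y) ->
  (forall x y, in_disk (x, y) ->
     is_derive (fun s => h s y) x (h1 x y) /\ is_derive (fun t => h x t) y (h2 x y)) ->
  (forall x y, in_disk (x, y) -> ex_diff_n h1 n x y /\ ex_diff_n h2 n x y) ->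
  forall x y, in_disk (x, y) -> ex_diff_n h (S n) x y).
{ intros h h1 h2 n Hc Hd Hn x y Hxy. destruct (Hd x y Hxy) as [D1 D2]. destruct (Hn x y Hxy) as [N1 N2].
  refine (conj (Hc x y Hxy) (conj (ex_intro _ _ D1) (conj (ex_intro _ _ D2) (conj _ _)))).
  - apply ex_diff_n_ext_loc with h1; [|exact N1].
    generalize (in_disk_locally_2d x y Hxy). apply locally_2d_impl, locally_2d_forall.
    intros s t Hst. symmetry. apply is_derive_unique, Hd, Hst.
  - apply ex_diff_n_ext_loc with h2; [|exact N2].
    generalize (in_disk_locally_2d x y Hxy). apply locally_2d_impl, locally_2d_forall.
    intros s t Hst. symmetry. apply is_derive_unique, Hd, Hst. }
apply (step g g1 g2 1%nat); [apply HC | exact H |].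
intros x y Hxy. split.
- revert x y Hxy. apply (step g1 g11 g12 0%nat); [apply HC | exact H1 |].
  intros x y Hxy. split; (split; [now apply HC | exact I]).
- revert x y Hxy. apply (step g2 g21 g22 0%nat); [apply HC | exact H2 |].
  intros x y Hxy. split; (split; [now apply HC | exact I]).
Qed.

Definition cayley_arg (k : nat) (theta z : C) : R :=
  Im (Clog ((RtoC 1 + theta * Cpow z k) / (RtoC 1 - theta * Cpow z k)))%C.

(* [2 w' / (1 - w^2)], the derivative of [log ((1 + w) / (1 - w))] for [w = theta z^k]. *)
Definition cayley_deriv (k : nat) (theta z : C) : C :=
  (RtoC 2 * (theta * dpow k z)
   * / (RtoC 1 + - ((theta * Cpow z k) * (theta * Cpow z k))))%C.

Definition cayley_deriv2 (k : nat) (theta z : C) : C :=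
  let w := (theta * Cpow z k)%C in
  let w1 := (theta * dpow k z)%C in
  let q := (/ (RtoC 1 + - (w * w)))%C in
  (RtoC 2 * (theta * ddpow k z) * q
   + RtoC 2 * w1 * - (- (w1 * w + w * w1) * (q * q)))%C.

Lemma cayley_denominator_neq_0 k theta z :
  (1 <= k)%nat -> Cmod theta = 1 -> in_disk z ->
  (RtoC 1 + - ((theta * Cpow z k) * (theta * Cpow z k)))%C <> RtoC 0.
Proof.
intros Hk Ht Hz E. assert (Hw := monomial_lt_1 k theta z Hk Ht Hz). set (w := (theta * Cpow z k)%C) in *.
assert (E2 : (w * w)%C = RtoC 1).
{ replace (w * w)%C with (RtoC 1 - (RtoC 1 + - (w * w)))%C by ring. rewrite E. ring. }
apply (f_equal Cmod) in E2. rewrite Cmod_mult, Cmod_1 in E2.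
generalize (Cmod_ge_0 w). nra.
Qed.

Lemma has_C_derive_monomial k theta x y :
  has_C_derive (fun z => (theta * Cpow z k)%C) x y (theta * dpow k (x, y))%C.
Proof.
eapply has_C_derive_eq; [apply (has_C_derive_mult (fun _ => theta) (fun z => Cpow z k));
  [apply has_C_derive_const | apply has_C_derive_pow]|]. ring.
Qed.

Lemma cont_C_monomial k theta x y : cont_C (fun z => (theta * Cpow z k)%C) x y.
Proof. apply (cont_C_mult (fun _ => theta) (fun z => Cpow z k)); [apply cont_C_const | apply cont_C_pow]. Qed.

Lemma cont_C_denominator k theta x y :
  (1 <= k)%nat -> Cmod theta = 1 -> in_disk (x, y) ->
  cont_C (fun z => / (RtoC 1 + - ((theta * Cpow z k) * (theta * Cpow z k))))%C x y.
Proof.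
intros Hk Ht H. apply (cont_C_inv (fun z => (RtoC 1 + - ((theta * Cpow z k) * (theta * Cpow z k)))%C)).
- now apply cayley_denominator_neq_0.
- apply (cont_C_plus (fun _ => RtoC 1)); [apply cont_C_const|].
  apply (cont_C_opp (fun z => ((theta * Cpow z k) * (theta * Cpow z k))%C)).
  apply cont_C_mult; apply cont_C_monomial.
Qed.

Lemma cont_C_double theta (F : C -> C) x y : cont_C F x y -> cont_C (fun z => (RtoC 2 * (theta * F z))%C) x y.
Proof.
intros H. apply (cont_C_mult (fun _ => RtoC 2)); [apply cont_C_const|].
apply (cont_C_mult (fun _ => theta)); [apply cont_C_const | exact H].
Qed.

Lemma cont_C_cayley_deriv k theta x y :
  (1 <= k)%nat -> Cmod theta = 1 -> in_disk (x, y) -> cont_C (cayley_deriv k theta) x y.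
Proof.
intros Hk Ht H. apply (cont_C_mult (fun z => (RtoC 2 * (theta * dpow k z))%C)).
- apply cont_C_double, cont_C_dpow.
- now apply cont_C_denominator.
Qed.

Lemma cont_C_cayley_deriv2 k theta x y :
  (1 <= k)%nat -> Cmod theta = 1 -> in_disk (x, y) -> cont_C (cayley_deriv2 k theta) x y.
Proof.
intros Hk Ht H. unfold cayley_deriv2. cbv zeta.
assert (Q := cont_C_denominator k theta x y Hk Ht H).
assert (W1 : cont_C (fun z => (theta * dpow k z)%C) x y).
{ apply (cont_C_mult (fun _ => theta)); [apply cont_C_const | apply cont_C_dpow]. }
assert (W := cont_C_monomial k theta x y).
apply (cont_C_plus (fun z => (RtoC 2 * (theta * ddpow k z)
  * / (RtoC 1 + - ((theta * Cpow z k) * (theta * Cpow z k))))%C)).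
- apply (cont_C_mult (fun z => (RtoC 2 * (theta * ddpow k z))%C)); [|exact Q].
  apply cont_C_double, cont_C_ddpow.
- apply (cont_C_mult (fun z => (RtoC 2 * (theta * dpow k z))%C)).
  { apply cont_C_double, cont_C_dpow. }
  apply (cont_C_opp (fun z => (- (theta * dpow k z * (theta * Cpow z k) + theta * Cpow z k * (theta * dpow k z)) *
    (/ (RtoC 1 + - ((theta * Cpow z k) * (theta * Cpow z k))) *
     / (RtoC 1 + - ((theta * Cpow z k) * (theta * Cpow z k)))))%C)).
  apply (cont_C_mult (fun z => (- (theta * dpow k z * (theta * Cpow z k) + theta * Cpow z k * (theta * dpow k z)))%C)).
  + apply (cont_C_opp (fun z => (theta * dpow k z * (theta * Cpow z k) + theta * Cpow z k * (theta * dpow k z))%C)).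
    apply cont_C_plus; apply cont_C_mult; assumption.
  + apply cont_C_mult; exact Q.
Qed.

Lemma has_C_derive_cayley_deriv k theta x y :
  (1 <= k)%nat -> Cmod theta = 1 -> in_disk (x, y) ->
  has_C_derive (cayley_deriv k theta) x y (cayley_deriv2 k theta (x, y)).
Proof.
intros Hk Ht H. assert (W := has_C_derive_monomial k theta x y).
assert (N := cayley_denominator_neq_0 k theta (x, y) Hk Ht H).
assert (Q := has_C_derive_inv (fun z => RtoC 1 + - ((theta * Cpow z k) * (theta * Cpow z k)))%C x y _ N
  (has_C_derive_plus _ _ x y _ _ (has_C_derive_const (RtoC 1) x y)
    (has_C_derive_opp _ x y _ (has_C_derive_mult _ _ x y _ _ W W)))).
assert (W1 := has_C_derive_mult _ _ x y _ _ (has_C_derive_const (RtoC 2) x y)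
  (has_C_derive_mult _ _ x y _ _ (has_C_derive_const theta x y) (has_C_derive_dpow k x y))).
eapply has_C_derive_eq; [exact (has_C_derive_mult _ _ x y _ _ W1 Q)|].
unfold cayley_deriv2. cbv zeta. ring.
Qed.

(** The angle is the imaginary part of a holomorphic function with derivative H = [cayley_deriv], so
    its partials are Im H and Im(i H) = Re H. *)
Lemma is_derive_cayley_arg_xy k theta x y :
  (1 <= k)%nat -> Cmod theta = 1 -> in_disk (x, y) ->
  is_derive (fun s => cayley_arg k theta (s, y)) x (Im (cayley_deriv k theta (x, y))) /\
  is_derive (fun t => cayley_arg k theta (x, t)) y (Re (cayley_deriv k theta (x, y))).
Proof.
intros Hk Ht H. destruct (has_C_derive_monomial k theta x y) as [D1 [D2 [D3 D4]]].
assert (Hw := monomial_lt_1 k theta (x, y) Hk Ht H).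
assert (Hlt : Re (theta * Cpow (x, y) k)%C ^ 2 + Im (theta * Cpow (x, y) k)%C ^ 2 < 1).
{ rewrite <- Cmod_sq. generalize (Cmod_ge_0 (theta * Cpow (x, y) k)). nra. }
set (w := (theta * Cpow (x, y) k)%C) in *.
set (w1 := (theta * dpow k (x, y))%C) in *.
split.
- apply is_derive_ext_loc with (fun s => atan (2 * Im (theta * Cpow (s, y) k)%C
    / (1 - Re (theta * Cpow (s, y) k)%C ^ 2 - Im (theta * Cpow (s, y) k)%C ^ 2))).
  { generalize (in_disk_locally_x x y H). apply filter_imp. intros s Hs.
    symmetry. now apply Im_Clog_cayley, monomial_lt_1. }
  eapply is_derive_R_eq; [apply (is_derive_cayley_arg _ _ x _ _ D1 D2 Hlt)|].
  unfold cayley_deriv. fold w w1.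
  replace (Re w, Im w) with w by (now destruct w).
  replace (Re w1, Im w1) with w1 by (now destruct w1). reflexivity.
- apply is_derive_ext_loc with (fun t => atan (2 * Im (theta * Cpow (x, t) k)%C
    / (1 - Re (theta * Cpow (x, t) k)%C ^ 2 - Im (theta * Cpow (x, t) k)%C ^ 2))).
  { generalize (in_disk_locally_y x y H). apply filter_imp. intros s Hs.
    symmetry. now apply Im_Clog_cayley, monomial_lt_1. }
  eapply is_derive_R_eq; [apply (is_derive_cayley_arg _ _ y _ _ D3 D4 Hlt)|].
  unfold cayley_deriv. fold w w1.
  replace (Re w, Im w) with w by (now destruct w).
  replace (- Im w1, Re w1) with (Ci * w1)%C by (apply C_ext; destruct w1; simpl; ring).
  assert (R : forall a b : C, Im (RtoC 2 * (Ci * a) * b) = Re (RtoC 2 * a * b))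
    by (intros [a1 a2] [b1 b2]; simpl; ring).
  apply R.
Qed.

Lemma cayley_arg_ex_diff k theta a x y :
  (1 <= k)%nat -> Cmod theta = 1 -> in_disk (x, y) ->
  ex_diff_n (fun s t => a * cayley_arg k theta (s, t)) 2 x y.
Proof.
intros Hk Ht. revert x y.
(* Starting from the first partials Im H and Re H, the Cauchy-Riemann equations for H express all
   second partials through H'. *)
apply (ex_diff_2_of_partials (fun s t => a * cayley_arg k theta (s, t))
  (fun s t => a * Im (cayley_deriv k theta (s, t)))
  (fun s t => a * Re (cayley_deriv k theta (s, t)))
  (fun s t => a * Im (cayley_deriv2 k theta (s, t)))
  (fun s t => a * Re (cayley_deriv2 k theta (s, t)))
  (fun s t => a * Re (cayley_deriv2 k theta (s, t)))
  (fun s t => a * - Im (cayley_deriv2 k theta (s, t)))).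
- intros x y H. destruct (is_derive_cayley_arg_xy k theta x y Hk Ht H) as [D1 D2].
  split; now apply is_derive_scal.
- intros x y H. destruct (has_C_derive_cayley_deriv k theta x y Hk Ht H) as [D1 [D2 [D3 D4]]].
  split; now apply is_derive_scal.
- intros x y H. destruct (has_C_derive_cayley_deriv k theta x y Hk Ht H) as [D1 [D2 [D3 D4]]].
  split; now apply is_derive_scal.
- intros x y H.
  destruct (cont_C_cayley_deriv k theta x y Hk Ht H) as [C1 C2].
  destruct (cont_C_cayley_deriv2 k theta x y Hk Ht H) as [C3 C4].
  assert (S : forall h : R -> R -> R, continuity_2d_pt h x y -> continuity_2d_pt (fun s t => a * h s t) x y).
  { intros h Hh. apply continuity_2d_pt_mult; [apply continuity_2d_pt_const | exact Hh]. }
  refine (conj _ (conj (S _ C2) (conj (S _ C1) (conj (S _ C4) (conj (S _ C3) (conj (S _ C3) (S _ _))))))).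
  + apply S.
    destruct (cont_C_monomial k theta x y) as [W1 W2].
    assert (Hw := monomial_lt_1 k theta (x, y) Hk Ht H).
    apply continuity_2d_pt_ext_loc with (fun s t => atan (2 * Im (theta * Cpow (s, t) k)%C
    * / (1 - Re (theta * Cpow (s, t) k)%C * Re (theta * Cpow (s, t) k)%C
         - Im (theta * Cpow (s, t) k)%C * Im (theta * Cpow (s, t) k)%C))).
    { generalize (in_disk_locally_2d x y H). apply locally_2d_impl, locally_2d_forall.
      intros s t Hst. unfold cayley_arg. rewrite Im_Clog_cayley by now apply monomial_lt_1.
      unfold Rdiv. f_equal. f_equal. f_equal. ring. }
    apply (continuity_1d_2d_pt_comp atan).
    * apply derivable_continuous_pt, derivable_pt_atan.
    * apply continuity_2d_pt_mult.
      { apply continuity_2d_pt_mult; [apply continuity_2d_pt_const | exact W2]. }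
      apply continuity_2d_pt_inv.
      { repeat apply continuity_2d_pt_minus; [apply continuity_2d_pt_const| |];
        apply continuity_2d_pt_mult; assumption. }
      assert (X := Cmod_sq (theta * Cpow (x, y) k)).
      assert (P := Cmod_ge_0 (theta * Cpow (x, y) k)). intros E. nra.
  + apply continuity_2d_pt_opp. exact C4.
Qed.


Lemma extremal_map_C2 M k eps theta f : (1 <= k)%nat -> Cmod theta = 1 ->
  (forall z, in_disk z -> f z = extremal_map M k eps theta z) -> C2_disk f.
Proof.
intros Hk Ht Hf x y H.
set (kappa := (RtoC 2 * eps * RtoC M / RtoC PI)%C).
assert (E : forall s t, in_disk (s, t) -> f (s, t) = (kappa * RtoC (cayley_arg k theta (s, t)))%C).
{ intros s t Hst. now rewrite Hf. }
split.
- apply ex_diff_n_ext_loc with (fun s t => Re kappa * cayley_arg k theta (s, t));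
    [|now apply cayley_arg_ex_diff].
  generalize (in_disk_locally_2d x y H). apply locally_2d_impl, locally_2d_forall.
  intros s t Hst. rewrite E by assumption. simpl. ring.
- apply ex_diff_n_ext_loc with (fun s t => Im kappa * cayley_arg k theta (s, t));
    [|now apply cayley_arg_ex_diff].
  generalize (in_disk_locally_2d x y H). apply locally_2d_impl, locally_2d_forall.
  intros s t Hst. rewrite E by assumption. simpl. ring.
Qed.

(** For alpha = 0 the coefficients of the lower-order terms are 0, so only the Laplacian has to
    vanish. It does because [d_dzbar f] is a constant times the conjugate of a holomorphic function,
    which [d_dz] annihilates. *)
Lemma extremal_map_harmonic M k eps theta f z : (1 <= k)%nat -> Cmod theta = 1 ->
  (forall z, in_disk z -> f z = extremal_map M k eps theta z) ->
  in_disk z -> T_op 0 f z = RtoC 0.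
Proof.
intros Hk Ht Hf Hz.
set (kappa := (RtoC 2 * eps * RtoC M / RtoC PI)%C).
set (H := cayley_deriv k theta).
assert (E : forall s t, in_disk (s, t) -> f (s, t) = (kappa * RtoC (cayley_arg k theta (s, t)))%C).
{ intros s t Hst. now rewrite Hf. }
assert (Ex : forall a x y, in_disk (x, y) ->
  Derive (fun s => a * cayley_arg k theta (s, y)) x = a * Im (H (x, y)) /\
  Derive (fun t => a * cayley_arg k theta (x, t)) y = a * Re (H (x, y))).
{ intros a x y Hxy. destruct (is_derive_cayley_arg_xy k theta x y Hk Ht Hxy) as [D1 D2].
  split; apply is_derive_unique; now apply is_derive_scal. }
(* [d f / d zbar = i kappa / 2 * conj H], antiholomorphic. *)
assert (Ezbar : forall x y, in_disk (x, y) ->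
  d_dzbar f (x, y) = (RtoC (1 / 2) * Ci * kappa * Cconj (H (x, y)))%C).
{ intros x y Hxy. unfold d_dzbar, d_dx, d_dy.
  change (Re (x, y)) with x. change (Im (x, y)) with y.
  rewrite (Derive_ext_loc (fun s => Re (f (s, y))) (fun s => Re kappa * cayley_arg k theta (s, y))),
    (Derive_ext_loc (fun s => Im (f (s, y))) (fun s => Im kappa * cayley_arg k theta (s, y))),
    (Derive_ext_loc (fun t => Re (f (x, t))) (fun t => Re kappa * cayley_arg k theta (x, t))),
    (Derive_ext_loc (fun t => Im (f (x, t))) (fun t => Im kappa * cayley_arg k theta (x, t))).
  2, 3: generalize (in_disk_locally_y x y Hxy); apply filter_imp; intros t Hst;
    rewrite E by assumption; simpl; ring.
  2, 3: generalize (in_disk_locally_x x y Hxy); apply filter_imp; intros t Hst;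
    rewrite E by assumption; simpl; ring.
  rewrite !(proj1 (Ex _ x y Hxy)), !(proj2 (Ex _ x y Hxy)).
  apply C_ext; destruct kappa, (H (x, y)); simpl; ring. }
set (lambda := (RtoC (1 / 2) * Ci * kappa)%C) in Ezbar.
assert (L : d_dz (d_dzbar f) z = RtoC 0).
{ destruct z as [x y]. unfold d_dz, d_dx, d_dy.
  change (Re (x, y)) with x. change (Im (x, y)) with y.
  destruct (has_C_derive_cayley_deriv k theta x y Hk Ht Hz) as [D1 [D2 [D3 D4]]].
  fold H in D1, D2, D3, D4. set (l := cayley_deriv2 k theta (x, y)) in *.
  assert (comb : forall (u v : R -> R) (a b t u' v' : R), is_derive u t u' -> is_derive v t v' ->
    Derive (fun s => a * u s + b * v s) t = a * u' + b * v').
  { intros u v a b t u' v' Hu Hv. apply is_derive_unique.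
    apply (is_derive_plus (fun s => a * u s) (fun s => b * v s)); now apply is_derive_scal. }
  rewrite (Derive_ext_loc (fun s => Re (d_dzbar f (s, y)))
      (fun s => Re lambda * Re (H (s, y)) + Im lambda * Im (H (s, y)))),
    (Derive_ext_loc (fun s => Im (d_dzbar f (s, y)))
      (fun s => Im lambda * Re (H (s, y)) + - Re lambda * Im (H (s, y)))),
    (Derive_ext_loc (fun t => Re (d_dzbar f (x, t)))
      (fun t => Re lambda * Re (H (x, t)) + Im lambda * Im (H (x, t)))),
    (Derive_ext_loc (fun t => Im (d_dzbar f (x, t)))
      (fun t => Im lambda * Re (H (x, t)) + - Re lambda * Im (H (x, t)))).
  2, 3: generalize (in_disk_locally_y x y Hz); apply filter_imp; intros t Hst;
    rewrite Ezbar by assumption; simpl; ring.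
  2, 3: generalize (in_disk_locally_x x y Hz); apply filter_imp; intros t Hst;
    rewrite Ezbar by assumption; simpl; ring.
  rewrite !(comb _ _ _ _ _ _ _ D1 D2), !(comb _ _ _ _ _ _ _ D3 D4).
  clear. generalize lambda l. clear. intros [a1 a2] [l1 l2]. apply C_ext; simpl; ring. }
unfold T_op, Laplacian. rewrite L. cbv zeta.
replace (- (0 ^ 2 / 4) * Rpower (1 - Cmod z ^ 2) (- 0 - 1)) with 0 by (simpl; field).
replace (0 / 2 * Rpower (1 - Cmod z ^ 2) (- 0 - 1)) with 0 by field.
ring.
Qed.

(** * Boundary values *)

Lemma continuous_bounded_segment (g : R -> R) (b : R) : 0 <= b ->
  (forall t, continuous g t) -> exists B, forall t, 0 <= t <= b -> Rabs (g t) <= B.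
Proof.
intros Hb Hg.
destruct (continuity_ab_maj (fun t => Rabs (g t)) 0 b Hb) as [t0 [Ht0 _]].
{ intros t _. apply continuity_pt_filterlim.
  apply (continuous_comp g Rabs); [apply Hg | apply continuous_Rabs]. }
exists (Rabs (g t0)). exact Ht0.
Qed.

Lemma periodic_bounded (g : R -> R) : (forall t, continuous g t) ->
  (forall t, g (t + 2 * PI) = g t) -> exists B, forall t, Rabs (g t) <= B.
Proof.
intros Hg Hp. assert (PI0 := PI_RGT_0).
destruct (continuous_bounded_segment g (2 * PI) ltac:(lra) Hg) as [B HB].
exists B. intros t.
assert (Hn : forall n t, g (t + INR n * (2 * PI)) = g t).
{ induction n as [|n IH]; intros s.
  - simpl. f_equal. ring.
  - rewrite S_INR. replace (s + (INR n + 1) * (2 * PI)) with (s + INR n * (2 * PI) + 2 * PI) by ring.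
    now rewrite Hp. }
assert (Hz : forall m t, g (t + IZR m * (2 * PI)) = g t).
{ intros m s. destruct (Z_le_dec 0 m) as [h|h].
  - rewrite <- (Z2Nat.id m h), <- INR_IZR_INZ. apply Hn.
  - rewrite <- (Hn (Z.to_nat (- m)) (s + IZR m * (2 * PI))). f_equal.
    rewrite INR_IZR_INZ, Z2Nat.id, opp_IZR by lia. ring. }
destruct (base_Int_part (t / (2 * PI))) as [I1 I2].
set (q := Int_part (t / (2 * PI))) in *.
rewrite <- (Hz (- q)%Z t). apply HB. rewrite opp_IZR.
assert (Et : t = t / (2 * PI) * (2 * PI)) by (field; lra).
split; nra.
Qed.

(* By parts; periodicity removes the boundary terms. *)
Lemma trig_integral_decay (psi dpsi : R -> R) (K x : R) :
  (forall t, is_derive psi t (dpsi t)) -> (forall t, continuous dpsi t) ->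
  psi (2 * PI) = psi 0 -> (forall t, 0 <= t <= 2 * PI -> Rabs (dpsi t) <= K) ->
  cis (x * (2 * PI)) = RtoC 1 ->
  exists Ic Is : R,
    is_RInt (fun t => cos (x * t) * psi t) 0 (2 * PI) Ic /\ Rabs (x * Ic) <= 2 * PI * K /\
    is_RInt (fun t => sin (x * t) * psi t) 0 (2 * PI) Is /\ Rabs (x * Is) <= 2 * PI * K.
Proof.
intros Hd Hc Hp HK Hx. assert (PI0 := PI_RGT_0).
injection Hx as Hcos Hsin.
assert (Hcp : forall t, continuous psi t).
{ intros t. apply (ex_derive_continuous psi). eexists. apply Hd. }
assert (Hcc : forall t, continuous (fun t => cos (x * t)) t).
{ intros t. apply (ex_derive_continuous (fun t => cos (x * t))). now auto_derive. }
assert (Hcs : forall t, continuous (fun t => sin (x * t)) t).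
{ intros t. apply (ex_derive_continuous (fun t => sin (x * t))). now auto_derive. }
assert (ex : forall g h : R -> R, (forall t, continuous g t) -> (forall t, continuous h t) ->
  ex_RInt (fun t => g t * h t) 0 (2 * PI)).
{ intros g h Hg Hh. apply (ex_RInt_continuous (V := R_CompleteNormedModule)). intros t _.
  apply (continuous_mult (K := R_AbsRing) g h); auto. }
destruct (ex _ _ Hcc Hcp) as [Ic HIc]. destruct (ex _ _ Hcs Hcp) as [Is HIs].
destruct (ex _ _ Hcc Hc) as [Jc HJc]. destruct (ex _ _ Hcs Hc) as [Js HJs].
exists Ic, Is.
assert (bnd : forall (g : R -> R) (J : R), (forall t, Rabs (g t) <= 1) ->
  is_RInt (fun t => g t * dpsi t) 0 (2 * PI) J -> Rabs J <= 2 * PI * K).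
{ intros g J Hg HJ. rewrite <- (is_RInt_unique _ _ _ _ HJ).
  replace (2 * PI * K) with ((2 * PI - 0) * K) by ring.
  apply abs_RInt_le_const; [lra | eexists; exact HJ |].
  intros t Ht. rewrite Rabs_mult. specialize (HK t Ht).
  generalize (Hg t) (Rabs_pos (g t)) (Rabs_pos (dpsi t)). nra. }
assert (Pc : x * Ic + Js = 0).
{ assert (D : is_RInt (fun t => x * cos (x * t) * psi t + sin (x * t) * dpsi t) 0 (2 * PI)
    (minus (sin (x * (2 * PI)) * psi (2 * PI)) (sin (x * 0) * psi 0))).
  { apply (is_RInt_derive (fun t => sin (x * t) * psi t)).
    - intros t _. apply (is_derive_mul_R (fun t => sin (x * t)) psi); [|apply Hd]. auto_derive; [auto | ring].
    - intros t _. apply (continuous_plus (fun t => x * cos (x * t) * psi t) (fun t => sin (x * t) * dpsi t)).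
      + apply (continuous_mult (K := R_AbsRing) (fun t => x * cos (x * t)) psi); [|apply Hcp].
        apply (continuous_scal_r (V := R_NormedModule) x (fun t => cos (x * t))), Hcc.
      + apply (continuous_mult (K := R_AbsRing) (fun t => sin (x * t)) dpsi); auto. }
  assert (D' := is_RInt_plus _ _ _ _ _ _ (is_RInt_scal _ _ _ x _ HIc) HJs).
  apply (is_RInt_unique (V := R_CompleteNormedModule)) in D.
  assert (D2 : RInt (V := R_CompleteNormedModule) (fun t => x * cos (x * t) * psi t + sin (x * t) * dpsi t) 0 (2 * PI)
    = x * Ic + Js).
  { apply (is_RInt_unique (V := R_CompleteNormedModule)). eapply is_RInt_ext; [|exact D'].
    intros t _. unfold plus, scal; simpl. unfold mult; simpl. ring. }
  rewrite <- D2, D, Hsin, Rmult_0_r, sin_0. unfold minus, plus, opp; simpl. ring. }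
assert (Ps : x * Is - Jc = 0).
{ assert (D : is_RInt (fun t => x * sin (x * t) * psi t + - cos (x * t) * dpsi t) 0 (2 * PI)
    (minus (- cos (x * (2 * PI)) * psi (2 * PI)) (- cos (x * 0) * psi 0))).
  { apply (is_RInt_derive (fun t => - cos (x * t) * psi t)).
    - intros t _. apply (is_derive_mul_R (fun t => - cos (x * t)) psi); [|apply Hd]. auto_derive; [auto | ring].
    - intros t _. apply (continuous_plus (fun t => x * sin (x * t) * psi t) (fun t => - cos (x * t) * dpsi t)).
      + apply (continuous_mult (K := R_AbsRing) (fun t => x * sin (x * t)) psi); [|apply Hcp].
        apply (continuous_scal_r (V := R_NormedModule) x (fun t => sin (x * t))), Hcs.
      + apply (continuous_mult (K := R_AbsRing) (fun t => - cos (x * t)) dpsi); [|auto].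
        apply (continuous_opp (V := R_NormedModule) (fun t => cos (x * t))), Hcc. }
  assert (D' := is_RInt_minus _ _ _ _ _ _ (is_RInt_scal _ _ _ x _ HIs) HJc).
  apply (is_RInt_unique (V := R_CompleteNormedModule)) in D.
  assert (D2 : RInt (V := R_CompleteNormedModule) (fun t => x * sin (x * t) * psi t + - cos (x * t) * dpsi t) 0 (2 * PI)
    = x * Is - Jc).
  { apply (is_RInt_unique (V := R_CompleteNormedModule)). eapply is_RInt_ext; [|exact D'].
    intros t _. unfold minus, plus, opp, scal; simpl. unfold mult; simpl. ring. }
  rewrite <- D2, D, Hcos, Rmult_0_r, cos_0, Hp. unfold minus, plus, opp; simpl. ring. }
assert (Bc : Rabs Jc <= 2 * PI * K).
{ apply (bnd (fun t => cos (x * t))); [|exact HJc].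
  intros t. apply Rabs_le. generalize (COS_bound (x * t)). lra. }
assert (Bs : Rabs Js <= 2 * PI * K).
{ apply (bnd (fun t => sin (x * t))); [|exact HJs].
  intros t. apply Rabs_le. generalize (SIN_bound (x * t)). lra. }
change (x * Ic + Js = 0) in Pc. change (x * Is - Jc = 0) in Ps.
split; [exact HIc|]. split; [|split; [exact HIs|]].
- replace (x * Ic) with (- Js) by lra. now rewrite Rabs_Ropp.
- now replace (x * Is) with Jc by lra.
Qed.

Lemma test_function_part (phi : R -> C) (p : C -> R) :
  (forall (n : nat) (t : R), ex_derive_n (fun s => p (phi s)) n t) ->
  (forall t, phi (t + 2 * PI) = phi t) ->
  exists (d : R -> R) (K : R), (forall t, is_derive (fun s => p (phi s)) t (d t)) /\
    (forall t, continuous d t) /\ p (phi (2 * PI)) = p (phi 0) /\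
    (forall t, 0 <= t <= 2 * PI -> Rabs (d t) <= K).
Proof.
intros H Hp. assert (PI0 := PI_RGT_0).
set (d := Derive (fun s => p (phi s))).
assert (Hc : forall t, continuous d t).
{ intros t. apply (ex_derive_continuous d). exact (H 2%nat t). }
destruct (continuous_bounded_segment d (2 * PI) ltac:(lra) Hc) as [K HK].
exists d, K. split; [|split; [exact Hc|split; [|exact HK]]].
- intros t. apply Derive_correct. exact (H 1%nat t).
- rewrite <- (Hp 0). do 2 f_equal. ring.
Qed.

Lemma Cmod_le_Re_Im (z : C) : Cmod z <= Rabs (Re z) + Rabs (Im z).
Proof.
replace z with (RtoC (Re z) + Ci * RtoC (Im z))%C at 1 by (apply C_ext; simpl; ring).
eapply Rle_trans; [apply Cmod_triangle|]. rewrite Cmod_mult, Cmod_Ci, !Cmod_R. lra.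
Qed.

(** A single integration by parts suffices: 1/|n| decay here meets 1/|n| decay of the extremal
    coefficients. The product form covers n = 0 without a case distinction. *)
Lemma test_function_fourier_decay (phi : R -> C) : test_function phi ->
  exists (m : Z -> C) (D : R),
    (forall n, is_RInt_C (fun t => (cis (IZR n * t) * phi t)%C) 0 (2 * PI) (m n)) /\
    (forall n, Cmod (m n) * INR (Z.abs_nat n) <= D).
Proof.
intros [H Hp].
destruct (test_function_part phi Re (fun n t => proj1 (H n t)) Hp) as [d1 [K1 [A1 [A2 [A3 A4]]]]].
destruct (test_function_part phi Im (fun n t => proj2 (H n t)) Hp) as [d2 [K2 [B1 [B2 [B3 B4]]]]].
assert (P : forall n : Z, exists mn : C,
  is_RInt_C (fun t => (cis (IZR n * t) * phi t)%C) 0 (2 * PI) mn /\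
  (* Four real integrals occur, a cosine and a sine one for each part of phi, bounded by 2 pi K1 or
     2 pi K2, two of each kind. *)
  Cmod mn * INR (Z.abs_nat n) <= 4 * PI * (K1 + K2)).
{ intros n.
  destruct (trig_integral_decay _ _ K1 (IZR n) A1 A2 A3 A4 (cis_2PI_Z n)) as [c1 [s1 [C1 [C2 [C3 C4]]]]].
  destruct (trig_integral_decay _ _ K2 (IZR n) B1 B2 B3 B4 (cis_2PI_Z n)) as [c2 [s2 [D1 [D2 [D3 D4]]]]].
  exists (c1 - s2, c2 + s1). split.
  - apply is_RInt_C_iff. split.
    + exact (is_RInt_minus _ _ _ _ _ _ C1 D3).
    + exact (is_RInt_plus _ _ _ _ _ _ D1 C3).
  - eapply Rle_trans; [apply Rmult_le_compat_r; [apply pos_INR | apply Cmod_le_Re_Im]|].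
    change (Re (c1 - s2, c2 + s1)) with (c1 - s2). change (Im (c1 - s2, c2 + s1)) with (c2 + s1).
    assert (En : INR (Z.abs_nat n) = Rabs (IZR n)).
    { rewrite INR_IZR_INZ, Nat2Z.inj_abs_nat. apply abs_IZR. }
    rewrite En, Rmult_plus_distr_r, <- !Rabs_mult.
    replace ((c1 - s2) * IZR n) with (IZR n * c1 + - (IZR n * s2)) by ring.
    replace ((c2 + s1) * IZR n) with (IZR n * c2 + IZR n * s1) by ring.
    assert (T1 := Rabs_triang (IZR n * c1) (- (IZR n * s2))). rewrite Rabs_Ropp in T1.
    assert (T2 := Rabs_triang (IZR n * c2) (IZR n * s1)). lra. }
exists (fun n => RInt (V := C_R_CompleteNormedModule) (fun t => (cis (IZR n * t) * phi t)%C) 0 (2 * PI)),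
  (4 * PI * (K1 + K2)).
split; intros n; destruct (P n) as [mn [P1 P2]];
rewrite (is_RInt_unique (V := C_R_CompleteNormedModule) _ _ _ _ P1); assumption.
Qed.

Lemma test_function_bounded (phi : R -> C) : test_function phi ->
  exists B, forall t, Cmod (phi t) <= B.
Proof.
intros [H Hp].
destruct (periodic_bounded (fun t => Re (phi t))) as [B1 H1].
{ intros t. apply (ex_derive_continuous (fun t => Re (phi t))). exact (proj1 (H 1%nat t)). }
{ intros t. now rewrite Hp. }
destruct (periodic_bounded (fun t => Im (phi t))) as [B2 H2].
{ intros t. apply (ex_derive_continuous (fun t => Im (phi t))). exact (proj2 (H 1%nat t)). }
{ intros t. now rewrite Hp. }
exists (B1 + B2). intros t. eapply Rle_trans; [apply Cmod_le_Re_Im|].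
specialize (H1 t). specialize (H2 t). lra.
Qed.

Lemma ex_series_inv_sq : ex_series (fun k => / INR (S k) ^ 2).
Proof.
assert (P : forall k, 0 < INR (S k)) by (intros; apply lt_0_INR; lia).
apply ex_series_bounded with 2.
- intros n. left. apply Rinv_0_lt_compat. generalize (P n). nra.
- assert (H : forall n, sum_n (fun k => / INR (S k) ^ 2) n <= 2 - / INR (S n)).
  { induction n as [|n IH].
    - rewrite sum_O. simpl. lra.
    - rewrite sum_Sn. change plus with Rplus.
      assert (Pn := P n). rewrite (S_INR (S n)). set (x := INR (S n)) in *.
      (* The telescoping comparison that keeps the partial sums below 2 - 1 / (n + 1). *)
      assert (E : / (x + 1) ^ 2 <= / x - / (x + 1)).
      { replace (/ x - / (x + 1)) with (/ (x * (x + 1))) by (field; lra).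
        apply Rinv_le_contravar; nra. }
      lra. }
  intros n. specialize (H n). assert (Hi := Rinv_0_lt_compat _ (P n)).
  change (sum_n (fun k => / INR (S k) ^ 2) n <= 2). lra.
Qed.

Lemma tannery_C {T} (F : (T -> Prop) -> Prop) {FF : ProperFilter F}
    (u : nat -> T -> C) (l : nat -> C) (a : nat -> R) (s : T -> C) :
  ex_series a ->
  (forall n, filterlim (u n) F (locally (T := C_UniformSpace) (l n))) ->
  F (fun x => (forall n, Cmod (u n x) <= a n) /\ is_series_C (fun n => u n x) (s x)) ->
  exists L, filterlim s F (locally (T := C_UniformSpace) L).
Proof.
intros Ha Hl Hs.
destruct (tannery F (fun n x => Re (u n x)) (fun n => Re (l n)) a (fun x => Re (s x))) as [L1 [_ H1]]; auto.
{ intros n. revert Hs. apply filter_imp. intros x [H _]. eapply Rle_trans; [apply Rabs_Re_le | apply H]. }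
{ intros n. exact (proj1 (proj1 (filterlim_C F (u n) (l n)) (Hl n))). }
{ revert Hs. apply filter_imp. intros x [H Hx]. apply is_series_C_iff in Hx as [Hx _].
  split; [|exact Hx]. intros n. eapply Rle_trans; [apply Rabs_Re_le | apply H]. }
destruct (tannery F (fun n x => Im (u n x)) (fun n => Im (l n)) a (fun x => Im (s x))) as [L2 [_ H2]]; auto.
{ intros n. revert Hs. apply filter_imp. intros x [H _]. eapply Rle_trans; [apply Rabs_Im_le | apply H]. }
{ intros n. exact (proj2 (proj1 (filterlim_C F (u n) (l n)) (Hl n))). }
{ revert Hs. apply filter_imp. intros x [H Hx]. apply is_series_C_iff in Hx as [_ Hx].
  split; [|exact Hx]. intros n. eapply Rle_trans; [apply Rabs_Im_le | apply H]. }
exists (L1, L2). apply filterlim_C; [apply filter_filter|]. split; assumption.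
Qed.

Lemma pairing_spec (g phi : R -> C) (J : C) :
  is_RInt_C (fun t => (g t * phi t)%C) 0 (2 * PI) J ->
  function_pairing g phi = (RtoC (/ (2 * PI)) * J)%C.
Proof.
intros H. unfold function_pairing.
now rewrite (is_RInt_unique (V := C_R_CompleteNormedModule) _ _ _ _ H).
Qed.

Lemma radial_integral_exists c f phi r :
  has_expansion 0 c f -> limsup_root_le_1 c -> test_function phi -> 0 < r < 1 ->
  exists J, is_RInt_C (fun t => (f (polar r t) * phi t)%C) 0 (2 * PI) J.
Proof.
intros Hf Hc Hphi Hr.
destruct (test_function_fourier_decay phi Hphi) as [m [D [Hm _]]].
destruct (test_function_bounded phi Hphi) as [B HB].
destruct (radial_coef_summable 0 c r ltac:(lra) ltac:(lra) Hc) as [b [Hb1 Hb2]].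
destruct (integral_laurent _ b (fun t => f (polar r t)) phi B m Hb2 Hb1 HB Hm) as [J [_ HJ]].
- intros t. apply expansion_laurent; [assumption | lra].
- now exists J.
Qed.

(** At radius r the pairing is the sum of r^|n| c_n m_n / (2 pi), where m_n are the moments of phi.
    The terms are dominated by C0 D / (2 pi n^2) for n <> 0, so the limit r -> 1 passes inside. *)
Lemma radial_pairing_converges c f phi C0 :
  has_expansion 0 c f -> limsup_root_le_1 c ->
  (forall n, Cmod (c n) * INR (Z.abs_nat n) <= C0) -> test_function phi ->
  exists L, filterlim (fun r => function_pairing (fun t => f (polar r t)) phi)
    (at_left 1) (locally (T := C_UniformSpace) L).
Proof.
intros Hf Hc HC Hphi.
destruct (test_function_fourier_decay phi Hphi) as [m [D [Hm HD]]].
destruct (test_function_bounded phi Hphi) as [B HB].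
set (A := fun n => (RtoC (/ (2 * PI)) * (c n * m n))%C).
set (u := fun k r => (RtoC (r ^ k) * A (Z.of_nat k) + RtoC (r ^ S k) * A (- Z.of_nat (S k))%Z)%C).
assert (P := at_left_1_filter).
apply (tannery_C (at_left 1) u (fun k => (A (Z.of_nat k) + A (- Z.of_nat (S k))%Z)%C)
  (fun k => Cmod (A (Z.of_nat k)) + Cmod (A (- Z.of_nat (S k))%Z))).
- assert (HA : forall n : Z, n <> 0%Z ->
    Cmod (A n) <= Rabs (/ (2 * PI)) * (C0 * D) * / INR (Z.abs_nat n) ^ 2).
  { intros n Hn. assert (Pn : 0 < INR (Z.abs_nat n)) by (apply lt_0_INR; lia).
    unfold A. rewrite !Cmod_mult, Cmod_R, Rmult_assoc. apply Rmult_le_compat_l; [apply Rabs_pos|].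
    apply Rmult_le_reg_r with (INR (Z.abs_nat n) ^ 2); [nra|].
    rewrite (Rmult_assoc _ (/ _)), Rinv_l, Rmult_1_r by nra.
    replace (Cmod (c n) * Cmod (m n) * INR (Z.abs_nat n) ^ 2)
      with ((Cmod (c n) * INR (Z.abs_nat n)) * (Cmod (m n) * INR (Z.abs_nat n))) by ring.
    apply Rmult_le_compat; auto; apply Rmult_le_pos; auto using Cmod_ge_0; lra. }
  assert (HQ : 0 <= Rabs (/ (2 * PI)) * (C0 * D)).
  { apply Rmult_le_pos; [apply Rabs_pos|].
    assert (Hc0 := HC 0%Z). assert (Hd0 := HD 0%Z). simpl in Hc0, Hd0.
    apply Rmult_le_pos; lra. }
  apply (ex_series_incr_1 (K := R_AbsRing) (V := R_NormedModule)).
  apply (ex_series_le (K := R_AbsRing) (V := R_CompleteNormedModule) _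
    (fun k => (2 * (Rabs (/ (2 * PI)) * (C0 * D))) * / INR (S k) ^ 2)).
  + intros k. set (Q := Rabs (/ (2 * PI)) * (C0 * D)) in *.
    assert (H1 := HA (Z.of_nat (S k)) ltac:(lia)).
    assert (H2 := HA (- Z.of_nat (S (S k)))%Z ltac:(lia)).
    replace (Z.abs_nat (Z.of_nat (S k))) with (S k) in H1 by lia.
    replace (Z.abs_nat (- Z.of_nat (S (S k)))) with (S (S k)) in H2 by lia.
    match goal with |- norm ?x <= _ => change (Rabs x <= 2 * Q * / INR (S k) ^ 2) end.
    rewrite Rabs_pos_eq by (apply Rplus_le_le_0_compat; apply Cmod_ge_0).
    assert (Hk : 0 < INR (S k)) by (apply lt_0_INR; lia).
    assert (I2 : / INR (S (S k)) ^ 2 <= / INR (S k) ^ 2).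
    { apply Rinv_le_contravar; [nra|]. rewrite (S_INR (S k)). nra. }
    assert (Q * / INR (S (S k)) ^ 2 <= Q * / INR (S k) ^ 2) by now apply Rmult_le_compat_l.
    lra.
  + apply (ex_series_scal (K := R_AbsRing) (V := R_NormedModule)), ex_series_inv_sq.
- intros k. apply filterlim_C; [apply filter_filter|].
  assert (G : forall a b : R, filterlim (fun r => r ^ k * a + r ^ S k * b) (at_left 1) (locally (1 * a + 1 * b))).
  { intros a b. eapply filterlim_comp_2; [| |apply (filterlim_plus (K := R_AbsRing) (V := R_NormedModule))];
    (apply filterlim_mult_R; [apply filterlim_pow_at_left_1 | apply filterlim_const]). }
  split.
  + assert (GR := G (Re (A (Z.of_nat k))) (Re (A (- Z.of_nat (S k))%Z))).
    rewrite !Rmult_1_l in GR. eapply filterlim_ext; [|exact GR].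
    intros r. unfold u. simpl. ring.
  + assert (GI := G (Im (A (Z.of_nat k))) (Im (A (- Z.of_nat (S k))%Z))).
    rewrite !Rmult_1_l in GI. eapply filterlim_ext; [|exact GI].
    intros r. unfold u. simpl. ring.
- generalize at_left_1_unit. apply filter_imp. intros r Hr. split.
  + intros k. unfold u. eapply Rle_trans; [apply Cmod_triangle|]. rewrite !Cmod_mult, !Cmod_R.
    assert (B1 := pow_le_1 r k ltac:(lra)). assert (B2 := pow_le_1 r (S k) ltac:(lra)).
    rewrite !(Rabs_pos_eq (r ^ _)) by (apply pow_le; lra).
    generalize (Cmod_ge_0 (A (Z.of_nat k))) (Cmod_ge_0 (A (- Z.of_nat (S k))%Z)). nra.
  + destruct (radial_coef_summable 0 c r ltac:(lra) ltac:(lra) Hc) as [b [Hb1 Hb2]].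
    destruct (integral_laurent _ b (fun t => f (polar r t)) phi B m Hb2 Hb1 HB Hm) as [J [HJ1 HJ2]].
    { intros t. apply expansion_laurent; [assumption | lra]. }
    rewrite (pairing_spec _ _ _ HJ2).
    apply (is_series_scal (K := C_AbsRing) (V := C_NormedModule) (RtoC (/ (2 * PI)))) in HJ1.
    eapply is_series_C_ext; [|exact HJ1]. intros k. cbv beta. unfold radial_coef, u, A.
    rewrite !F_alpha_0.
    replace (Z.abs_nat (Z.of_nat k)) with k by lia.
    replace (Z.abs_nat (- Z.of_nat (S k))) with (S k) by lia.
    match goal with |- scal ?x ?y = _ => change (scal x y) with (x * y)%C end. ring.
Qed.

(** A distribution is encoded as a total map on functions, whereas the limit is known to exist for
    test functions only; [iota] on each component chooses it there. Linearity and continuity pass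
    from the pairings at r < 1 to the limit. *)
Lemma boundary_distribution M c f C0 : 0 < M ->
  has_expansion 0 c f -> limsup_root_le_1 c ->
  (forall n, Cmod (c n) * INR (Z.abs_nat n) <= C0) ->
  (forall z, in_disk z -> Cmod (f z) <= M) ->
  exists fstar, circle_distribution fstar /\ boundary_value f fstar.
Proof.
intros HM Hf Hc HC Hb. assert (PI0 := PI_RGT_0). assert (P := at_left_1_filter).
set (pair := fun phi r => function_pairing (fun t => f (polar r t)) phi).
set (fstar := fun phi : R -> C =>
  (iota (fun l : R => filterlim (fun r => Re (pair phi r)) (at_left 1) (locally l)),
   iota (fun l : R => filterlim (fun r => Im (pair phi r)) (at_left 1) (locally l))) : C).
assert (val : forall phi L, filterlim (pair phi) (at_left 1) (locally (T := C_UniformSpace) L) ->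
  fstar phi = L).
{ intros phi L HL. apply (filterlim_C (at_left 1)) in HL. destruct HL as [H1 H2].
  apply C_ext.
  - apply (iota_filterlim_locally (K := R_AbsRing) (V := R_CompleteNormedModule)). exact H1.
  - apply (iota_filterlim_locally (K := R_AbsRing) (V := R_CompleteNormedModule)). exact H2. }
assert (lim : forall phi, test_function phi ->
  filterlim (pair phi) (at_left 1) (locally (T := C_UniformSpace) (fstar phi))).
{ intros phi Hphi. destruct (radial_pairing_converges c f phi C0 Hf Hc HC Hphi) as [L HL].
  now rewrite (val phi L HL). }
exists fstar. split; [|exact lim].
split; [|split].
- intros phi psi Hphi Hpsi. apply val.
  apply filterlim_ext_loc with (fun r => (pair phi r + pair psi r)%C).
  + generalize at_left_1_unit. apply filter_imp. intros r Hr.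
    destruct (radial_integral_exists c f phi r Hf Hc Hphi Hr) as [J1 HJ1].
    destruct (radial_integral_exists c f psi r Hf Hc Hpsi Hr) as [J2 HJ2].
    unfold pair. rewrite (pairing_spec _ _ _ HJ1), (pairing_spec _ _ _ HJ2).
    rewrite (pairing_spec _ _ (J1 + J2)%C); [ring|].
    eapply is_RInt_C_ext; [|exact (is_RInt_C_plus _ _ _ _ _ _ HJ1 HJ2)].
    intros t. cbv beta. ring.
  + eapply filterlim_comp_2; [apply (lim _ Hphi) | apply (lim _ Hpsi) |].
    apply (filterlim_plus (K := C_AbsRing) (V := C_NormedModule)).
- intros a phi Hphi. apply val.
  apply filterlim_ext_loc with (fun r => (a * pair phi r)%C).
  + generalize at_left_1_unit. apply filter_imp. intros r Hr.
    destruct (radial_integral_exists c f phi r Hf Hc Hphi Hr) as [J1 HJ1].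
    unfold pair. rewrite (pairing_spec _ _ _ HJ1).
    rewrite (pairing_spec _ _ (a * J1)%C); [ring|].
    eapply is_RInt_C_ext; [|exact (is_RInt_C_scal _ _ _ a _ HJ1)].
    intros t. cbv beta. ring.
  + eapply filterlim_comp; [apply (lim _ Hphi)|].
    apply (filterlim_scal_r (K := C_AbsRing) (V := C_NormedModule) a).
(* Order 0 suffices: |f| <= M and the normalized arc length bound every pairing by M sup |phi|. *)
- exists 0%nat, M. intros phi B Hphi HB.
  assert (HB' : forall t, Cmod (phi t) <= B).
  { intros t. specialize (HB 0%nat t (le_n _)).
    replace (phi t) with (CDerive_n phi 0 t); [exact HB|].
    unfold CDerive_n. simpl. now destruct (phi t). }
  assert (E : Rbar_le (Cmod (fstar phi)) (M * B)); [|exact E].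
  apply (filterlim_le (F := at_left 1) (fun r => Cmod (pair phi r)) (fun _ => M * B)).
  + generalize at_left_1_unit. apply filter_imp. intros r Hr.
    destruct (radial_integral_exists c f phi r Hf Hc Hphi Hr) as [J HJ].
    unfold pair. rewrite (pairing_spec _ _ _ HJ), Cmod_mult, Cmod_R.
    rewrite Rabs_pos_eq by (left; apply Rinv_0_lt_compat; lra).
    assert (Q : Cmod J <= (2 * PI - 0) * (M * B)).
    { refine (Cmod_RInt_le _ (fun _ => M * B) 0 (2 * PI) _ _ ltac:(lra) _ HJ (is_RInt_cst (M * B) 0 (2 * PI))).
      intros t. rewrite Cmod_mult. apply Rmult_le_compat; auto using Cmod_ge_0.
      apply Hb. unfold in_disk. rewrite Cmod_polar; lra. }
    apply Rmult_le_reg_l with (2 * PI); [lra|].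
    rewrite <- Rmult_assoc, Rinv_r, Rmult_1_l by lra. lra.
  + eapply filterlim_comp; [apply (lim _ Hphi)|].
    apply filterlim_ext with (norm (K := C_AbsRing) (V := C_NormedModule)).
    { reflexivity. }
    change (Finite (Cmod (fstar phi))) with (Finite (norm (K := C_AbsRing) (V := C_NormedModule) (fstar phi))).
    apply (filterlim_norm (K := C_AbsRing) (V := C_NormedModule)).
  + apply filterlim_const.
Qed.

(** * Extremality *)

Lemma extremal_map_extremal M k eps theta f : 0 < M -> (1 <= k)%nat ->
  Cmod eps = 1 -> Cmod theta = 1 ->
  (forall z, in_disk z -> f z = extremal_map M k eps theta z) -> extremal M k f.
Proof.
intros HM Hk He Ht Hf. assert (PI0 := PI_RGT_0).
assert (X := extremal_map_expansion M k eps theta f Hk Ht Hf).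
assert (B := fun n => extremal_coef_bound M k eps theta n HM Hk He Ht).
assert (L := limsup_root_of_bound _ _ B).
assert (Hb : forall z, in_disk z -> Cmod (f z) <= M).
{ intros z Hz. rewrite Hf by assumption. now apply extremal_map_bound. }
destruct (boundary_distribution M _ f _ HM X L B Hb) as [fstar [D1 D2]].
exists fstar, (extremal_coef M k eps theta). split.
- split; [|split; [exact X | split; [exact L | exact Hb]]].
  split; [now apply (extremal_map_C2 M k eps theta)|].
  split; [|split; assumption].
  intros z Hz. now apply (extremal_map_harmonic M k eps theta).
- destruct (extremal_coef_k M k eps theta Hk) as [-> ->].
  rewrite F_alpha_0, !Cmod_mult, extremal_factor_Cmod by assumption.
  rewrite Cmod_opp, Cmod_Ci, Cmod_Cconj, Ht, Cmod_1. field. lra.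
Qed.

Lemma extremal_is_extremal_map M k f : 0 < M -> (1 <= k)%nat -> extremal M k f ->
  exists eps theta, Cmod eps = 1 /\ Cmod theta = 1 /\
    forall z, in_disk z -> f z = extremal_map M k eps theta z.
Proof.
intros HM Hk [fstar [c [[_ [X [L Hb]]] Heq]]]. assert (PI0 := PI_RGT_0).
rewrite F_alpha_0, !Cmult_1_r in Heq.
destruct (polar_form (c (Z.of_nat k))) as [a Ea].
destruct (polar_form (c (- Z.of_nat k)%Z)) as [b Eb].
destruct (angle_split a b) as [gamma [beta [-> ->]]].
(* The coefficients of the extremal map at k and -k carry -i theta and i conj theta. The factor i in
   theta turns these into e^{i beta} and e^{-i beta}, so the phases become gamma + beta and gamma -
   beta, as for f. *)
set (eps := cis gamma). set (theta := (Ci * cis beta)%C).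
assert (He : Cmod eps = 1) by apply Cmod_cis.
assert (Ht : Cmod theta = 1) by (unfold theta; rewrite Cmod_mult, Cmod_Ci, Cmod_cis; ring).
exists eps, theta. split; [exact He|split; [exact Ht|]]. intros z Hz.
assert (X' := extremal_map_expansion M k eps theta _ Hk Ht (fun z _ => eq_refl)).
assert (L' := limsup_root_of_bound _ _ (fun n => extremal_coef_bound M k eps theta n HM Hk He Ht)).
destruct (extremal_coef_k M k eps theta Hk) as [Ck Ck'].
assert (Ef : (RtoC 2 * eps * RtoC M / RtoC PI)%C = (RtoC (2 * M / PI) * eps)%C).
{ rewrite RtoC_div, RtoC_mult by lra. field. apply RtoC_neq_0. lra. }
refine (expansion_unique 0 _ _ f _ z X X' _ Hz).
apply (extremal_coefficients_unique M f (extremal_map M k eps theta) c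
  (extremal_coef M k eps theta) k gamma beta _ _ (2 * M / PI) (2 * M / PI) HM Hk
  L X Hb L' X' (fun z _ => extremal_map_bound M k eps theta z HM Hk He) Ea Eb).
- rewrite Ck, Ef, cis_plus. unfold eps, theta.
  replace (RtoC (2 * M / PI) * cis gamma * - Ci * (Ci * cis beta))%C
    with (- (Ci * Ci) * (RtoC (2 * M / PI) * (cis gamma * cis beta)))%C by ring.
  replace (- (Ci * Ci))%C with (RtoC 1) by (apply C_ext; simpl; ring). ring.
- rewrite Ck', Ef. unfold Rminus. rewrite cis_plus. unfold eps, theta.
  rewrite Cmult_conj, Cconj_cis.
  replace (RtoC (2 * M / PI) * cis gamma * Ci * (Cconj Ci * cis (- beta)))%C
    with (Ci * Cconj Ci * (RtoC (2 * M / PI) * (cis gamma * cis (- beta))))%C by ring.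
  replace (Ci * Cconj Ci)%C with (RtoC 1) by (apply C_ext; simpl; ring). ring.
- exact Heq.
- field. lra.
Qed.

Theorem theorem3 :
  (forall (alpha M : R) (f : C -> C) (fstar : (R -> C) -> C) (c : Z -> C),
     -1 < alpha -> 0 < M ->
     bounded_solution alpha M f fstar c ->
     (forall k : nat, (1 <= k)%nat ->
        Cmod (c (Z.of_nat k) * RtoC (F_alpha alpha k 1))
        + Cmod (c (- Z.of_nat k)%Z * RtoC (F_alpha alpha k 1))
        <= 4 * M / PI) /\
     Cmod (c 0%Z * RtoC (F_alpha alpha 0 1)) <= M)
  /\
  (forall (M : R) (k : nat), 0 < M -> (1 <= k)%nat ->
     (exists f : C -> C, extremal M k f) /\
     (forall f : C -> C,
        extremal M k f <->
        exists eps theta : C,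
          Cmod eps = 1 /\ Cmod theta = 1 /\
          forall z : C, in_disk z -> f z = extremal_map M k eps theta z)).
Proof.
split.
- intros alpha M f fstar c Ha HM [_ [X [L Hb]]]. split.
  + intros k Hk. now apply (coefficient_bound alpha M f c k).
  + now apply (zeroth_coefficient_bound alpha M f c).
- intros M k HM Hk. split.
  + exists (extremal_map M k (RtoC 1) (RtoC 1)).
    apply (extremal_map_extremal M k (RtoC 1) (RtoC 1)); auto using Cmod_1.
  + intros f. split; [now apply extremal_is_extremal_map|].
    intros [eps [theta [He [Ht Hf]]]]. now apply (extremal_map_extremal M k eps theta).
Qed.
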